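(* Let $(R,\mathfrak m,k)$ be a local ring with $\operatorname{char}(k)=2$ and let $P$ be a tiny complex over $R$. Then $\sum_j\operatorname{rank}_R(P_j)\ge 2^{\dim(R)-1}$. In particular, for every nonzero $R$-module $M$ of finite length, $\beta(M)\ge 2^{\dim(R)-1}$.
   Context: Local rings are commutative and Noetherian. A tiny complex over a local ring $R$ is a non-exact complex of finite rank free $R$-modules of the form $\cdots\to 0\to P_{\dim(R)}\to\cdots\to P_1\to P_0\to 0\to\cdots$ having finite length homology. For a finitely generated $R$-module $M$, $\beta(M)=\sum_j\dim_k\operatorname{Tor}_j^R(M,k)\in\mathbb N\cup\{\infty\}$ is its total Betti number. *)

(* Defs.v *)
From HB Require Import structures.
From mathcomp Require Import all_boot all_order all_algebra.
From mathcomp Require Import generic_quotient ring_quotient.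
From mathcomp Require Import boolp classical_sets.
From mathcomp Require Import constructive_ereal ereal esum.

Set Implicit Arguments.
Unset Strict Implicit.
Unset Printing Implicit Defensive.

Import GRing.Theory.
Local Open Scope ring_scope.
Local Open Scope quotient_scope.

(* Subsets are boolean predicates; with the axioms of boolp this is no
   restriction. *)

Section Chains.
Variable T : Type.

(* c 0 < c 1 < ... < c l is a strictly increasing chain, of length l, of
   subsets satisfying P; the values c i for i > l are irrelevant. *)
Definition strict_chain (P : {pred T} -> Prop) (l : nat)
    (c : nat -> {pred T}) : Prop :=
  (forall i, (i <= l)%N -> P (c i)) /\
  (forall i, (i < l)%N -> {subset c i <= c i.+1} /\ ~ {subset c i.+1 <= c i}).

End Chains.

Section LocalRings.
Variable R : comNzRingType.

Definition noetherian : Prop :=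
  forall I : {pred R^o}, GRing.submod_closed I ->
  exists (n : nat) (g : 'I_n -> R),
    forall x, x \in I <-> exists c : 'I_n -> R, x = \sum_i c i * g i.

(* idealr_closed includes properness. *)
Definition prime_ideal (I : {pred R}) : Prop :=
  idealr_closed I /\ prime_idealr_closed I.

Definition maximal_ideal (I : {pred R}) : Prop :=
  idealr_closed I /\
  forall J : {pred R}, idealr_closed J -> {subset I <= J} -> J =i I.

Definition noetherian_local (m : {pred R}) : Prop :=
  [/\ noetherian, maximal_ideal m & forall I, maximal_ideal I -> I =i m].

(* k, with the map pi, is the quotient of R by m. *)
Definition residue_field (m : {pred R}) (k : fieldType)
    (pi : {rmorphism R -> k}) : Prop :=
  (forall y, exists x, pi x = y) /\ (forall x, (x \in m) = (pi x == 0)).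

Definition krull_dim (d : nat) : Prop :=
  (exists c, strict_chain prime_ideal d c) /\
  (forall l c, strict_chain prime_ideal l c -> (l <= d)%N).

End LocalRings.

Section Modules.
Variable R : comNzRingType.

Definition nontrivial (M : lmodType R) : Prop := exists x : M, x != 0.

(* The length, i.e. the supremum of the lengths of chains of submodules, is
   finite. *)
Definition finite_length (M : lmodType R) : Prop :=
  exists n, forall l c,
    strict_chain (fun N : {pred M} => GRing.submod_closed N) l c -> (l <= n)%N.

End Modules.

Section QuotientModule.
Variables (R : comNzRingType) (M : lmodType R).
Variables (N : {pred M}) (N_submod : GRing.submod_closed N).

Definition submod_zmod : zmodClosed M :=
  HB.pack N (GRing.isZmodClosed.Build M N (GRing.submod_closedB N_submod)).

Definition quot_module : Type := Quotient.quot submod_zmod.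

HB.instance Definition _ := GRing.Zmodule.on quot_module.

Definition quot_class : M -> quot_module := \pi_(Quotient.quot submod_zmod).

Definition quot_scale (a : R) (u : quot_module) : quot_module :=
  quot_class (a *: repr (u : Quotient.quot submod_zmod)).

Lemma quot_class_surj (u : quot_module) : exists x, u = quot_class x.
Proof. by exists (repr (u : Quotient.quot submod_zmod)); rewrite /quot_class reprK. Qed.

Lemma quot_classE (x y : M) : (quot_class x == quot_class y) = (x - y \in N).
Proof. by rewrite (Quotient.idealrBE submod_zmod x y). Qed.

Lemma quot_classD (x y : M) :
  quot_class (x + y) = quot_class x + quot_class y.
Proof. exact: (raddfD (\pi_(Quotient.quot submod_zmod))). Qed.

Lemma quot_classZ a (x : M) : quot_class (a *: x) = quot_scale a (quot_class x).
Proof.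
apply/eqP; rewrite quot_classE -scalerBr; apply: (GRing.subsemimod_closedZ N_submod).
by rewrite -quot_classE /quot_class reprK.
Qed.

Fact quot_scaleA a b u : quot_scale a (quot_scale b u) = quot_scale (a * b) u.
Proof. by have [x ->] := quot_class_surj u; rewrite -!quot_classZ scalerA. Qed.

Fact quot_scale1 : left_id 1 quot_scale.
Proof. by move=> u; have [x ->] := quot_class_surj u; rewrite -quot_classZ scale1r. Qed.

Fact quot_scaleDr : right_distributive quot_scale +%R.
Proof.
move=> a u v; have [x ->] := quot_class_surj u; have [y ->] := quot_class_surj v.
by rewrite -quot_classD -!quot_classZ -quot_classD scalerDr.
Qed.

Fact quot_scaleDl u : {morph quot_scale^~ u : a b / a + b}.
Proof.
move=> a b; have [x ->] := quot_class_surj u.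
by rewrite -!quot_classZ -quot_classD scalerDl.
Qed.

HB.instance Definition _ := GRing.Zmodule_isLmodule.Build R quot_module
  quot_scaleA quot_scale1 quot_scaleDr quot_scaleDl.

End QuotientModule.

Section Homology.
Variables (R : comNzRingType) (m n p : nat).
Variables (A : 'M[R]_(m, n)) (B : 'M[R]_(n, p)).

Definition is_cycle : {pred 'rV[R]_n} := fun x => x *m B == 0.

Fact cycle_submod : GRing.submod_closed is_cycle.
Proof.
split=> [|a u v]; rewrite !unfold_in ?mul0mx// => /eqP u0 /eqP v0.
by rewrite mulmxDl -scalemxAl u0 v0 scaler0 addr0.
Qed.

HB.instance Definition _ := GRing.isSubmodClosed.Build R 'rV[R]_n is_cycle cycle_submod.

Record cycles := Cycles { cycles_val : 'rV[R]_n; _ : cycles_val \in is_cycle }.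

HB.instance Definition _ := [isSub for cycles_val].
HB.instance Definition _ := [Choice of cycles by <:].
HB.instance Definition _ := [SubChoice_isSubLmodule of cycles by <:].

Definition is_boundary : {pred cycles} :=
  fun z => `[< exists y : 'rV[R]_m, y *m A = val z >].

Fact boundary_submod : GRing.submod_closed is_boundary.
Proof.
split=> [|a u v]; rewrite !unfold_in.
  by apply/asboolP; exists 0; rewrite mul0mx raddf0.
move=> /asboolP[x xE] /asboolP[y yE]; apply/asboolP; exists (a *: x + y).
by rewrite mulmxDl -scalemxAl xE yE linearP.
Qed.

Definition mx_homology : lmodType R := quot_module boundary_submod.

End Homology.

(* Complexes ... -> R^(rk 2) -> R^(rk 1) -> R^(rk 0) -> 0 of finite rank free
   modules; elements of R^n are row vectors and matrices act on the right. *)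
Record free_complex (R : comNzRingType) := FreeComplex {
  rk : nat -> nat;
  differential : forall i, 'M[R]_(rk i.+1, rk i);
  differential2 : forall i, differential i.+1 *m differential i = 0
}.

Section FreeComplexes.
Variable R : comNzRingType.
Implicit Type P : free_complex R.

Definition rk_pred P (i : nat) : nat := if i is j.+1 then rk P j else 0%N.

(* The differential out of degree i; it is the map to 0 when i = 0. *)
Definition diff_out P (i : nat) : 'M[R]_(rk P i, rk_pred P i) :=
  match i with 0%N => 0 | j.+1 => differential P j end.

Definition homology P (i : nat) : lmodType R :=
  mx_homology (differential P i) (diff_out P i).

(* To be used with d the Krull dimension of R. *)
Definition tiny_complex (d : nat) P : Prop :=
  [/\ forall i, (d < i)%N -> rk P i = 0%N,
      forall i, finite_length (homology P i)
    & exists i, nontrivial (homology P i)].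

Definition zero_complex : free_complex R :=
  @FreeComplex R (fun=> 0%N) (fun=> 0) (fun=> mulmx0 _ _).

Definition free_resolution (M : lmodType R) P : Prop :=
  (exists eps : {linear 'rV[R]_(rk P 0) -> M},
    (forall y, exists x, eps x = y) /\
    (forall x, eps x = 0 <-> exists y, y *m differential P 0 = x)) /\
  (forall i, ~ nontrivial (homology P i.+1)).

(* A chosen resolution by finite rank free modules. One exists when R is
   Noetherian and M is finitely generated; otherwise the value may be junk. *)
Definition resolution (M : lmodType R) : free_complex R :=
  if pselect (exists P, free_resolution M P) is left exP
  then projT1 (cid exP) else zero_complex.

End FreeComplexes.

Section Tor.
Variables (R S : comNzRingType) (f : {rmorphism R -> S}).

Fact base_change_subproof (P : free_complex R) i :
  map_mx f (differential P i.+1) *m map_mx f (differential P i) = 0.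
Proof. by rewrite -map_mxM differential2 map_mx0. Qed.

(* P tensored over R with S. *)
Definition base_change (P : free_complex R) : free_complex S :=
  FreeComplex (base_change_subproof P).

(* Tor_j^R(M, S), where S is an R-module through f. *)
Definition Tor (M : lmodType R) (j : nat) : lmodType S :=
  homology (base_change (resolution M)) j.

End Tor.

(* Dimension of a finite-dimensional vector space (0 if V has no finite
   basis, which never occurs for the spaces Tor M j). *)
Definition vdim (k : fieldType) (V : lmodType k) : nat :=
  xget 0%N [set n : nat | exists e : {linear 'rV[k]_n -> V}, bijective e]%classic.

Definition betti (R : comNzRingType) (k : fieldType) (pi : {rmorphism R -> k})
    (M : lmodType R) (j : nat) : nat :=
  vdim (Tor pi M j).

(* The value is a natural number or +oo. *)
Definition total_betti (R : comNzRingType) (k : fieldType)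
    (pi : {rmorphism R -> k}) (M : lmodType R) : \bar rat :=
  \esum_(j in [set: nat]%classic) ((betti pi M j)%:R)%:E.

(* Main.v *)
(* Reduce modulo 2 and fix a differential module F = R^n with differential D,
   D^2 = 0, strictly lowering degrees, with entries in m and with homology of
   finite length h.  On the tensor square of F let d = D (x) 1 + 1 (x) D and
   s = 1 + swap; in characteristic 2, d + t s squares to 0 over the Laurent
   series ring R((t)).  Filtering one tensor factor, the homology of d has
   length at most n h, and comparing initial forms in t this bounds the length
   of the homology of d + t s.  But t s is exact off the diagonal, so d + t s
   retracts onto a differential module of rank n again, whose differential has
   entries in m^2.  After e steps the length of R / (2, m^(2^e)) is at most
   n^e h, hence that of R / m^(2^e) is at most (2 n)^e h.  By the Artin-Rees
   lemma the latter grows at least like a constant times 2^(d e), so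
   2^d <= 2 n.  A complex is first replaced by its minimal model, the rank of
   which is the total Betti number in the case of a resolution. *)

From HB Require Import structures.
Require Import Defs.
From mathcomp Require Import all_boot all_order all_algebra.
From mathcomp Require Import generic_quotient ring_quotient.
From mathcomp Require Import zify ring.
From mathcomp Require Import boolp classical_sets functions cardinality fsbigop.
From mathcomp Require Import constructive_ereal ereal esum.

Set Implicit Arguments.
Unset Strict Implicit.
Unset Printing Implicit Defensive.

Import Order.TTheory GRing.Theory Num.Theory.
Local Open Scope ring_scope.
Local Open Scope classical_set_scope.

(** * Chains of submodules and length of homology *)

(** Each round doubles the order [q] of the entries and multiplies the length of homology by [n],
    while the rank must not grow; the obstacle is that the tensor square has rank [n^2]. Inverting
    [t] removes it: off the diagonal everything cancels, and on the diagonal the first order part of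
    the transferred differential vanishes, because both tensor factors contribute the same term in
    characteristic 2. Every surviving term therefore contains two entries of the old differential.
    The base ring changes in each round, so lengths are compared through chains of submodules,
    without a common module. The residue field only tells that 2 lies in [m]. Reducing modulo 2
    costs a factor [2^e] in length, because [2^(2^e)] lies in [m^(2^e)]; this is the factor 2
    missing from the final bound. Homology keeps finite length modulo 2 because powers of the
    elements of [m] are null-homotopic, a property which survives base change. The lower bound for
    the length of [R/m^n] comes from a chain of primes and Pascal's rule. An infinite resolution is
    cut at a degree where its minimal model is zero; if there is no such degree beyond some point,
    the Betti sum is infinite. *)

Section Lengths.
Variable R : comNzRingType.
Implicit Type V W : lmodType R.

Definition submodule V (N : set V) : Prop :=
  N 0 /\ forall (a : R) x y, N x -> N y -> N (a *: x + y).

Fixpoint has_chain V (Z : set V) (l : nat) (N : set V) : Prop :=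
  if l is l'.+1 then
    exists N', [/\ submodule N', N `<=` N', N' `<=` Z, ~ (N' `<=` N)
                 & has_chain Z l' N']
  else True.

(** The length of [Z/B] is at most [n], said without forming the quotient. *)
Definition length_le V (B Z : set V) (n : nat) : Prop :=
  forall l, has_chain Z l B -> (l <= n)%N.

Lemma submodule0 V (N : set V) : submodule N -> N 0.
Proof. by case. Qed.

Lemma submoduleD V (N : set V) x y : submodule N -> N x -> N y -> N (x + y).
Proof. by case=> _ H Nx Ny; rewrite -[x]scale1r; exact: H. Qed.

Lemma submoduleZ V (N : set V) a x : submodule N -> N x -> N (a *: x).
Proof. by case=> N0 H Nx; rewrite -[_ *: _]addr0; exact: H. Qed.

Lemma submoduleN V (N : set V) x : submodule N -> N x -> N (- x).
Proof. by move=> sN Nx; rewrite -scaleN1r; exact: submoduleZ. Qed.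

Lemma submoduleB V (N : set V) x y : submodule N -> N x -> N y -> N (x - y).
Proof. by move=> sN Nx Ny; apply: submoduleD => //; exact: submoduleN. Qed.

Lemma submodule_sum V (N : set V) (I : Type) (r : seq I) (P : pred I)
    (F : I -> V) :
  submodule N -> (forall i, P i -> N (F i)) -> N (\sum_(i <- r | P i) F i).
Proof.
by move=> sN NF; elim/big_ind: _ => //;
  [exact: submodule0 | move=> x y; exact: submoduleD].
Qed.

Lemma submoduleI V (N N' : set V) :
  submodule N -> submodule N' -> submodule (N `&` N').
Proof.
move=> [N0 HN] [N'0 HN']; split=> // a x y [? ?] [? ?].
by split; [exact: HN | exact: HN'].
Qed.

Lemma submodule_preim V W (f : {linear V -> W}) (N : set W) :
  submodule N -> submodule (fun x => N (f x)).
Proof.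
move=> [N0 HN]; split=> [|a x y]; first by rewrite linear0.
by rewrite linearP; exact: HN.
Qed.

Lemma submodule_im V W (f : {linear V -> W}) (N : set V) :
  submodule N -> submodule (f @` N).
Proof.
move=> [N0 HN]; split=> [|a _ _ [x Nx <-] [y Ny <-]]; first by exists 0; rewrite ?linear0.
by exists (a *: x + y); rewrite ?linearP//; exact: HN.
Qed.

Lemma submoduleT V : submodule [set: V].
Proof. by []. Qed.

Definition sum_set V (N N' : set V) : set V :=
  fun x => exists y z, [/\ N y, N' z & x = y + z].

Lemma submodule_add V (N N' : set V) :
  submodule N -> submodule N' -> submodule (sum_set N N').
Proof.
move=> sN sN'; split; first by exists 0, 0; rewrite addr0; split=> //; exact: submodule0.
move=> a _ _ [x [x' [Nx Nx' ->]]] [y [y' [Ny Ny' ->]]].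
exists (a *: x + y), (a *: x' + y'); split; [exact: (proj2 sN)|exact: (proj2 sN')|].
by rewrite scalerDr addrACA.
Qed.

Lemma sum_setl V (N N' : set V) : submodule N' -> N `<=` sum_set N N'.
Proof. by move=> sN' x Nx; exists x, 0; rewrite addr0; split=> //; exact: submodule0. Qed.

Lemma sum_setr V (N N' : set V) : submodule N -> N' `<=` sum_set N N'.
Proof. by move=> sN x Nx; exists 0, x; rewrite add0r; split=> //; exact: submodule0. Qed.

Lemma sum_set_min V (N N' M : set V) :
  submodule M -> N `<=` M -> N' `<=` M -> sum_set N N' `<=` M.
Proof. by move=> sM NM NM' _ [x [y [Nx Ny ->]]]; apply: submoduleD; auto. Qed.

Lemma has_chainS V (Z N N' : set V) l :
  N `<=` N' -> has_chain Z l N' -> has_chain Z l N.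
Proof.
case: l => //= l sNN' [M [sM N'M MZ nMN' ch]]; exists M; split=> //.
  exact: subset_trans N'M.
by move=> MN; apply: nMN'; apply: subset_trans sNN'.
Qed.

Lemma has_chain_widen V (Z Z' N : set V) l :
  Z `<=` Z' -> has_chain Z l N -> has_chain Z' l N.
Proof.
move=> sZ; elim: l N => //= l IH N [M [sM NM MZ nMN ch]].
by exists M; split=> //; [exact: subset_trans sZ | exact: IH].
Qed.

Lemma has_chain_leq V (Z N : set V) l l' :
  (l <= l')%N -> has_chain Z l' N -> has_chain Z l N.
Proof.
elim: l l' N => //= l IH [|l'] N //= ll' [M [sM NM MZ nMN ch]].
by exists M; split=> //; exact: IH ch.
Qed.

Lemma length_leS V (B Z B' Z' : set V) n :
  B `<=` B' -> Z' `<=` Z -> length_le B Z n -> length_le B' Z' n.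
Proof. by move=> sB sZ H l /(has_chainS sB) /(has_chain_widen sZ) /H. Qed.

End Lengths.

(** Additivity of length in abstract form: by the last condition a strict step cannot become trivial
    under both [f] and [g], so it is counted in at least one of the two image chains. *)
Lemma has_chain_split (R S1 S2 : comNzRingType) (V : lmodType R)
    (W1 : lmodType S1) (W2 : lmodType S2) (f : set V -> set W1)
    (g : set V -> set W2) (B Z : set V) (Z1 : set W1) (Z2 : set W2) :
  let good N := [/\ submodule N, B `<=` N & N `<=` Z] in
  (forall N, good N -> submodule (f N) /\ f N `<=` Z1) ->
  (forall N, good N -> submodule (g N) /\ g N `<=` Z2) ->
  (forall N N', N `<=` N' -> f N `<=` f N' /\ g N `<=` g N') ->
  (forall N N', good N -> good N' -> N `<=` N' -> f N' `<=` f N ->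
     g N' `<=` g N -> N' `<=` N) ->
  forall l N, good N -> has_chain Z l N ->
    exists a b, [/\ (l = a + b)%N, has_chain Z1 a (f N) & has_chain Z2 b (g N)].
Proof.
move=> good goodf goodg mono strict; elim=> [|l IH] N gN; first by exists 0%N, 0%N.
case=> M [sM NM MZ nMN ch].
have gM : good M by split=> //; case: gN => _ BN _; exact: subset_trans NM.
have [a [b [-> ca cb]]] := IH _ gM ch.
have [fNM gNM] := mono _ _ NM; have [sf fZ] := goodf _ gM; have [sg gZ] := goodg _ gM.
have [fMN|nf] := pselect (f M `<=` f N).
  have [gMN|ng] := pselect (g M `<=` g N).
    by exfalso; apply: nMN; exact: strict.
  exists a, b.+1; split; first by rewrite addnS.
    exact: has_chainS ca.
  by exists (g M).
exists a.+1, b; split=> //; first by exists (f M).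
exact: has_chainS cb.
Qed.

(** The case of a single image in which every step stays strict. It serves to pass between modules
    over [A] and over [laurent A]. *)
Lemma has_chain_map (R S : comNzRingType) (V : lmodType R)
    (W : lmodType S) (f : set V -> set W) (B Z : set V) (Z1 : set W) :
  let good N := [/\ submodule N, B `<=` N & N `<=` Z] in
  (forall N, good N -> submodule (f N) /\ f N `<=` Z1) ->
  (forall N N', N `<=` N' -> f N `<=` f N') ->
  (forall N N', good N -> good N' -> N `<=` N' -> f N' `<=` f N -> N' `<=` N) ->
  forall l N, good N -> has_chain Z l N -> has_chain Z1 l (f N).
Proof.
move=> good goodf mono strict; elim=> [|l IH] N gN //.
case=> M [sM NM MZ nMN ch].
have gM : good M by split=> //; case: gN => _ BN _; exact: subset_trans NM.
have [sf fZ] := goodf _ gM; exists (f M); split=> //; first exact: mono.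
  by move=> fMN; apply: nMN; exact: strict.
exact: IH.
Qed.

Section HomologyLength.
Variable R : comNzRingType.

Definition hlen (V : lmodType R) (W : set V) (dlt : V -> V) (n : nat) : Prop :=
  length_le (dlt @` W) (W `&` [set x | dlt x = 0]) n.

(** Half exactness of homology along [W -> W' -> F]: a module between boundaries and cycles is
    recovered from its intersection with [W] and its image in the homology of [F]. *)
Lemma hlen_extension (V F : lmodType R) (dlt : {linear V -> V})
    (dF : {linear F -> F}) (p : {linear V -> F}) (W W' : set V) a b :
  submodule W' -> W = W' `&` [set x | p x = 0] ->
  (forall x, W' x -> W' (dlt x)) -> (forall x, dlt (dlt x) = 0) ->
  (forall x, W' x -> p (dlt x) = dF (p x)) ->
  (forall y, exists2 x, W' x & p x = y) ->
  hlen W dlt a -> hlen setT dF b -> hlen W' dlt (a + b).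
Proof.
move=> sW' defW dW' dlt2 pd psurj hW hF l ch.
have sW : submodule W.
  rewrite defW; apply: submoduleI => //; split=> /=[|c x y /= px py]; first exact: linear0.
  by rewrite linearP px py scaler0 addr0.
pose f (N : set V) := N `&` W.
pose g (N : set V) := sum_set (p @` N) (dF @` setT).
have W'W x : W x -> W' x by rewrite defW => -[].
have sker : submodule [set x | dlt x = 0].
  by split=> [|c x y] /=; rewrite ?linear0 // linearP => -> ->; rewrite scaler0 addr0.
have := @has_chain_split R R R V V F f g (dlt @` W') (W' `&` [set x | dlt x = 0])
  (W `&` [set x | dlt x = 0]) (setT `&` [set x | dF x = 0]) _ _ _ _ l (dlt @` W') _ ch.
case.
- move=> N [sN BN NZ]; split; first exact: submoduleI.
  by move=> x [Nx Wx]; split=> //; case: (NZ _ Nx).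
- move=> N [sN BN NZ]; split.
    by apply: submodule_add; apply: submodule_im.
  move=> _ [_ [_ [[x Nx <-] [y _ <-] ->]]]; split=> //=.
  have [Wx dx] := NZ _ Nx; rewrite linearD -pd// dx linear0 add0r.
  have [v Wv <-] := psurj y; rewrite -pd// -pd; last exact: dW'.
  by rewrite dlt2 linear0.
- move=> N N' NN'; split; first by move=> x [/NN' Nx Wx].
  move=> _ [_ [z [[x Nx <-] Hz ->]]]; exists (p x), z; split=> //.
  by exists x => //; exact: NN'.
- move=> N N' [sN BN NZ] [sN' BN' NZ'] NN' ff gg x N'x.
  have [] := gg (p x).
    by exists (p x), 0; split; [exists x | exists 0; rewrite ?linear0 | rewrite addr0].
  move=> _ [_ [[y Ny <-] [z _ <-] e]].
  (* The boundary [dlt v] lies in [N] and accounts for the difference of [p x] and [p y]; what is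
     left of [x] lies in [W]. *)
  have [v Wv vE] := psurj z; rewrite -vE -pd// in e.
  have Nyv : N (y + dlt v) by apply: submoduleD => //; apply: BN; exists v.
  suff : N (x - (y + dlt v)) by move=> H; rewrite -[x](subrK (y + dlt v)); exact: submoduleD.
  have [] // : f N (x - (y + dlt v)).
  apply: ff; split; first by apply: submoduleB => //; exact: NN'.
  rewrite defW; split.
    by apply: submoduleB => //; [case: (NZ' _ N'x)|case: (NZ' _ (NN' _ Nyv))].
  by rewrite /= linearB linearD e subrr.
- split; first exact: submodule_im.
    by [].
  by move=> _ [x Wx <-]; split; [exact: dW' | exact: dlt2].
move=> m [n [-> cm cn]]; apply: leq_add.
  apply: hW; apply: has_chainS cm => _ [x Wx <-]; split.
    by exists x => //; exact: W'W.
  rewrite defW; split; first by apply: dW'; exact: W'W.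
  by move: Wx; rewrite defW /= => -[W'x px]; rewrite pd// px linear0.
apply: hF; apply: has_chainS cn; apply: sum_setr.
by apply/submodule_im/submodule_im.
Qed.

(** [N] is sent to [Phi N] plus all boundaries. Applying [Psi] gives [N] back, since [Psi] maps
    boundaries to boundaries and these lie in [N]. *)
Lemma hlen_retract (V F : lmodType R) (dlt : {linear V -> V}) (dF : {linear F -> F})
    (Phi : {linear F -> V}) (Psi : {linear V -> F}) n :
  (forall x, Phi (dF x) = dlt (Phi x)) -> (forall x, Psi (dlt x) = dF (Psi x)) ->
  (forall x, Psi (Phi x) = x) -> (forall x, dlt (dlt x) = 0) ->
  hlen setT dlt n -> hlen setT dF n.
Proof.
move=> Pd dP PP dlt2 hV l ch.
have dF2 x : dF (dF x) = 0 by rewrite -[LHS]PP !Pd dlt2 linear0.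
pose f (N : set F) := sum_set (Phi @` N) (dlt @` setT).
apply: hV; suff : has_chain (setT `&` [set x | dlt x = 0]) l (f (dF @` setT)).
  by apply: has_chainS; apply: sum_setr; apply/submodule_im/submodule_im.
apply: (@has_chain_map R R _ _ _ (dF @` setT) (setT `&` [set x | dF x = 0])) ch.
- move=> N [sN BN NZ]; split; first by apply: submodule_add; exact: submodule_im.
  move=> _ [_ [_ [[x /NZ[_ dx] <-] [y _ <-] ->]]]; split=> //=.
  by rewrite linearD dlt2 addr0 -Pd dx linear0.
- move=> N N' NN' _ [_ [z [[x Nx <-] Hz ->]]]; exists (Phi x), z; split=> //.
  by exists x => //; exact: NN'.
- move=> N N' [sN BN NZ] [sN' BN' NZ'] NN' ff x N'x.
  have [] := ff (Phi x).
    by exists (Phi x), 0; split; [exists x | exists 0; rewrite ?linear0 | rewrite addr0].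
  move=> _ [_ [[y Ny <-] [z _ <-] e]].
  rewrite -[x]PP e linearD PP dP; apply: submoduleD => //.
  by apply: BN; exists (Psi z).
split; [exact: submodule_im|by []|by move=> _ [x _ <-]; split].
Qed.

End HomologyLength.

(* [h] contracts the part of [V] to be discarded; [i] and [p] identify the rest with [F]. *)
Section HomotopyRetract.
Variables (R : comNzRingType) (V F : lmodType R).
Variables (dlt h : {linear V -> V}) (i : {linear F -> V}) (p : {linear V -> F}).

(** The chain map [1 - dlt h - h dlt], homotopic to the identity. The side conditions below make it
    idempotent and, through [qipq], identify its image with [F]. *)
Definition retract_proj (x : V) : V := x - dlt (h x) - h (dlt x).

Fact retract_proj_linear : linear retract_proj.
Proof.
by move=> a x y; rewrite /retract_proj !linearP !scalerDr [RHS]addrACA (addrACA (a *: x) _ y).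
Qed.

HB.instance Definition _ :=
  GRing.isLinear.Build R V V *:%R retract_proj retract_proj_linear.

Definition retract_in : F -> V := retract_proj \o i.
Definition retract_out : V -> F := p \o retract_proj.
Definition retract_diff : F -> F := p \o dlt \o retract_proj \o i.

HB.instance Definition _ := GRing.Linear.on retract_in.
HB.instance Definition _ := GRing.Linear.on retract_out.
HB.instance Definition _ := GRing.Linear.on retract_diff.

Hypothesis dlt2 : forall x, dlt (dlt x) = 0.
Hypothesis h2 : forall x, h (h x) = 0.
Hypothesis hdh : forall x, h (dlt (h x)) = h x.
Hypothesis pi1 : forall x, p (i x) = x.
Hypothesis hi0 : forall x, h (i x) = 0.
Hypothesis ph0 : forall x, p (h x) = 0.
Hypothesis qipq : forall x,
  retract_proj (i (p (retract_proj x))) = retract_proj x.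

Lemma retract_projd x : retract_proj (dlt x) = dlt (retract_proj x).
Proof. by rewrite /retract_proj !linearB !dlt2 !(linear0, oppr0, addr0). Qed.

Lemma retract_proj_idem x : retract_proj (retract_proj x) = retract_proj x.
Proof.
rewrite {1}/retract_proj -retract_projd /retract_proj.
by rewrite !linearB !hdh !dlt2 !h2 !(linear0, oppr0, addr0, subrr).
Qed.

Lemma retract_outK x : retract_out (retract_in x) = x.
Proof.
rewrite /retract_out /retract_in /= retract_proj_idem /retract_proj !linearB.
by rewrite hi0 ph0 !(linear0, oppr0, addr0) pi1.
Qed.

Lemma retract_inK x : retract_in (retract_out x) = retract_proj x.
Proof. by rewrite /retract_out /retract_in /= qipq. Qed.

Lemma retract_ind x : retract_in (retract_diff x) = dlt (retract_in x).
Proof.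
rewrite /retract_in /retract_diff /= -retract_projd qipq.
by rewrite retract_projd.
Qed.

Lemma retract_outd x : retract_out (dlt x) = retract_diff (retract_out x).
Proof.
by rewrite /retract_out /retract_diff /= qipq retract_projd.
Qed.

Lemma retract_diff2 x : retract_diff (retract_diff x) = 0.
Proof. by rewrite -[LHS]retract_outK !retract_ind dlt2 linear0. Qed.

(** Prepares the case where [p dlt i] vanishes: then each entry of the transferred differential
    involves [dlt] at least twice. *)
Lemma retract_diffE x : retract_diff x = p (dlt (i x)) - p (dlt (h (dlt (i x)))).
Proof. by rewrite /retract_diff /= /retract_proj hi0 !(linear0, oppr0, addr0) !linearB. Qed.

End HomotopyRetract.

(** * Laurent series *)

Section IntegerSums.
Variable A : zmodType.
Implicit Type F : int -> A.

Definition window F (m : int) (K : nat) : Prop :=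
  forall i, (i < m) || (m + K%:Z <= i) -> F i = 0.

Lemma window_sum_widen F m K m' K' :
  window F m K -> m' <= m -> m + K%:Z <= m' + K'%:Z ->
  \sum_(i < K') F (m' + i%:Z) = \sum_(i < K) F (m + i%:Z).
Proof.
move=> wF mm KK.
have [a am] : exists a : nat, m = m' + a%:Z by exists `|m - m'|%N; lia.
have [b bE] : exists b : nat, K' = (a + (K + b))%N by exists (K' - (a + K))%N; lia.
rewrite bE !big_split_ord /= big1 => [|i _]; last by apply: wF; have := ltn_ord i; lia.
rewrite [X in _ + (_ + X)]big1 => [|i _]; last by apply: wF; lia.
by rewrite add0r addr0; apply: eq_bigr => i _; congr F; lia.
Qed.

(** The sum over all integers of a function of bounded support, 0 for other functions. By [zsumE]
    the chosen window does not influence the value. *)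
Definition zsum F : A :=
  if pselect (exists mK : int * nat, window F mK.1 mK.2) is left H
  then \sum_(i < (projT1 (cid H)).2) F ((projT1 (cid H)).1 + i%:Z) else 0.

Lemma zsumE F m K : window F m K -> zsum F = \sum_(i < K) F (m + i%:Z).
Proof.
move=> wF; rewrite /zsum; case: pselect => [H|[]]; last by exists (m, K).
case: (cid H) => -[m' K'] /= wF'.
pose m0 := Num.min m m'; pose K0 := (`|m - m0| + `|m' - m0| + K + K')%N.
by rewrite -(@window_sum_widen F m' K' m0 K0)// ?(@window_sum_widen F m K m0 K0)//; lia.
Qed.

Lemma zsumD F G m K :
  window F m K -> window G m K -> zsum (fun i => F i + G i) = zsum F + zsum G.
Proof.
move=> wF wG; rewrite (zsumE wF) (zsumE wG) (@zsumE _ m K) ?big_split// => i Hi.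
by rewrite wF// wG// addr0.
Qed.

Lemma zsum_shift F c m K : window F m K -> zsum (fun i => F (i + c)) = zsum F.
Proof.
move=> wF; rewrite (zsumE wF) (@zsumE _ (m - c) K); last by move=> i Hi; apply: wF; lia.
by apply: eq_bigr => i _; congr F; lia.
Qed.

Lemma zsum_rev F c m K : window F m K -> zsum (fun i => F (c - i)) = zsum F.
Proof.
move=> wF; rewrite (zsumE wF) (@zsumE _ (c - m - K%:Z + 1) K); last by move=> i Hi; apply: wF; lia.
rewrite (reindex_inj rev_ord_inj) /=.
by apply: eq_bigr => i _; congr F; have := ltn_ord i; lia.
Qed.

Lemma zsum_exchange (F : int -> int -> A) m K m' K' :
  (forall i j, (i < m) || (m + K%:Z <= i) || (j < m') || (m' + K'%:Z <= j) -> F i j = 0) ->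
  zsum (fun i => zsum (F i)) = zsum (fun j => zsum (F^~ j)).
Proof.
move=> wF.
have w1 i : window (F i) m' K' by move=> j Hj; apply: wF; lia.
have w2 j : window (F^~ j) m K by move=> i Hi; apply: wF; lia.
rewrite (@zsumE _ m K) => [|i Hi]; last first.
  by rewrite (zsumE (w1 i)) big1// => j _; apply: wF; rewrite Hi.
rewrite (@zsumE _ m' K') => [|j Hj]; last first.
  by rewrite (zsumE (w2 j)) big1// => i _; apply: wF; rewrite -orbA Hj orbT.
rewrite (eq_bigr _ (fun i _ => zsumE (w1 _))) exchange_big /=.
by apply: eq_bigr => j _; rewrite (zsumE (w2 _)).
Qed.

End IntegerSums.

Lemma zsum_mull (A : pzRingType) (c : A) (F : int -> A) m K :
  window F m K -> zsum (fun i => c * F i) = c * zsum F.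
Proof.
move=> wF; rewrite (zsumE wF) (@zsumE _ _ m K) ?big_distrr// => i Hi.
by rewrite wF// mulr0.
Qed.

Section LaurentSeries.
Variable A : comNzRingType.

Record laurent := Laurent {
  lcoef :> int -> A;
  lcoefP : exists m : int, forall i, i < m -> lcoef i = 0 }.

HB.instance Definition _ := gen_eqMixin laurent.
HB.instance Definition _ := gen_choiceMixin laurent.

Lemma laurentP (f g : laurent) : (forall i, f i = g i) -> f = g.
Proof.
case: f g => f Pf [g Pg] /= /funext fg; subst g.
by congr Laurent; exact: Prop_irrelevance.
Qed.

Lemma lcoef_bound2 (f g : laurent) :
  exists m : int, forall i, i < m -> f i = 0 /\ g i = 0.
Proof.
have [m Hm] := lcoefP f; have [m' Hm'] := lcoefP g.
by exists (Num.min m m') => i Hi; split; [apply: Hm|apply: Hm']; lia.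
Qed.

Program Definition laurent_add (f g : laurent) := @Laurent (fun i => f i + g i) _.
Next Obligation.
move=> f g; have [m Hm] := lcoef_bound2 f g.
by exists m => i /Hm[-> ->]; rewrite addr0.
Qed.

Program Definition laurent_opp (f : laurent) := @Laurent (fun i => - f i) _.
Next Obligation.
by move=> f; have [m Hm] := lcoefP f; exists m => i /Hm->; rewrite oppr0.
Qed.

Program Definition laurent0 := @Laurent (fun=> 0) _.
Next Obligation. by exists 0. Qed.

Lemma laurent_window (f g : laurent) (m m' n : int) :
  (forall i, i < m -> f i = 0) -> (forall i, i < m' -> g i = 0) ->
  window (fun i => f i * g (n - i)) m `|(n - m - m' + 1)%R|%N.
Proof.
move=> Hm Hm' i /orP[/Hm->|Hi]; first by rewrite mul0r.
by rewrite (Hm' (n - i)) ?mulr0//; lia.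
Qed.

Definition laurent_mul_coef (f g : laurent) (n : int) : A := zsum (fun i => f i * g (n - i)).

Lemma laurent_mul_coef_bound (f g : laurent) m m' :
  (forall i, i < m -> f i = 0) -> (forall i, i < m' -> g i = 0) ->
  forall n, n < m + m' -> laurent_mul_coef f g n = 0.
Proof.
move=> Hm Hm' n Hn; rewrite /laurent_mul_coef (@zsumE _ _ m 0) ?big_ord0// => i.
case: (ltP i m) => [/Hm-> _|mi _]; first by rewrite mul0r.
by rewrite Hm' ?mulr0//; lia.
Qed.

Program Definition laurent_mul (f g : laurent) := @Laurent (laurent_mul_coef f g) _.
Next Obligation.
move=> f g; have [m Hm] := lcoefP f; have [m' Hm'] := lcoefP g.
by exists (m + m'); exact: laurent_mul_coef_bound.
Qed.

Program Definition laurent_mono (n : int) (a : A) :=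
  @Laurent (fun i => if i == n then a else 0) _.
Next Obligation.
by move=> n a; exists n => i Hi; case: eqP => // ?; subst; rewrite ltxx in Hi.
Qed.

Fact laurent_addA : associative laurent_add.
Proof. by move=> f g h; apply: laurentP => i /=; rewrite addrA. Qed.
Fact laurent_addC : commutative laurent_add.
Proof. by move=> f g; apply: laurentP => i /=; rewrite addrC. Qed.
Fact laurent_add0 : left_id laurent0 laurent_add.
Proof. by move=> f; apply: laurentP => i /=; rewrite add0r. Qed.
Fact laurent_addN : left_inverse laurent0 laurent_opp laurent_add.
Proof. by move=> f; apply: laurentP => i /=; rewrite addNr. Qed.

HB.instance Definition _ := GRing.isZmodule.Build laurent
  laurent_addA laurent_addC laurent_add0 laurent_addN.

Fact laurent_mulC : commutative laurent_mul.
Proof.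
move=> f g; apply: laurentP => n /=; rewrite /laurent_mul_coef.
have [m Hm] := lcoefP f; have [m' Hm'] := lcoefP g.
rewrite -(zsum_rev n (laurent_window (n := n) Hm Hm')); congr zsum.
by apply/funext => i; rewrite mulrC subKr.
Qed.

Lemma laurent_mono_mul n a (f : laurent) i :
  laurent_mul (laurent_mono n a) f i = a * f (i - n).
Proof.
rewrite /= /laurent_mul_coef (@zsumE _ _ n 1) ?big_ord1 /= ?addr0 ?eqxx// => j Hj.
by case: eqP => [?|]; [lia|rewrite mul0r].
Qed.

Fact laurent_mul1 : left_id (laurent_mono 0 1) laurent_mul.
Proof. by move=> f; apply: laurentP => i; rewrite laurent_mono_mul mul1r subr0. Qed.

Fact laurent_mulDl : left_distributive laurent_mul laurent_add.
Proof.
move=> f g h; apply: laurentP => n /=; rewrite /laurent_mul_coef.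
have [m Hm] := lcoef_bound2 f g; have [m' Hm'] := lcoefP h.
rewrite -(@zsumD _ _ _ m `|(n - m - m' + 1)%R|%N); first last.
- by apply: laurent_window => // i /Hm[].
- by apply: laurent_window => // i /Hm[].
by congr zsum; apply/funext => i /=; rewrite mulrDl.
Qed.

Fact laurent_mulA : associative laurent_mul.
Proof.
move=> f g h; apply: laurentP => n /=; rewrite /laurent_mul_coef /= /laurent_mul_coef.
have [m Hm] := lcoefP f; have [m' Hm'] := lcoefP g; have [m'' Hm''] := lcoefP h.
(* [j] is the degree of the product of [f] and [g]: summing over [j] first gives [f (g h)], summing
   over [i] first gives [(f g) h]. *)
pose T i j := f i * (g (j - i) * h (n - j)).
transitivity (zsum (fun i => zsum (T i))).
  congr zsum; apply/funext => i.
  rewrite -(@zsum_mull _ _ _ m' `|(n - i - m' - m'' + 1)%R|%N); last exact: laurent_window.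
  rewrite -(@zsum_shift _ _ (- i) m' `|(n - i - m' - m'' + 1)%R|%N).
    by congr zsum; apply/funext => j; rewrite /T; congr (_ * (_ * h _)); lia.
  by move=> j Hj; rewrite (laurent_window (n := n - i) Hm' Hm'') ?mulr0.
rewrite (@zsum_exchange _ _ m `|(n - m - m' - m'' + 1)%R|%N (m + m') `|(n - m - m' - m'' + 1)%R|%N).
  congr zsum; apply/funext => j; rewrite mulrC.
  rewrite -(zsum_mull _ (laurent_window (n := j) Hm Hm')).
  by congr zsum; apply/funext => i; rewrite /T mulrA mulrC.
move=> i j Hij; rewrite /T.
have [im|mi] := ltP i m; first by rewrite Hm// mul0r.
have [im|mi'] := ltP (j - i) m'; first by rewrite Hm'// mul0r mulr0.
by rewrite (Hm'' (n - j)) ?mulr0//; lia.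
Qed.

Fact laurent_1_neq0 : laurent_mono 0 1 != 0.
Proof.
apply/eqP => /(congr1 (fun f : laurent => f 0)) /= /eqP.
by rewrite oner_eq0.
Qed.

HB.instance Definition _ := GRing.Zmodule_isComNzRing.Build laurent
  laurent_mulA laurent_mulC laurent_mul1 laurent_mulDl laurent_1_neq0.

Lemma lcoefD (f g : laurent) i : (f + g) i = f i + g i. Proof. by []. Qed.
Lemma lcoefN (f : laurent) i : (- f) i = - f i. Proof. by []. Qed.
Lemma lcoefM (f g : laurent) i : (f * g) i = zsum (fun j => f j * g (i - j)).
Proof. by []. Qed.
Lemma lcoef_monoM n a (f : laurent) i : (laurent_mono n a * f) i = a * f (i - n).
Proof. exact: laurent_mono_mul. Qed.

Fact lcoef_is_additive i : zmod_morphism (fun f : laurent => f i).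
Proof. by move=> f g. Qed.

Definition coefl (i : int) (f : laurent) : A := f i.
HB.instance Definition _ i := GRing.isZmodMorphism.Build laurent A (coefl i) (lcoef_is_additive i).

Lemma laurent_monoM n n' a a' :
  laurent_mono n a * laurent_mono n' a' = laurent_mono (n + n') (a * a').
Proof.
apply: laurentP => i; rewrite lcoef_monoM /=.
have -> : (i - n == n') = (i == n + n') by lia.
by case: eqP; rewrite ?mulr0.
Qed.

Definition laurent_const (a : A) : laurent := laurent_mono 0 a.

Fact laurent_const_additive : zmod_morphism laurent_const.
Proof. by move=> a b; apply: laurentP => i /=; case: eqP; rewrite ?subr0. Qed.
Fact laurent_const_monoid : monoid_morphism laurent_const.
Proof. by split=> // a b; rewrite /laurent_const laurent_monoM addr0. Qed.

HB.instance Definition _ := GRing.isZmodMorphism.Build A laurent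
  laurent_const laurent_const_additive.
HB.instance Definition _ := GRing.isMonoidMorphism.Build A laurent
  laurent_const laurent_const_monoid.

Lemma coefl_constM i a (f : laurent) : coefl i (laurent_const a * f) = a * coefl i f.
Proof. by rewrite /coefl lcoef_monoM subr0. Qed.

(** The kernel of [A((t)) -> (A/I)((t))]; it may exceed the ideal generated by [I] when [I] is not
    finitely generated. *)
Definition laurent_ideal (I : set A^o) : set laurent^o := fun f => forall i, I ((f : laurent) i).

Definition power_series (f : laurent) : Prop := forall i, i < 0 -> f i = 0.

Lemma power_seriesM (f g : laurent) :
  power_series f -> power_series g -> power_series (f * g).
Proof. by move=> Hf Hg i Hi; apply: laurent_mul_coef_bound Hf Hg _ _; lia. Qed.

Definition series_coef (a : nat -> A) (i : int) : A := if i is Posz n then a n else 0.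

Fact series_bound a : exists m : int, forall i, i < m -> series_coef a i = 0.
Proof. by exists 0 => -[]. Qed.

Definition series (a : nat -> A) : laurent := Laurent (series_bound a).

Lemma seriesP a : power_series (series a). Proof. by case. Qed.

Lemma series_step a :
  series a = laurent_const (a 0%N) + laurent_mono 1 1 * series (fun i => a i.+1).
Proof.
apply: laurentP => i; rewrite lcoefD lcoef_monoM mul1r.
case: i => [[|n]|n]; rewrite /= ?addr0 ?add0r//.
by rewrite subn1.
Qed.

End LaurentSeries.

(** * The tensor square of a differential module *)

Section FinitelyGenerated.
Variable R : comNzRingType.

Definition fin_gen (V : lmodType R) (N : set V) : Prop :=
  exists (I : finType) (u : I -> V), (forall j, N (u j)) /\
    forall x, N x -> exists a : I -> R, x = \sum_j a j *: u j.

(** For iterated Laurent series no chain condition on the ring is at hand, so finite generation is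
    drawn from a length bound, by induction on it. *)
Lemma fin_gen_length (V : lmodType R) (B Z : set V) n :
  submodule B -> fin_gen B -> length_le B Z n ->
  forall N, submodule N -> B `<=` N -> N `<=` Z -> fin_gen N.
Proof.
elim: n B => [|n IH] B sB fB lB N sN BN NZ.
  suff NB : N `<=` B.
    by have -> : N = B by apply/seteqP.
  by apply: contrapT => NB; suff : (1 <= 0)%N by []; apply: lB; exists N.
have [NB|/existsNP[x /not_implyP[Nx nBx]]] := pselect (N `<=` B).
  by have -> : N = B by apply/seteqP.
(* Adjoining one element outside [B] keeps the bottom finitely generated and shortens the remaining
   chains by one. *)
pose B1 := sum_set B (fun y => exists a, y = a *: x).
have sx : submodule (fun y => exists a, y = a *: x).
  split; first by exists 0; rewrite scale0r.
  by move=> c _ _ [a ->] [b ->]; exists (c * a + b); rewrite scalerDl scalerA.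
have sB1 : submodule B1 by exact: submodule_add.
have B1N : B1 `<=` N.
  by apply: sum_set_min => // _ [a ->]; exact: submoduleZ.
apply: (IH B1) => //.
  have [I [u [Bu Hu]]] := fB; exists (option I), (fun j => if j is Some j then u j else x).
  split=> [[j|]|].
  - by exists (u j), 0; rewrite addr0; split=> //; exists 0; rewrite scale0r.
  - by exists 0, x; rewrite add0r; split=> //; [exact: submodule0|exists 1; rewrite scale1r].
  move=> _ [y [_ [/Hu[a ->] [b ->] ->]]].
  exists (fun j => if j is Some j then a j else b).
  rewrite (bigD1 None) //= addrC; congr (_ + _).
  rewrite (reindex_omap Some (fun i => i)) /=; last by case.
  by apply: eq_bigl => j; rewrite eqxx.
move=> l ch; rewrite -ltnS; apply: lB; exists B1; split=> //.
- exact: sum_setl.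
- exact: subset_trans NZ.
- by move=> H; apply: nBx; apply: H; apply: sum_setr => //; exists 1; rewrite scale1r.
Qed.

Lemma fin_gen_im_mx m n (V : lmodType R) (f : {linear 'M[R]_(m, n) -> V}) :
  fin_gen (f @` setT).
Proof.
exists ('I_m * 'I_n)%type, (fun ij => f (delta_mx ij.1 ij.2)); split.
  by move=> ij; exists (delta_mx ij.1 ij.2).
move=> _ [X _ <-]; exists (fun ij => X ij.1 ij.2).
rewrite {1}[X]matrix_sum_delta pair_bigA /= linear_sum.
by apply: eq_bigr => -[i j] _; rewrite linearZ.
Qed.

End FinitelyGenerated.

Section TensorSquare.
Variables (A : comNzRingType) (n : nat).

(* An n x n matrix stands for an element of the tensor square of A^n. *)
Definition tdiff (D X : 'M[A]_n) : 'M[A]_n := D^T *m X + X *m D.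
(** When the tensor of [x] and [y] is read as [x^T *m y], the swap is transposition, and [tdiff D]
    is [D] acting on either factor. *)
Definition tsym (X : 'M[A]_n) : 'M[A]_n := X + X^T.

Fact tdiff_linear D : linear (tdiff D).
Proof.
move=> a X Y; rewrite /tdiff mulmxDl mulmxDr -scalemxAl -scalemxAr scalerDr.
by rewrite addrACA.
Qed.
HB.instance Definition _ D :=
  GRing.isLinear.Build A 'M[A]_n 'M[A]_n *:%R (tdiff D) (tdiff_linear D).

Fact tsym_linear : linear tsym.
Proof. by move=> a X Y; rewrite /tsym linearP scalerDr addrACA. Qed.
HB.instance Definition _ := GRing.isLinear.Build A 'M[A]_n 'M[A]_n *:%R tsym tsym_linear.

(** Only the filtration by degree is kept, not the grading: the differential obtained on the
    diagonal lowers degrees by varying amounts. *)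
Definition lowering (w : 'I_n -> nat) (D : 'M[A]_n) : Prop :=
  forall i j, D i j != 0 -> (w j < w i)%N.

Hypothesis char2 : forall x : A, x + x = 0.

Lemma mx_char2 m p (X : 'M[A]_(m, p)) : X + X = 0.
Proof. by apply/matrixP => i j; rewrite !mxE char2. Qed.

Lemma tdiff2 D X : D *m D = 0 -> tdiff D (tdiff D X) = 0.
Proof.
move=> D2; rewrite /tdiff !mulmxDl !mulmxDr !mulmxA -trmx_mul D2 trmx0 mul0mx.
by rewrite add0r -!mulmxA D2 mulmx0 addr0 mx_char2.
Qed.

(** The matrices supported on the rows in [S] form a subcomplex when [S] is closed under [D].
    Peeling off the row of greatest degree leaves a closed set, and no other row of [S] maps into
    that row, so the quotient is a copy of [A^n] with differential [D]. There are [n] rows, whence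
    the factor [n]. *)
Lemma hlen_tdiff D w h :
  D *m D = 0 -> lowering w D -> hlen setT (mulmxr D : 'rV[A]_n -> _) h ->
  hlen setT (tdiff D) (n * h).
Proof.
move=> D2 lD hD.
pose VS (S : {set 'I_n}) : set 'M[A]_n := fun X => forall i, i \notin S -> row i X = 0.
have sVS S : submodule (VS S).
  split=> [i _|a X Y HX HY i Hi]; first by rewrite linear0.
  by rewrite linearP /= HX// HY// scaler0 addr0.
suff main c (S : {set 'I_n}) : #|S| = c ->
    (forall k j, k \in S -> D k j != 0 -> j \in S) -> hlen (VS S) (tdiff D) (c * h).
  pose U : {set 'I_n} := finset.finset xpredT.
  have := main _ U erefl; rewrite cardsE card_ord.
  have -> : VS U = setT by apply/seteqP; split=> // X _ i; rewrite inE.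
  by apply=> k j _ _; rewrite inE.
elim: c S => [|c IH] S cS dS.
  move: cS => /eqP; rewrite cards_eq0 => /eqP S0.
  case=> [//|l [N' [sN' _ HZ nH _]]]; exfalso; apply: nH => X /HZ[HX _].
  exists 0; first by move=> i _; rewrite linear0.
  by rewrite linear0; apply/row_matrixP => i; rewrite HX ?S0 ?inE// linear0.
have [i0 i0S] : exists i, i \in S by apply/set0Pn; rewrite -card_gt0 cS.
pose i := [arg max_(i > i0 | i \in S) w i]%N.
have [iS imax] : i \in S /\ forall j, j \in S -> (w j <= w i)%N.
  by rewrite /i; case: arg_maxnP.
have dd X : row i (tdiff D X) = row i (D^T *m X) + row i X *m D.
  by rewrite linearD -row_mul.
rewrite mulSn addnC.
apply: (hlen_extension (dF := mulmxr D) (p := row i) (W := VS (S :\ i))) => //.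
- apply/seteqP; split=> [X HX|X [HX iX] j].
    by split=> [j jS|/=]; rewrite HX// !inE ?eqxx// (negbTE jS) andbF.
  by rewrite !inE negb_and negbK => /orP[/eqP->//|/HX].
- move=> X HX j jS; rewrite linearD /= !row_mul HX// mul0mx addr0.
  rewrite mulmx_sum_row big1// => k _; rewrite !mxE.
  case: (boolP (k \in S)) => [kS|/HX->]; last by rewrite scaler0.
  have [->|/(dS _ _ kS)] := eqVneq (D k j) 0; first by rewrite scale0r.
  by rewrite (negbTE jS).
- by move=> X; exact: tdiff2.
- move=> X HX; rewrite /= dd row_mul mulmx_sum_row big1 ?add0r// => k _; rewrite !mxE.
  case: (boolP (k \in S)) => [kS|/HX->]; last by rewrite scaler0.
  have [->|/lD] := eqVneq (D k i) 0; first by rewrite scale0r.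
  by rewrite ltnNge imax.
- move=> y; exists (\matrix_(k, l) if k == i then y 0 l else 0).
    move=> j jS; apply/rowP => l; rewrite !mxE; case: eqP => // ji.
    by move: jS; rewrite ji iS.
  by apply/rowP => l; rewrite !mxE eqxx.
- apply: IH; first by move: cS; rewrite (cardsD1 i) iS => -[].
  move=> k j; rewrite !inE => /andP[ki kS] Dkj; rewrite (dS k)// andbT.
  by apply: contraTN (lD _ _ Dkj) => /eqP->; rewrite -leqNgt imax.
Qed.

End TensorSquare.

(** * Deformation over Laurent series *)

Section InitialForms.
Variables (A : comNzRingType) (m n : nat).
Notation B := (laurent A).
Notation t := (laurent_mono 1 (1 : A)).

Lemma laurent_tV : t * laurent_mono (-1) 1 = 1.
Proof. by rewrite laurent_monoM mulr1 subrr. Qed.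

Definition coefmx (k : int) (X : 'M[B]_(m, n)) : 'M[A]_(m, n) := map_mx (coefl k) X.
Definition power_series_mx (X : 'M[B]_(m, n)) : Prop := forall i j, power_series (X i j).
(** Specialization at [t = 0]. As [t] is a unit, every element of a submodule can be rescaled to a
    power series, so restricting to power series loses nothing. *)
Definition initial (N : set 'M[B]_(m, n)) : set 'M[A]_(m, n) :=
  fun x => exists X, [/\ N X, power_series_mx X & x = coefmx 0 X].

Lemma coefmxP (X Y : 'M[B]_(m, n)) : (forall k, coefmx k X = coefmx k Y) -> X = Y.
Proof.
move=> H; apply/matrixP => i j; apply: laurentP => k.
by have /matrixP/(_ i j) := H k; rewrite !mxE.
Qed.

Lemma coefmx_t k X : coefmx k (t *: X) = coefmx (k - 1) X.
Proof. by apply/matrixP => i j; rewrite !mxE /coefl lcoef_monoM mul1r. Qed.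

Lemma coefmxZ k a X : coefmx k (laurent_const a *: X) = a *: coefmx k X.
Proof. by apply/matrixP => i j; rewrite !mxE coefl_constM. Qed.

Lemma coefmxD k X Y : coefmx k (X + Y) = coefmx k X + coefmx k Y.
Proof. by apply/matrixP => i j; rewrite !mxE. Qed.

Lemma power_series_mxD X Y :
  power_series_mx X -> power_series_mx Y -> power_series_mx (X + Y).
Proof. by move=> HX HY i j k Hk; rewrite mxE lcoefD HX// HY// addr0. Qed.

Lemma power_series_mxZ f X :
  power_series f -> power_series_mx X -> power_series_mx (f *: X).
Proof. by move=> Hf HX i j; rewrite mxE; exact: power_seriesM. Qed.

Lemma power_series_const a : power_series (laurent_const a : B).
Proof. by move=> i Hi /=; case: eqP => // i0; rewrite i0 in Hi. Qed.

Lemma power_series_mxP X : power_series_mx X <-> forall k, k < 0 -> coefmx k X = 0.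
Proof.
split=> [H k Hk|H i j k Hk]; first by apply/matrixP => i j; rewrite !mxE; exact: H.
by have /matrixP/(_ i j) := H k Hk; rewrite !mxE.
Qed.

Lemma power_series_mx_scale (X : 'M[B]_(m, n)) :
  exists k : nat, power_series_mx (t ^+ k *: X).
Proof.
have texp k (f : B) i : (t ^+ k * f) i = f (i - k%:Z).
  elim: k i => [|k IH] i; first by rewrite mul1r subr0.
  by rewrite exprS -mulrA lcoef_monoM mul1r IH; congr (f _); lia.
have /choice[b Hb] ij : exists k : nat, forall i, i < - k%:Z -> X ij.1 ij.2 i = 0.
  by have [c Hc] := lcoefP (X ij.1 ij.2); exists `|c|%N => i Hi; apply: Hc; lia.
exists (\max_ij b ij)%N => i j l Hl; rewrite mxE texp; apply: (Hb (i, j)).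
by have /= := leq_bigmax (F := b) (i, j); lia.
Qed.

Lemma submodule_initial N : submodule N -> submodule (initial N).
Proof.
move=> sN; split.
  exists 0; split; first exact: submodule0.
    by move=> i j k _; rewrite mxE.
  by apply/matrixP => i j; rewrite !mxE.
move=> a _ _ [X [NX pX ->]] [Y [NY pY ->]]; exists (laurent_const a *: X + Y); split.
- by apply: submoduleD => //; exact: submoduleZ.
- apply: power_series_mxD => //; apply: power_series_mxZ => //; exact: power_series_const.
by rewrite coefmxD coefmxZ.
Qed.

(* Successive approximation: the coefficients of the generators are built one power of t at a time. *)
Lemma initial_sub (N N' : set 'M[B]_(m, n)) :
  submodule N -> submodule N' -> N' `<=` N -> fin_gen (initial N') ->
  initial N `<=` initial N' -> N `<=` N'.
Proof.
move=> sN sN' N'N [I [u [uN' genu]]] iNN'.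
have /choice[U HU] j : exists X, [/\ N' X, power_series_mx X & u j = coefmx 0 X].
  exact: uN'.
suff psN : forall x, N x -> power_series_mx x -> N' x.
  move=> x Nx; have [k Hk] := power_series_mx_scale x.
  have -> : x = laurent_mono (-1) 1 ^+ k *: (t ^+ k *: x).
    by rewrite scalerA -exprMn mulrC laurent_tV expr1n scale1r.
  by apply: (submoduleZ _ sN'); apply: psN => //; exact: submoduleZ.
pose good (x : 'M[B]_(m, n)) := N x /\ power_series_mx x.
(* One approximation: remove a combination of the [U j] with the same constant term, then divide by
   [t]. Outside [good] a dummy value makes [choice] applicable. *)
have step x : exists ay : (I -> A) * 'M[B]_(m, n), good x ->
    good ay.2 /\ x = \sum_j laurent_const (ay.1 j) *: U j + t *: ay.2.
  have [gx|] := pselect (good x); last by move=> ?; exists (fun=> 0, 0).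
  have [Nx px] := gx.
  have [a aE] : exists a : I -> A, coefmx 0 x = \sum_j a j *: u j.
    by apply: genu; apply: iNN'; exists x.
  pose z := x - \sum_j laurent_const (a j) *: U j.
  exists (a, laurent_mono (-1) 1 *: z) => _ /=; split; last first.
    by rewrite scalerA laurent_tV scale1r addrC subrK.
  have NU : N (\sum_j laurent_const (a j) *: U j).
    apply: submodule_sum => // j _; apply: submoduleZ => //; apply: N'N.
    by case: (HU j).
  have pU : power_series_mx (\sum_j laurent_const (a j) *: U j).
    elim/big_ind: _ => [||j _]; [by move=> i j k _; rewrite mxE|exact: power_series_mxD|].
    by apply: power_series_mxZ; [exact: power_series_const|case: (HU j)].
  split; first by apply: submoduleZ => //; exact: submoduleB.
  apply/power_series_mxP => k Hk.
  have -> : coefmx k (laurent_mono (-1) 1 *: z) = coefmx (k + 1) z.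
    by apply/matrixP => i j; rewrite !mxE /coefl lcoef_monoM mul1r opprK.
  have zE l : coefmx l z = coefmx l x - coefmx l (\sum_j laurent_const (a j) *: U j).
    by apply/matrixP => i j; rewrite !mxE raddfB.
  rewrite zE; have [k1|k1] := ltP (k + 1) 0.
    by move/power_series_mxP: px => ->//; move/power_series_mxP: pU => ->//; rewrite subrr.
  have -> : k + 1 = 0 by lia.
  rewrite aE; apply/eqP; rewrite subr_eq0; apply/eqP.
  elim/big_rec2: _ => [|j y1 y2 _ ->]; first by apply/matrixP => i j; rewrite !mxE.
  by rewrite coefmxD coefmxZ; case: (HU j) => _ _ ->.
have {step} /choice[st Hst] := step.
move=> x Nx px; pose xs k := iter k (fun y => (st y).2) x.
pose a k := (st (xs k)).1.
have gxs k : good (xs k) by elim: k => //= k /Hst[].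
have xsE k : xs k = \sum_j laurent_const (a k j) *: U j + t *: xs k.+1.
  by have [_] := Hst _ (gxs k).
(* These series collect the coefficients found from step [k] on, so that the remainder [y k] is [t]
   times the remainder [y k.+1]. *)
pose c k j := series (fun l => a (k + l)%N j).
pose y k := xs k - \sum_j c k j *: U j.
have yE k : y k = t *: y k.+1.
  rewrite /y {1}xsE scalerBr scaler_sumr addrAC.
  have -> : \sum_j c k j *: U j = \sum_j laurent_const (a k j) *: U j
      + \sum_j t *: (c k.+1 j *: U j).
    rewrite -big_split; apply: eq_bigr => j _ /=.
    rewrite scalerA -scalerDl /c series_step addn0; congr ((_ + _ * series _) *: _).
    by apply/funext => l; rewrite addSnnS.
  by rewrite opprD addrA subrr add0r addrC.
have py k : power_series_mx (y k).
  apply: power_series_mxD; first by case: (gxs k).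
  rewrite -scaleN1r; apply: power_series_mxZ.
    by move=> i Hi; rewrite lcoefN /=; case: eqP => [i0|_]; [rewrite i0 in Hi|rewrite oppr0].
  elim/big_ind: _ => [||j _]; [by move=> i j l _; rewrite mxE|exact: power_series_mxD|].
  by apply: power_series_mxZ; [exact: seriesP|case: (HU j)].
(* The remainder is [t^K] times a power series for every [K]. *)
have y0 : y 0%N = 0.
  apply: coefmxP => k.
  have yK K : coefmx k (y 0%N) = coefmx (k - K%:Z) (y K).
    elim: K => [|K ->]; first by rewrite subr0.
    by rewrite yE coefmx_t; congr coefmx; lia.
  rewrite (yK `|k|.+1%N) (proj1 (power_series_mxP _) (py _)); last by lia.
  by apply/matrixP => i j; rewrite !mxE.
have -> : x = \sum_j c 0%N j *: U j by apply/eqP; rewrite -subr_eq0 -[_ - _]/(y 0%N) y0.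
by apply: submodule_sum => // j _; apply: submoduleZ => //; case: (HU j).
Qed.

End InitialForms.

Section LaurentDeformation.
Variables (A : comNzRingType) (n : nat) (D : 'M[A]_n).
Notation B := (laurent A).
Notation t := (laurent_mono 1 (1 : A)).
Notation DB := (map_mx (@laurent_const A) D).
Hypothesis char2 : forall x : A, x + x = 0.
Hypothesis D2 : D *m D = 0.

Lemma laurent_char2 (f : B) : f + f = 0.
Proof. by apply: laurentP => i; rewrite lcoefD char2. Qed.

Definition deform (X : 'M[B]_n) : 'M[B]_n := tdiff DB X + t *: tsym X.

Fact deform_linear : linear deform.
Proof.
move=> a X Y; rewrite /deform [tdiff _ _]linearP [tsym _]linearP /= [t *: _]scalerDr.
by rewrite scalerA mulrC -scalerA addrACA -scalerDr.
Qed.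
HB.instance Definition _ := GRing.isLinear.Build B 'M[B]_n 'M[B]_n *:%R deform deform_linear.

Lemma DB2 : DB *m DB = 0.
Proof. by rewrite -map_mxM D2 map_mx0. Qed.

Lemma tsym2 (X : 'M[B]_n) : tsym (tsym X) = 0.
Proof. by rewrite /tsym linearD /= trmxK [X^T + X]addrC; exact: (mx_char2 laurent_char2). Qed.

Lemma tsym_tdiff (X : 'M[B]_n) : tsym (tdiff DB X) = tdiff DB (tsym X).
Proof.
rewrite /tsym [RHS]linearD; congr (_ + _).
by rewrite /tdiff linearD /= !trmx_mul trmxK addrC.
Qed.

Lemma deform2 X : deform (deform X) = 0.
Proof.
rewrite /deform [tdiff DB (_ + _)]linearD /= (tdiff2 laurent_char2 _ DB2) add0r.
rewrite [tsym (_ + _)]linearD linearZ /= [tsym (_ *: _)]linearZ /= tsym2 scaler0 addr0.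
by rewrite -tsym_tdiff; exact: (mx_char2 laurent_char2).
Qed.

Lemma coefmx_tdiff k X : coefmx k (tdiff DB X) = tdiff D (coefmx k X).
Proof.
apply/matrixP => i j; rewrite !mxE raddfD !raddf_sum; congr (_ + _); apply: eq_bigr => l _.
  by rewrite !mxE; exact: coefl_constM.
by rewrite !mxE mulrC [RHS]mulrC; exact: coefl_constM.
Qed.

Lemma coefmx_tsym k (X : 'M[B]_n) : coefmx k (tsym X) = tsym (coefmx k X).
Proof. by apply/matrixP => i j; rewrite !mxE. Qed.

Lemma coefmx_deform k X :
  coefmx k (deform X) = tdiff D (coefmx k X) + tsym (coefmx (k - 1) X).
Proof. by rewrite coefmxD coefmx_t coefmx_tdiff coefmx_tsym. Qed.

(** Semicontinuity at [t = 0]. Constant terms of power series cycles of [deform] are cycles of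
    [tdiff D], and every boundary of [tdiff D] is such a constant term of a boundary. Strict
    inclusions survive by [initial_sub], whose finiteness condition comes from the length bound for
    [tdiff D]. *)
Lemma hlen_deform h : hlen setT (tdiff D) h -> hlen setT deform h.
Proof.
move=> hD l ch; apply: (hD).
have ps0 (X : 'M[B]_n) k : power_series_mx X -> k < 0 -> coefmx k X = 0.
  by move=> /power_series_mxP; apply.
have imB N : deform @` setT `<=` N -> tdiff D @` setT `<=` initial N.
  move=> BN _ [Y _ <-]; pose Y' := map_mx (@laurent_const A) Y.
  have cY' k : coefmx k Y' = if k == 0 then Y else 0.
    by apply/matrixP => i j; rewrite !mxE /coefl /=; case: eqP; rewrite ?mxE.
  exists (deform Y'); split.
  - by apply: BN; exists Y'.
  - apply/power_series_mxP => k Hk; rewrite coefmx_deform !cY'.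
    have /negbTE-> : k != 0 by lia.
    have /negbTE-> : k - 1 != 0 by lia.
    by rewrite !linear0 addr0.
  - by rewrite coefmx_deform !cY' eqxx linear0 addr0.
apply: (has_chainS (imB _ (@subset_refl _ _))).
apply: (@has_chain_map B A _ _ (@initial A n n) (deform @` setT)
   (setT `&` [set x | deform x = 0])) ch.
- move=> N [sN BN NZ]; split; first exact: submodule_initial.
  move=> _ [X [/NZ[_ dX] pX ->]]; split=> //=.
  have := coefmx_deform 0 X; rewrite dX (ps0 _ (0 - 1)) // linear0 addr0 => <-.
  by apply/matrixP => i j; rewrite !mxE.
- by move=> N N' NN' _ [X [NX pX ->]]; exists X; split=> //; exact: NN'.
- move=> N N' [sN BN NZ] [sN' BN' NZ'] NN' iN; apply: initial_sub => //.
  apply: (@fin_gen_length A _ (tdiff D @` setT) (setT `&` [set x | tdiff D x = 0]) h) => //.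
  + exact: submodule_im.
  + exact: fin_gen_im_mx.
  + by refine (@submodule_initial A n n N sN).
  + exact: imB.
  + move=> _ [X [/NZ[_ dX] pX ->]]; split=> //=.
    have := coefmx_deform 0 X; rewrite dX (ps0 _ (0 - 1)) // linear0 addr0 => <-.
    by apply/matrixP => i j; rewrite !mxE.
by split; [exact: submodule_im| |move=> _ [X _ <-]; split=> //=; exact: deform2].
Qed.

End LaurentDeformation.

(** * Homological perturbation in characteristic 2 *)

Section Perturbation.
Variables (R : comNzRingType) (V F : lmodType R).
Variables (d0 d1 h0 h dlt : {linear V -> V}) (i : {linear F -> V}) (p : {linear V -> F}).
Hypothesis char2 : forall x : V, x + x = 0.
Hypothesis dltE : forall x, dlt x = d0 x + d1 x.
Hypothesis dlt2 : forall x, dlt (dlt x) = 0.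
Hypothesis h0h0 : forall x, h0 (h0 x) = 0.
Hypothesis ph0 : forall x, p (h0 x) = 0.
Hypothesis ipE : forall x, i (p x) = x + d0 (h0 x) + h0 (d0 x).
Hypothesis hl : forall x, h x = h0 x + h0 (d1 (h x)).
Hypothesis hr : forall x, h x = h0 x + h (d1 (h0 x)).
Hypothesis hh0 : forall x, h (h0 x) = 0.

Lemma perturb_h2 x : h (h x) = 0.
Proof. by rewrite [h x]hl -linearD hh0. Qed.

Lemma perturb_ph x : p (h x) = 0.
Proof. by rewrite hl -linearD ph0. Qed.

Lemma perturb_hdh x :
  h (d0 (h x)) = h x + h (d1 (h x)) -> h (dlt (h x)) = h x.
Proof. by move=> e; rewrite dltE linearD e -addrA char2 addr0. Qed.

(** By [hr] and [hl] the map [h0] factors through [h] on either side. Hence the projection kills the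
    image of [h0], and, in the next lemma, [h0] kills the image of the projection. *)
Lemma perturb_proj_h0 x : (forall x, h (dlt (h x)) = h x) -> retract_proj dlt h (h0 x) = 0.
Proof.
move=> hdh.
have qh y : retract_proj dlt h (h y) = 0.
  by rewrite /retract_proj perturb_h2 hdh linear0 subr0 subrr.
have -> : h0 x = h (x + d1 (h0 x)) by rewrite linearD [in RHS]hr -addrA char2 addr0.
exact: qh.
Qed.

Lemma perturb_h0_proj x : (forall x, h (dlt (h x)) = h x) -> h0 (retract_proj dlt h x) = 0.
Proof.
move=> hdh.
have hq y : h (retract_proj dlt h y) = 0.
  by rewrite /retract_proj !linearB hdh perturb_h2 subr0 subrr.
have -> y : h0 y = h y + h0 (d1 (h y)) by rewrite [X in _ = X + _]hl -addrA char2 addr0.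
by rewrite hq !linear0 addr0.
Qed.

(** On the image of the projection, [i p] differs from the identity only by the term [h0 d0], which
    a second projection kills. *)
Lemma perturb_proj_ip x : (forall x, h (dlt (h x)) = h x) ->
  retract_proj dlt h (i (p (retract_proj dlt h x))) = retract_proj dlt h x.
Proof.
move=> hdh; rewrite ipE perturb_h0_proj// linear0 addr0.
by rewrite [LHS]linearD /= perturb_proj_h0// addr0 retract_proj_idem//; exact: perturb_h2.
Qed.

End Perturbation.

Section Neumann.
Variables (R : comNzRingType) (V : lmodType R) (u : {linear V -> V}) (C : nat).
Hypothesis u_nilp : forall x, iter C u x = 0.

(** The geometric series for the inverse of [1 - u], finite since [u] is nilpotent. *)
Definition neumann (x : V) : V := \sum_(r < C) iter r u x.

Fact neumann_linear : linear neumann.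
Proof.
move=> a x y; rewrite /neumann scaler_sumr -big_split; apply: eq_bigr => r _ /=.
by elim: (r : nat) => //= k ->; rewrite linearP.
Qed.
HB.instance Definition _ := GRing.isLinear.Build R V V *:%R neumann neumann_linear.

Lemma neumann_l x : neumann x = x + u (neumann x).
Proof.
rewrite /neumann; case: C u_nilp => [u0|c uc].
  by rewrite !big_ord0 linear0 addr0; exact/esym/(u0 x).
rewrite [LHS]big_ord_recl /=; congr (_ + _).
by rewrite linear_sum big_ord_recr /= -[u (iter c u x)]/(iter c.+1 u x) uc addr0.
Qed.

Lemma neumann_r x : neumann x = x + neumann (u x).
Proof.
rewrite /neumann; case: C u_nilp => [u0|c uc].
  by rewrite !big_ord0 addr0; exact/esym/(u0 x).
rewrite [LHS]big_ord_recl /=; congr (_ + _).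
rewrite big_ord_recr /= -iterSr uc addr0.
by apply: eq_bigr => r _; rewrite -iterSr.
Qed.

End Neumann.

(** * Retraction onto the diagonal *)

Section DiagonalRetract.
Variables (B : comNzRingType) (n : nat).
Variables (E : 'M[B]_n) (w : 'I_n -> nat) (t t' : B) (dlt : {linear 'M[B]_n -> 'M[B]_n}).
Hypothesis char2 : forall x : B, x + x = 0.
Hypothesis tt' : t * t' = 1.
Hypothesis dltE : forall X, dlt X = t *: tsym X + tdiff E X.
Hypothesis dlt2 : forall X, dlt (dlt X) = 0.
Hypothesis lE : lowering w E.

Let mchar2 (X : 'M[B]_n) : X + X = 0.
Proof. exact: mx_char2. Qed.

Definition diag_row (X : 'M[B]_n) : 'rV[B]_n := \row_j X j j.
(** A contraction of [tsym] off the diagonal, see [diag_diag_row]: on a pair of mirror entries the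
    kernel and the image of [tsym] are both the multiples of their sum, and this map moves the lower
    entry to the upper place. *)
Definition upper_mx (X : 'M[B]_n) : 'M[B]_n :=
  \matrix_(j, k) (if (j < k)%N then X k j else 0).
Definition sym_htpy (X : 'M[B]_n) : 'M[B]_n := t' *: upper_mx X.
Definition scaled_sym (X : 'M[B]_n) : 'M[B]_n := t *: tsym X.

Fact diag_row_linear : linear diag_row.
Proof. by move=> a X Y; apply/rowP => j; rewrite !mxE. Qed.
HB.instance Definition _ := GRing.isLinear.Build B 'M[B]_n 'rV[B]_n *:%R diag_row diag_row_linear.

Fact upper_mx_linear : linear upper_mx.
Proof.
by move=> a X Y; apply/matrixP => j k; rewrite !mxE; case: ifP => // _; rewrite mulr0 addr0.
Qed.
HB.instance Definition _ :=
  GRing.isLinear.Build B 'M[B]_n 'M[B]_n *:%R upper_mx upper_mx_linear.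

Fact sym_htpy_linear : linear sym_htpy.
Proof.
by move=> a X Y; rewrite /sym_htpy [upper_mx _]linearP scalerDr !scalerA [t' * a]mulrC.
Qed.
HB.instance Definition _ :=
  GRing.isLinear.Build B 'M[B]_n 'M[B]_n *:%R sym_htpy sym_htpy_linear.

Fact scaled_sym_linear : linear scaled_sym.
Proof.
by move=> a X Y; rewrite /scaled_sym [tsym _]linearP scalerDr !scalerA [t * a]mulrC.
Qed.
HB.instance Definition _ :=
  GRing.isLinear.Build B 'M[B]_n 'M[B]_n *:%R scaled_sym scaled_sym_linear.

Lemma upper_mx2 X : upper_mx (upper_mx X) = 0.
Proof. by apply/matrixP => j k; rewrite !mxE; case: ltngtP. Qed.

Lemma diag_row_upper X : diag_row (upper_mx X) = 0.
Proof. by apply/rowP => j; rewrite !mxE ltnn. Qed.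

Lemma upper_diag v : upper_mx (diag_mx v) = 0.
Proof.
apply/matrixP => j k; rewrite !mxE; case: ifP => // jk.
by case: eqP => // kj; move: jk; rewrite kj ltnn.
Qed.

Lemma upper_tsym_upper X : upper_mx (tsym (upper_mx X)) = upper_mx X.
Proof. by apply/matrixP => j k; rewrite !mxE; case: ltngtP; rewrite ?add0r. Qed.

Lemma diag_diag_row X : diag_mx (diag_row X) = X + tsym (upper_mx X) + upper_mx (tsym X).
Proof.
apply/matrixP => j k; rewrite !mxE; case: ltngtP => jk.
- have /negbTE-> : j != k by apply: contraTneq jk => ->; rewrite ltnn.
  by rewrite mulr0n addr0 addrA -[_ + _ + X k j]addrA char2 addr0 char2.
- have /negbTE-> : j != k by apply: contraTneq jk => ->; rewrite ltnn.
  by rewrite mulr0n add0r addr0 char2.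
- by move/val_inj: jk => ->; rewrite eqxx !addr0.
Qed.

Lemma diag_row_tsym X : diag_row (tsym X) = 0.
Proof. by apply/rowP => j; rewrite !mxE char2. Qed.

Lemma tsym_diag v : tsym (diag_mx v) = 0 :> 'M[B]_n.
Proof. by rewrite /tsym tr_diag_mx mchar2. Qed.

(** The reason for the gain from order [q] to order [2 q]: the first order term on the diagonal is
    [E j j * v j], once from each tensor factor, and cancels. *)
Lemma diag_row_tdiff_diag v : diag_row (tdiff E (diag_mx v)) = 0.
Proof.
apply/rowP => j; rewrite mxE /tdiff mul_mx_diag mul_diag_mx !mxE [v 0 j * _]mulrC.
exact: char2.
Qed.

Lemma diag_rowK v : diag_row (diag_mx v) = v.
Proof. by apply/rowP => j; rewrite !mxE eqxx. Qed.

Definition htpy_step : 'M[B]_n -> 'M[B]_n := sym_htpy \o tdiff E.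
HB.instance Definition _ := GRing.Linear.on htpy_step.

(** Bounds the total degree [w j + w k] in the tensor square: [tdiff E] lowers it and [sym_htpy]
    keeps it, so [htpy_step] is nilpotent. *)
Definition wsupp (c : nat) (X : 'M[B]_n) : Prop :=
  forall j k, X j k != 0 -> (w j + w k < c)%N.

Lemma wsupp_tdiff c X : wsupp c X -> wsupp c.-1 (tdiff E X).
Proof.
move=> HX j k; rewrite !mxE => nz.
have [|] := boolP [exists l, (E l j != 0) && (X l k != 0)].
  by case/existsP => l /andP[/lE wl /HX]; lia.
rewrite negb_exists => /forallP H1.
have [|] := boolP [exists l, (X j l != 0) && (E l k != 0)].
  by case/existsP => l /andP[/HX + /lE]; lia.
rewrite negb_exists => /forallP H2.
case/eqP: nz; rewrite !big1 ?addr0// => l _; rewrite ?mxE.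
- by have := H2 l; rewrite negb_and !negbK => /orP[/eqP->|/eqP->]; rewrite ?mul0r ?mulr0.
- by have := H1 l; rewrite negb_and !negbK => /orP[/eqP->|/eqP->]; rewrite ?mul0r ?mulr0.
Qed.

Lemma wsupp_sym_htpy c X : wsupp c X -> wsupp c (sym_htpy X).
Proof.
move=> HX j k; rewrite !mxE; case: ifP; rewrite ?mulr0 ?eqxx// => _ nz.
by rewrite addnC; apply: HX; apply: contraNneq nz => ->; rewrite mulr0.
Qed.

Lemma wsupp_iter c r X : wsupp c X -> wsupp (c - r) (iter r htpy_step X).
Proof.
move=> HX; elim: r => [|r IH]; first by rewrite subn0.
by rewrite subnS; apply/wsupp_sym_htpy/wsupp_tdiff.
Qed.

Definition wbound := (\max_j w j).*2.+1.

Lemma htpy_step_nilp X : iter wbound htpy_step X = 0.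
Proof.
have HX : wsupp wbound X.
  move=> j k _; rewrite /wbound ltnS -addnn; apply: leq_add; exact: leq_bigmax.
have := wsupp_iter (r := wbound) HX; rewrite subnn => H.
by apply/matrixP => j k; rewrite [RHS]mxE; apply/eqP; apply: contraT => /H; rewrite ltn0.
Qed.

(** The perturbed contraction [h0 + h0 d1 h0 + ...], with [h0 = sym_htpy] and [d1 = tdiff E]. *)
Definition htpy : 'M[B]_n -> 'M[B]_n := neumann htpy_step wbound \o sym_htpy.
HB.instance Definition _ := GRing.Linear.on htpy.

Let h0h0 X : sym_htpy (sym_htpy X) = 0.
Proof. by rewrite /sym_htpy linearZ /= upper_mx2 !scaler0. Qed.

Let h0dh0 X : sym_htpy (scaled_sym (sym_htpy X)) = sym_htpy X.
Proof.
rewrite /sym_htpy /scaled_sym [tsym _]linearZ [upper_mx _]linearZ /= [upper_mx (_ *: _)]linearZ /=.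
by rewrite upper_tsym_upper !scalerA -?mulrA tt' mulr1.
Qed.

Let h0i v : sym_htpy (diag_mx v) = 0.
Proof. by rewrite /sym_htpy upper_diag scaler0. Qed.

Let ph0 X : diag_row (sym_htpy X) = 0.
Proof. by rewrite /sym_htpy linearZ /= diag_row_upper scaler0. Qed.

Let ipE X : diag_mx (diag_row X) = X + scaled_sym (sym_htpy X) + sym_htpy (scaled_sym X).
Proof.
rewrite diag_diag_row /sym_htpy /scaled_sym [tsym (_ *: _)]linearZ [upper_mx (_ *: _)]linearZ /=.
by rewrite !scalerA [t' * t]mulrC tt' !scale1r.
Qed.

Let hl X : htpy X = sym_htpy X + sym_htpy (tdiff E (htpy X)).
Proof. by rewrite {1}/htpy /= neumann_l//; exact: htpy_step_nilp. Qed.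

Let hr X : htpy X = sym_htpy X + htpy (tdiff E (sym_htpy X)).
Proof. by rewrite {1}/htpy /= neumann_r//; exact: htpy_step_nilp. Qed.

Let hh0 X : htpy (sym_htpy X) = 0.
Proof. by rewrite /htpy /= h0h0 linear0. Qed.

Let hi X : htpy (diag_mx X) = 0.
Proof. by rewrite /htpy /= h0i linear0. Qed.

Let dltE' X : dlt X = scaled_sym X + tdiff E X.
Proof. exact: dltE. Qed.

Let hdh X : htpy (dlt (htpy X)) = htpy X.
Proof.
apply: (perturb_hdh (d0 := scaled_sym) (d1 := tdiff E)) => //.
rewrite -[RHS]/(htpy X + htpy (tdiff E (htpy X))) -[LHS]/(htpy (scaled_sym (htpy X))).
(* [htpy X] is a value of [sym_htpy], and [h0 d0 h0 = h0] absorbs the [scaled_sym] in between. *)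
have e : htpy X = sym_htpy (X + tdiff E (htpy X)) by rewrite [RHS]linearD -hl.
transitivity (htpy (X + tdiff E (htpy X))); last by rewrite linearD.
by rewrite {1}e [htpy (scaled_sym _)]/htpy /= h0dh0.
Qed.

Let h2 X : htpy (htpy X) = 0.
Proof. exact: (perturb_h2 (d1 := tdiff E) (h0 := sym_htpy)). Qed.

Let ph X : diag_row (htpy X) = 0.
Proof. exact: (perturb_ph (d1 := tdiff E) (h0 := sym_htpy)). Qed.

Let qipq X : retract_proj dlt htpy (diag_mx (diag_row (retract_proj dlt htpy X))) =
  retract_proj dlt htpy X.
Proof.
by apply: (@perturb_proj_ip _ _ _ scaled_sym (tdiff E) sym_htpy _ _ (@diag_mx B n) diag_row).
Qed.

Definition diag_diff : 'M[B]_n := lin1_mx (retract_diff dlt htpy (@diag_mx B n) diag_row).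

Lemma diag_diffE v : v *m diag_diff = diag_row (tdiff E (htpy (tdiff E (diag_mx v)))).
Proof.
rewrite mul_rV_lin1 -[LHS]/(retract_diff dlt htpy (@diag_mx B n) diag_row v).
rewrite retract_diffE//= !dltE tsym_diag scaler0 add0r diag_row_tdiff_diag sub0r.
rewrite linearD /= linearZ /= diag_row_tsym scaler0 add0r.
by apply/rowP => j; rewrite mxE; apply/eqP; rewrite eq_sym -addr_eq0 char2.
Qed.

Lemma diag_diff2 : diag_diff *m diag_diff = 0.
Proof.
apply/row_matrixP => j; rewrite row_mul rowE !mul_rV_lin1 row0.
by apply: (@retract_diff2 _ _ _ dlt htpy (@diag_mx B n) diag_row) => //; exact: diag_rowK.
Qed.

(** The [a]-th diagonal element has total degree [2 * w a]. The two outer [tdiff E] lower this by at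
    least 2 and the homotopy never raises it, so [2 * w j <= 2 * w a - 2]. *)
Lemma diag_diff_lowering : lowering w diag_diff.
Proof.
move=> a j nz.
have {nz} : ((delta_mx 0 a : 'rV[B]_n) *m diag_diff) 0 j != 0 by rewrite -rowE mxE.
rewrite diag_diffE mxE => nz.
have s1 : wsupp (w a + w a).+1 (diag_mx (delta_mx 0 a : 'rV[B]_n)).
  move=> k l; rewrite !mxE; have [->|] := eqVneq k l; last by rewrite mulr0n eqxx.
  by rewrite eqxx /=; have [->|] := eqVneq l a; rewrite ?eqxx// ltnS.
have s2 : wsupp (w a + w a) (htpy (tdiff E (diag_mx (delta_mx 0 a : 'rV[B]_n)))).
  move=> k l; rewrite /htpy /= /neumann summxE => nz'.
  have [r] : exists r : 'I_wbound, iter r htpy_step (sym_htpy (tdiff E (diag_mx (delta_mx 0 a)))) k l != 0.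
    apply/existsP; apply: contraNT nz' => /existsPn H.
    by rewrite big1// => r _; have := H r; rewrite negbK => /eqP.
  by move/(wsupp_iter (r := r) (wsupp_sym_htpy (wsupp_tdiff s1))) => /=; lia.
by have := wsupp_tdiff s2 nz; lia.
Qed.

Lemma hlen_diag_diff N : hlen setT dlt N -> hlen setT (mulmxr diag_diff : 'rV[B]_n -> _) N.
Proof.
move=> H.
apply: (hlen_retract (dlt := dlt) (Phi := retract_in dlt htpy (@diag_mx B n))
  (Psi := retract_out dlt htpy diag_row)) => //.
- move=> v; rewrite /= mul_rV_lin1; exact: retract_ind.
- move=> v; rewrite /= mul_rV_lin1; exact: retract_outd.
- by move=> v; apply: retract_outK => //; exact: diag_rowK.
Qed.

(** Each of the two outer [tdiff E] in [diag_diffE] supplies a factor from [J]; the homotopy between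
    them is linear and keeps entries in [J]. *)
Lemma diag_diff_entries (J K : set B^o) :
  submodule J -> submodule K ->
  (forall i j, J (E i j)) -> (forall x y, J x -> J y -> K (x * y)) ->
  forall i j, K (diag_diff i j).
Proof.
move=> sJ sK EJ JK a j.
have -> : diag_diff a j = ((delta_mx 0 a : 'rV[B]_n) *m diag_diff) 0 j by rewrite -rowE [RHS]mxE.
rewrite diag_diffE mxE.
have s1 X : forall k l, J (tdiff E X k l).
  move=> k l; rewrite !mxE; apply: (submoduleD sJ); apply: (submodule_sum _ sJ) => r _.
    by rewrite mxE mulrC; exact: (submoduleZ _ sJ).
  exact: (submoduleZ _ sJ).
have s2 (X : 'M[B]_n) : (forall k l, J (X k l)) -> forall k l, J (sym_htpy X k l).
  move=> HX k l; rewrite !mxE; apply: (submoduleZ _ sJ).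
  by case: ifP => // _; exact: (submodule0 sJ).
have s3 (X : 'M[B]_n) : (forall k l, J (X k l)) -> forall k l, J (htpy X k l).
  move=> HX k l; rewrite /htpy /= /neumann summxE; apply: (submodule_sum _ sJ) => -[r /= _] _.
  by elim: r k l => [|r IH] k l /=; apply: s2.
have s4 := s3 _ (s1 (diag_mx (delta_mx 0 a))).
rewrite !mxE; apply: (submoduleD sK); apply: (submodule_sum _ sK) => r _.
  by rewrite mxE; exact: JK.
by rewrite mulrC; exact: JK.
Qed.

End DiagonalRetract.

(** * Iteration of the doubling step *)

Definition ring_filtration (A : comNzRingType) (I : nat -> set A^o) : Prop :=
  (forall k, submodule (I k)) /\
  (forall a b x y, I a x -> I b y -> I (a + b)%N (x * y)).

Lemma submodule_laurent_ideal (A : comNzRingType) (I : set A^o) :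
  submodule I -> submodule (laurent_ideal I).
Proof.
move=> sI; split=> [i|f g h Hg Hh i]; first exact: (submodule0 sI).
rewrite lcoefD; apply: (submoduleD sI) => //.
have [m Hm] := lcoefP f; have [m' Hm'] := lcoefP g.
rewrite lcoefM (zsumE (laurent_window Hm Hm')); apply: (submodule_sum _ sI) => j _.
by apply: (submoduleZ _ sI); exact: Hg.
Qed.

Lemma filtration_laurent (A : comNzRingType) (I : nat -> set A^o) :
  ring_filtration I -> ring_filtration (fun k => laurent_ideal (I k)).
Proof.
move=> [sI mI]; split=> [k|a b f g Hf Hg i]; first exact: submodule_laurent_ideal.
have [m Hm] := lcoefP f; have [m' Hm'] := lcoefP g.
rewrite lcoefM (zsumE (laurent_window Hm Hm')); apply: (submodule_sum _ (sI _)) => j _.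
exact: mI.
Qed.

(** Strict inclusions of ideals of [A] persist after extension to Laurent series, because they are
    detected by constants. *)
Lemma length_le_laurent (A : comNzRingType) (I : set A^o) N :
  submodule I ->
  length_le (laurent_ideal I) setT N -> length_le I setT N.
Proof.
move=> sI HN l ch; apply: HN.
apply: (@has_chain_map A (laurent A) A^o (laurent A)^o
  (fun N => laurent_ideal N) I setT) ch => //.
- by move=> N' [sN' _ _]; split=> //; exact: submodule_laurent_ideal.
- by move=> N1 N2 H f Hf i; exact/H/Hf.
- move=> N1 N2 [sN1 _ _] [sN2 _ _] _ H x Nx.
  have := H (@laurent_const A x); rewrite /laurent_ideal /= => /(_ _ 0); rewrite eqxx.
  by apply=> i; case: eqP => // _; exact: (submodule0 sN2).
by split.
Qed.

(** A basis vector [e] of least degree is a cycle, and a multiple [x *: e] can be a boundary only if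
    [x] lies in [I]. So [A/I] is no longer than the homology. *)
Lemma length_le_bottom (A : comNzRingType) (I : set A^o) n (D : 'M[A]_n) w N :
  submodule I -> D *m D = 0 -> lowering w D -> (0 < n)%N -> (forall i j, I (D i j)) ->
  hlen setT (mulmxr D : 'rV[A]_n -> _) N -> length_le I setT N.
Proof.
move=> sI D2 lD n0 ID HN l ch; apply: HN.
pose i0 := Ordinal n0; pose a := [arg min_(i < i0) w i]%N.
have amin j : (w a <= w j)%N by rewrite /a; case: arg_minnP => // i _; apply.
pose e : 'rV[A]_n := delta_mx 0 a.
have eD : e *m D = 0.
  rewrite -rowE; apply/rowP => j; rewrite !mxE; apply/eqP/contraT => /lD.
  by rewrite ltnNge amin.
pose f (N' : set A^o) := sum_set ((fun b => b *: e) @` N') ((fun y => y *m D) @` setT).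
have sD : submodule ((fun y : 'rV[A]_n => y *m D) @` setT).
  exact: (submodule_im (mulmxr D) (@submoduleT _ _)).
have sE (N' : set A^o) : submodule N' -> submodule ((fun b => b *: e) @` N').
  move=> sN'; split; first by exists 0; rewrite ?scale0r//; exact: submodule0.
  move=> c _ _ [b Nb <-] [b' Nb' <-]; exists (c * b + b'); last by rewrite scalerDl scalerA.
  exact: (proj2 sN').
suff : has_chain (setT `&` [set x | x *m D = 0]) l (f I).
  by apply: has_chainS; exact: (sum_setr (sE _ sI)).
apply: (@has_chain_map A A A^o _ f I setT) ch => //.
- move=> N' [sN' _ _]; split; first by apply: submodule_add => //; exact: sE.
  move=> _ [_ [_ [[b _ <-] [y _ <-] ->]]]; split=> //=.
  by rewrite mulmxDl -scalemxAl eD scaler0 add0r -mulmxA D2 mulmx0.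
- move=> N1 N2 H _ [_ [y [[b Nb <-] Hy ->]]]; exists (b *: e), y; split=> //.
  by exists b => //; exact: H.
- move=> N1 N2 [sN1 IN1 _] [sN2 _ _] _ H x Nx.
  have [] := H (x *: e).
    by exists (x *: e), 0; split; [exists x | exists 0; rewrite ?mul0mx | rewrite addr0].
  move=> _ [_ [[b Nb <-] [y _ <-] /matrixP/(_ 0 a)]].
  rewrite !mxE !eqxx !mulr1 => ->.
  apply: (submoduleD sN1) => //; apply: IN1; apply: (submodule_sum _ sI) => j _.
  exact: (submoduleZ _ sI).
by split.
Qed.

(** The ring is quantified after [e] because one step replaces [A], [q] and [h] by [laurent A],
    [2 q] and [n h], while [n] and [w] stay. The bound for Laurent series then descends to [A]. *)
Theorem length_growth e : forall (A : comNzRingType) (I : nat -> set A^o) n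
    (D : 'M[A]_n) w q h,
  (forall x : A, x + x = 0) -> ring_filtration I ->
  D *m D = 0 -> lowering w D -> (0 < n)%N -> (forall i j, I q (D i j)) ->
  hlen setT (mulmxr D : 'rV[A]_n -> _) h ->
  length_le (I (q * 2 ^ e)%N) setT (n ^ e * h).
Proof.
elim: e => [|e IH] A I n D w q h char2 [sI mI] D2 lD n0 ID hD.
  by rewrite muln1 mul1n; exact: (length_le_bottom (sI _) D2 lD n0 ID hD).
have char2B := laurent_char2 char2.
pose E := map_mx (@laurent_const A) D.
have lE : lowering w E.
  move=> i j; rewrite mxE => nz; apply: lD; apply: contraNneq nz => ->.
  by apply/eqP; exact: (raddf0 (@laurent_const A)).
pose t : laurent A := laurent_mono 1 1; pose t' : laurent A := laurent_mono (-1) 1.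
have tt' : t * t' = 1 by exact: laurent_tV.
have dE X : deform D X = t *: tsym X + tdiff E X by rewrite addrC.
have dd := deform2 char2 D2.
have H1 := hlen_deform char2 D2 (hlen_tdiff char2 D2 lD hD).
have H2 := hlen_diag_diff char2B tt' dE dd lE H1.
have sIB := filtration_laurent (conj sI mI).
have EI i j : laurent_ideal (I q) (E i j).
  by move=> k; rewrite mxE /=; case: eqP => // _; exact: (submodule0 (sI q)).
have KI := diag_diff_entries w t' char2B dE (proj1 sIB q) (proj1 sIB (q + q)%N) EI
  (proj2 sIB q q).
apply: length_le_laurent; first exact: sI.
have -> : (q * 2 ^ e.+1 = (q + q) * 2 ^ e)%N by rewrite expnS; lia.
rewrite expnSr -mulnA.
exact: (IH _ _ _ _ _ _ _ char2B sIB (diag_diff2 char2B tt' dE dd lE)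
  (diag_diff_lowering char2B dE lE) n0 KI H2).
Qed.

(** * Noetherian rings and the Artin-Rees lemma *)

Definition noeth (R : comNzRingType) : Prop :=
  forall I : set R^o, submodule I -> fin_gen I.

Lemma noetherian_noeth (R : comNzRingType) : noetherian R -> noeth R.
Proof.
move=> nR I sI; pose J : {pred R^o} := fun x => `[< I x >].
have [|n [g Hg]] := nR J.
  split=> [|a u v]; rewrite !unfold_in; first by apply/asboolP; exact: (submodule0 sI).
  by move=> /asboolP Iu /asboolP Iv; apply/asboolP; apply: (proj2 sI).
exists 'I_n, g; split=> [j|x Ix].
  suff : g j \in J by rewrite unfold_in => /asboolP.
  apply/Hg; exists (fun i => (i == j)%:R); rewrite (bigD1 j)//= eqxx mul1r big1 ?addr0// => i.
  by move=> /negbTE->; rewrite mul0r.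
by apply/Hg; rewrite unfold_in; exact/asboolP.
Qed.

Section FinGen.
Variable R : comNzRingType.

Lemma fin_gen_im (V W : lmodType R) (f : {linear V -> W}) (N : set V) :
  fin_gen N -> fin_gen (f @` N).
Proof.
move=> [I [u [Nu Hu]]]; exists I, (f \o u); split=> [j|_ [x /Hu[a ->] <-]].
  by exists (u j).
by exists a; rewrite linear_sum; apply: eq_bigr => j _; rewrite linearZ.
Qed.

Lemma fin_gen_extension (V W : lmodType R) (f : {linear V -> W}) (N : set V) :
  submodule N -> fin_gen (f @` N) -> fin_gen (N `&` [set x | f x = 0]) -> fin_gen N.
Proof.
move=> sN [I [u [Nu Hu]]] [J [v [Nv Hv]]].
have /choice[u' Hu'] j : exists x, N x /\ f x = u j by have [x Nx fx] := Nu j; exists x.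
exists (I + J)%type, (fun s => match s with inl i => u' i | inr j => v j end); split.
  by case=> [i|j]; [case: (Hu' i)|case: (Nv j)].
move=> x Nx; have [a aE] : exists a : I -> R, f x = \sum_j a j *: u j by apply: Hu; exists x.
have [|b bE] := Hv (x - \sum_j a j *: u' j).
  split; last first.
    rewrite /= linearB aE linear_sum; apply/eqP; rewrite subr_eq0; apply/eqP/eq_bigr => j _.
    by rewrite linearZ; case: (Hu' j) => _ ->.
  apply: submoduleB => //; apply: submodule_sum => // j _; apply: submoduleZ => //.
  by case: (Hu' j).
exists (fun s => match s with inl i => a i | inr j => b j end).
by rewrite big_sumType /= -bE addrC subrK.
Qed.

Lemma fin_gen_sub0 (V : lmodType R) (N : set V) : N `<=` [set 0] -> fin_gen N.
Proof.
move=> N0; exists void, (fun v : void => match v with end); split=> [[]|x /N0 /= ->].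
by exists (fun=> 0); rewrite big1 // => -[].
Qed.

Lemma noeth_row n (N : set 'rV[R]_n) : noeth R -> submodule N -> fin_gen N.
Proof.
move=> nR; elim: n N => [|n IH] N sN.
  by apply: fin_gen_sub0 => x _; rewrite [x]thinmx0.
pose f (v : 'rV[R]_(1 + n)) : R^o := lsubmx v 0 0.
have fl : linear f by move=> a x y; rewrite /f linearP !mxE.
pose F : {linear 'rV[R]_(1 + n) -> R^o} := HB.pack f (GRing.isLinear.Build _ _ _ _ f fl).
pose g (v : 'rV[R]_n) : 'rV[R]_(1 + n) := row_mx 0 v.
have gl : linear g by move=> a x y; rewrite /g scale_row_mx add_row_mx scaler0 addr0.
pose G : {linear 'rV[R]_n -> 'rV[R]_(1 + n)} := HB.pack g (GRing.isLinear.Build _ _ _ _ g gl).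
apply: (@fin_gen_extension _ _ F) => //; first by apply: nR; exact: submodule_im.
have -> : N `&` [set x | F x = 0] = G @` (fun v => N (G v)).
  apply/seteqP; split=> [x [Nx /= fx]|_ [v Nv <-]].
    have [r xE] : exists r, x = G r.
      exists (rsubmx (x : 'rV_(1 + n))).
rewrite -[LHS](@hsubmxK _ 1 1 n x) /= /g.
      suff -> : lsubmx (x : 'rV_(1 + n)) = 0 by [].
      by apply/rowP => j; rewrite ord1 [RHS]mxE; exact: fx.
    by rewrite xE in Nx *; exists r.
  by split=> //=; rewrite /f row_mxKl mxE.
by apply/fin_gen_im/IH/(submodule_preim G).
Qed.

End FinGen.

(** [L] is the ideal of leading coefficients; permitting [p] of smaller size puts 0 into it.
    Polynomials with leading coefficients generating [L], shifted to a common degree [K], reduce any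
    element to size at most [K], and those form a submodule of [A^K]. *)
Lemma hilbert_basis (A : comNzRingType) : noeth A -> noeth {poly A}.
Proof.
move=> nA N sN.
pose L : set A^o := fun a => exists (p : {poly A}) k, [/\ N p, (size p <= k.+1)%N & p`_k = a].
have shift (p : {poly A}) k j : (size p <= k.+1)%N ->
    (size ('X^j * p)%R <= (k + j).+1)%N /\ ('X^j * p)`_(k + j) = p`_k.
  move=> sp; rewrite coefXnM ltnNge leq_addl /= addnK; split=> //.
  have [->|p0] := eqVneq p 0; first by rewrite mulr0 size_poly0.
  by apply: leq_trans (size_polyMleq _ _) _; rewrite size_polyXn; lia.
have sL : submodule L.
  split; first by exists 0, 0%N; rewrite size_poly0 coef0; split=> //; exact: (submodule0 sN).
  move=> c _ _ [p [k [Np sp <-]]] [p' [k' [Np' sp' <-]]].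
  have [s1 e1] := shift p k k' sp; have [s2 e2] := shift p' k' k sp'.
  exists (c%:P * ('X^k' * p) + 'X^k * p'), (k + k')%N; split.
  - by apply: (proj2 sN); apply: (submoduleZ _ sN).
  - apply: leq_trans (size_polyD _ _) _; rewrite geq_max [in X in _ && X]addnC s2 andbT.
    by rewrite mul_polyC; apply: leq_trans (size_scale_leq _ _) s1.
  - by rewrite coefD coefCM e1 [in X in _ + X]addnC e2.
have [I [u [Lu Hu]]] := nA L sL.
have /choice[pk Hpk] j : exists pk : {poly A} * nat,
    [/\ N pk.1, (size pk.1 <= pk.2.+1)%N & pk.1`_(pk.2) = u j].
  by have [p [k ?]] := Lu j; exists (p, k).
pose K := (\max_j (pk j).2)%N; pose q j := 'X^(K - (pk j).2) * (pk j).1.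
have Hq j : [/\ N (q j), (size (q j) <= K.+1)%N & (q j)`_K = u j].
  have [Np sp e] := Hpk j; have [s1 e1] := shift _ _ (K - (pk j).2)%N sp.
  have kK : ((pk j).2 <= K)%N by apply: (leq_bigmax j).
  by rewrite subnKC// in s1 e1; split=> //; [apply: (submoduleZ _ sN)|rewrite e1].
have [J [v [Jv Hv]]] : fin_gen (fun r : 'rV[A]_K => N (rVpoly r)).
  apply: noeth_row => //; split; first by rewrite linear0; exact: (submodule0 sN).
  by move=> a x y Nx Ny; rewrite linearP /= -mul_polyC; exact: (proj2 sN).
exists (I + J)%type, (fun s => match s with inl i => q i | inr j => rVpoly (v j) end); split.
  by case=> [i|j]; [case: (Hq i)|exact: Jv].
pose gen (x : {poly A}) := exists a : I + J -> {poly A},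
  x = \sum_s a s *: (match s with inl i => q i | inr j => rVpoly (v j) end : {poly A}^o).
have genD x y : gen x -> gen y -> gen (x + y).
  move=> [a ->] [b ->]; exists (fun s => a s + b s); rewrite -big_split.
  by apply: eq_bigr => s _ /=; rewrite scalerDl.
move=> x; rewrite -/(gen x).
elim: {x}(size x) {-2}x (leqnn (size x)) => [|d IH] x sx Nx.
  exists (fun=> 0); rewrite big1 => [|s _]; last by rewrite scale0r.
  by apply/eqP; rewrite -size_poly_leq0.
have [dK|Kd] := ltnP d K.
  have [|b bE] := Hv (poly_rV x); first by rewrite poly_rV_K// (leq_trans sx).
  exists (fun s => match s with inl _ => 0 | inr j => (b j)%:P end).
  rewrite big_sumType /= big1 ?add0r => [|i _]; last by rewrite scale0r.
  rewrite -[LHS](@poly_rV_K _ K) ?(leq_trans sx)// bE linear_sum; apply: eq_bigr => j _.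
  by rewrite linearZ /= -mul_polyC.
have [a aE] : exists a : I -> A, x`_d = \sum_j a j *: (u j : A^o).
  by apply: Hu; exists x, d.
pose y := \sum_j ((a j)%:P * 'X^(d - K)) * q j.
have gy : gen y.
  exists (fun s => match s with inl j => (a j)%:P * 'X^(d - K) | inr j => 0 end).
  by rewrite big_sumType /= [X in _ + X]big1 ?addr0// => j _; rewrite scale0r.
have Ny : N y.
  by apply: (submodule_sum _ sN) => j _; apply: (submoduleZ _ sN); case: (Hq j).
rewrite -[x](subrK y); apply: genD => //; apply: IH; last exact: (submoduleB sN).
have sy : (size y <= d.+1)%N.
  apply: (big_ind (fun z : {poly A} => size z <= d.+1)%N) => [|z z' Hz Hz'|j _].
  - by rewrite size_poly0.
  - by apply: leq_trans (size_polyD _ _) _; rewrite geq_max Hz.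
  - case: (Hq j) => _ sq _; have [s1 _] := shift _ _ (d - K)%N sq.
    rewrite -mulrA mul_polyC; apply: leq_trans (size_scale_leq _ _) _.
    by rewrite subnKC in s1.
apply/leq_sizeP => k dk; rewrite coefB.
have [kd|kd] := eqVneq k d; last first.
  have {}dk : (d < k)%N by rewrite ltn_neqAle eq_sym kd.
  by rewrite !nth_default ?subrr// (leq_trans _ dk).
rewrite kd aE coef_sum; apply/eqP; rewrite subr_eq0; apply/eqP/eq_bigr => j _.
case: (Hq j) => _ sq <-; have [_] := shift _ _ (d - K)%N sq.
by rewrite subnKC// -mulrA coefCM => ->.
Qed.

Section IdealPowers.
Variable R : comNzRingType.
Implicit Types I J m : set R^o.

Definition ideal_mul I J : set R^o := fun z =>
  exists (s : seq (R * R)), (forall xy, xy \in s -> I xy.1 /\ J xy.2) /\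
    z = \sum_(xy <- s) xy.1 * xy.2.

Fixpoint ideal_pow m k : set R^o := if k is k'.+1 then ideal_mul m (ideal_pow m k') else setT.

Lemma submodule_ideal_mul I J : submodule J -> submodule (ideal_mul I J).
Proof.
move=> sJ; split; first by exists [::]; rewrite big_nil.
move=> c _ _ [s [Hs ->]] [s' [Hs' ->]].
exists ([seq (xy.1, c * xy.2) | xy <- s] ++ s'); split.
  move=> xy; rewrite mem_cat => /orP[/mapP[ab /Hs[Ia Jb] ->]|/Hs'//].
  by split=> //=; exact: (submoduleZ _ sJ).
rewrite big_cat big_map; congr (_ + _).
rewrite -[LHS]/(c * _) big_distrr; apply: eq_bigr => xy _ /=.
by rewrite mulrCA.
Qed.

Lemma ideal_mul_in I J x y : I x -> J y -> ideal_mul I J (x * y).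
Proof. by move=> Ix Jy; exists [:: (x, y)]; rewrite big_seq1; split=> // xy /[!inE] /eqP->. Qed.

Lemma ideal_mul_min I J (K : set R^o) : submodule K ->
  (forall x y, I x -> J y -> K (x * y)) -> ideal_mul I J `<=` K.
Proof.
move=> sK H _ [s [Hs ->]]; rewrite big_seq; apply: (submodule_sum _ sK) => xy /Hs[].
exact: H.
Qed.

Lemma submodule_ideal_pow m k : submodule (ideal_pow m k).
Proof. by elim: k => [|k IH] //=; exact: submodule_ideal_mul. Qed.

Lemma ideal_powM m a b x y :
  ideal_pow m a x -> ideal_pow m b y -> ideal_pow m (a + b) (x * y).
Proof.
elim: a x y => [|a IH] x y; first by move=> _ Hy; exact: (submoduleZ _ (submodule_ideal_pow m b)).
move=> Hx Hy.
have sK : submodule (fun x : R^o => ideal_pow m (a.+1 + b) (x * y)).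
  split; first by rewrite mul0r; exact: (submodule0 (submodule_ideal_pow _ _)).
  move=> c u v Hu Hv; rewrite mulrDl -mulrA.
  exact: (proj2 (submodule_ideal_pow m _)).
apply: (ideal_mul_min sK _ Hx) => u v mu Hv; rewrite -mulrA addSn.
by apply: ideal_mul_in => //; exact: IH.
Qed.

Lemma ideal_powS m k : ideal_pow m k.+1 `<=` ideal_pow m k.
Proof.
apply: ideal_mul_min; first exact: submodule_ideal_pow.
by move=> x y _; exact: (submoduleZ _ (submodule_ideal_pow m k)).
Qed.

Lemma ideal_pow_leq m k l : (k <= l)%N -> ideal_pow m l `<=` ideal_pow m k.
Proof.
move=> /subnK <-; elim: (l - k)%N => [|c IH] //.
exact: subset_trans (@ideal_powS _ _) IH.
Qed.

Lemma ideal_pow1 m : submodule m -> ideal_pow m 1 `<=` m.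
Proof.
by move=> sm; apply: ideal_mul_min => // x y mx _; rewrite mulrC; exact: (submoduleZ _ sm).
Qed.

(** The Rees algebra, as the set of polynomials whose coefficient at ['X^i] lies in the [i]-th power
    of [m]. *)
Definition in_rees m (f : {poly R}) : Prop := forall i, ideal_pow m i f`_i.

Lemma in_reesM m f g : in_rees m f -> in_rees m g -> in_rees m (f * g).
Proof.
move=> Hf Hg i; rewrite coefM; apply: (submodule_sum _ (submodule_ideal_pow m i)) => j _.
have ji : (j <= i)%N by rewrite -ltnS.
by rewrite -{1}(subnKC ji); exact: ideal_powM.
Qed.

Lemma in_reesD m f g : in_rees m f -> in_rees m g -> in_rees m (f + g).
Proof.
by move=> Hf Hg i; rewrite coefD; exact: (submoduleD (submodule_ideal_pow m i)).
Qed.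

Lemma in_rees_mono m i a : ideal_pow m i a -> in_rees m (a%:P * 'X^i).
Proof.
move=> Ha j; rewrite coefCM coefXn; case: eqP => [->|_]; first by rewrite mulr1.
by rewrite mulr0; exact: (submodule0 (submodule_ideal_pow m j)).
Qed.

(* The Rees algebra is the image of a polynomial ring over R, one variable per generator of m. *)
Lemma rees_algebra_gen m (s : seq R) :
  noeth R -> submodule m -> (forall x, x \in s -> m x) ->
  exists (B : comNzRingType) (phi : {rmorphism B -> {poly R}}),
    [/\ noeth B, forall b, in_rees m (phi b), forall c, exists b, phi b = c%:P
      & forall x, x \in s -> exists b, phi b = x%:P * 'X].
Proof.
move=> nR sm; elim: s => [_|x s IH Hs].
  exists R, (@polyC R); split=> // [b i|c]; last by exists c.
  rewrite coefC; case: eqP => [->|_] //; exact: (submodule0 (submodule_ideal_pow m i)).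
have [|B [phi [nB Hphi phiC phiX]]] := IH; first by move=> y ys; apply: Hs; rewrite inE ys orbT.
pose xX : {poly R} := x%:P * 'X.
have rX : in_rees m xX.
  apply: (@in_rees_mono m 1); rewrite /= -[x]mulr1; apply: ideal_mul_in => //.
  by apply: Hs; rewrite inE eqxx.
pose psi : {rmorphism {poly B} -> {poly R}} :=
  (horner_eval xX : {rmorphism {poly {poly R}} -> {poly R}}) \o map_poly phi.
have psiC b : psi b%:P = phi b by rewrite /psi /= /horner_eval map_polyC hornerC.
exists {poly B}, psi; split=> [|b|c|y].
- exact: hilbert_basis.
- elim/poly_ind: b => [|p b IHp]; first by rewrite rmorph0 => i; rewrite coef0;
    exact: (submodule0 (submodule_ideal_pow m i)).
  rewrite rmorphD rmorphM psiC; apply: in_reesD => //; apply: in_reesM => //.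
  by rewrite /psi /= /horner_eval map_polyX hornerX.
- by have [b <-] := phiC c; exists b%:P.
- rewrite inE => /orP[/eqP->|/phiX[b <-]]; last by exists b%:P.
  by exists 'X; rewrite /psi /= /horner_eval map_polyX hornerX.
Qed.

(** The Rees algebra is used only as the image of a Noetherian ring [B]; finite generation is then
    available for ideals of [B]. *)
Lemma rees_algebra m : noeth R -> submodule m ->
  exists (B : comNzRingType) (phi : {rmorphism B -> {poly R}}),
    noeth B /\ forall f, in_rees m f <-> exists b, phi b = f.
Proof.
move=> nR sm; have [I [u [mu Hu]]] := nR m sm.
have [|B [phi [nB Hphi phiC phiX]]] := @rees_algebra_gen m [seq u i | i <- enum I] nR sm.
  by move=> _ /mapP[i _ ->].
exists B, phi; split=> // f; split=> [Hf|[b <-]//].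
have imD g h : (exists b, phi b = g) -> (exists b, phi b = h) -> exists b, phi b = g + h.
  by move=> [b <-] [b' <-]; exists (b + b'); rewrite rmorphD.
have imM g h : (exists b, phi b = g) -> (exists b, phi b = h) -> exists b, phi b = g * h.
  by move=> [b <-] [b' <-]; exists (b * b'); rewrite rmorphM.
have im0 : exists b, phi b = 0 by exists 0; rewrite rmorph0.
have mono i a : ideal_pow m i a -> exists b, phi b = a%:P * 'X^i.
  elim: i a => [|i IH] a; first by move=> _; rewrite mulr1; exact: phiC.
  case=> s [Hs ->]; rewrite rmorph_sum big_distrl big_seq.
  apply: (big_ind (fun g => exists b, phi b = g)) => // -[x y] /Hs[/= mx Hy].
  rewrite rmorphM exprS mulrACA; apply: (imM); last exact: IH.
  have [a' ->] := Hu x mx; rewrite rmorph_sum big_distrl.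
  apply: (big_ind (fun g => exists b, phi b = g)) => // j _ /=.
  rewrite -[a' j *: u j]/(a' j * u j) rmorphM -mulrA; apply: (imM); first exact: phiC.
  by apply: phiX; rewrite map_f// mem_enum.
rewrite -[f]coefK poly_def; apply: (big_ind (fun g => exists b, phi b = g)) => // i _.
by rewrite -mul_polyC; exact: mono.
Qed.

(** Let [J] be the ideal of elements of [B] whose image has all coefficients in [N]. A preimage of
    [y 'X^n] lies in [J], so it is a combination of finitely many generators; comparing coefficients
    at ['X^n] leaves a factor in a power of [m] at least [n - c], where [c] bounds the sizes of the
    images of the generators. *)
Lemma artin_rees m N : noeth R -> submodule m -> submodule N ->
  exists c, forall n y, ideal_pow m n y -> N y -> ideal_mul (ideal_pow m (n - c)) N y.
Proof.
move=> nR sm sN; have [B [phi [nB Hphi]]] := rees_algebra nR sm.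
pose J : set B^o := fun b => forall i, N (phi b)`_i.
have [|K [u [Ju Hu]]] := nB J.
  split=> [i|a x y Jx Jy i]; first by rewrite rmorph0 coef0; exact: (submodule0 sN).
  rewrite -[a *: x]/(a * x) rmorphD rmorphM coefD; apply: (submoduleD sN) => //.
  by rewrite coefM; apply: (submodule_sum _ sN) => j _; exact: (submoduleZ _ sN).
exists (\max_j size (phi (u j)))%N => n y Hy Ny.
have [b bE] : exists b, phi b = y%:P * 'X^n by apply/Hphi/in_rees_mono.
have Jb : J b.
  by move=> i; rewrite bE coefCM mulrC; exact: (submoduleZ _ sN).
have [a aE] := Hu b Jb.
have -> : y = (phi b)`_n by rewrite bE coefCM coefXn eqxx mulr1.
have sM := submodule_ideal_mul (ideal_pow m (n - \max_j size (phi (u j)))) sN.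
rewrite aE rmorph_sum coef_sum; apply: (submodule_sum _ sM) => j _.
rewrite -[a j *: u j]/(a j * u j) rmorphM mulrC coefM; apply: (submodule_sum _ sM) => i _.
have [si|si] := ltnP i (size (phi (u j))); last first.
  by rewrite nth_default// mul0r; exact: (submodule0 sM).
rewrite mulrC; apply: ideal_mul_in; last exact: Ju.
have /Hphi/(_ (n - i)%N) : exists b, phi b = phi (a j) by exists (a j).
apply: ideal_pow_leq; apply: leq_sub2l; apply: leq_trans (ltnW si) _.
exact: (leq_bigmax j).
Qed.

End IdealPowers.

(** * Growth of the length of R/m^n *)

Lemma quotient_ring (R : comNzRingType) (J : set R^o) :
  submodule J -> ~ J 1 -> exists (A : comNzRingType) (pi : {rmorphism R -> A}),
    (forall a, exists x, pi x = a) /\ forall x, pi x = 0 <-> J x.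
Proof.
move=> sJ J1; pose I : {pred R} := fun x => `[< J x >].
have cI : idealr_closed I.
  split; first by rewrite unfold_in; apply/asboolP; exact: (submodule0 sJ).
    by rewrite unfold_in; apply/asboolP.
  move=> a u v; rewrite !unfold_in => /asboolP Ju /asboolP Jv; apply/asboolP.
  exact: (proj2 sJ).
pose II : idealr R := HB.pack I (isIdealr.Build R I cI).
pose f (x : R) : {ideal_quot II} := (\pi_{ideal_quot II} x)%qT.
have fB : zmod_morphism f by move=> x y; exact: raddfB.
have fM : monoid_morphism f by split=> [|x y]; [exact: rmorph1|exact: rmorphM].
pose F : {rmorphism R -> {ideal_quot II}} := HB.pack f
  (GRing.isZmodMorphism.Build _ _ f fB) (GRing.isMonoidMorphism.Build _ _ f fM).
exists {ideal_quot II}, F; split=> [a|x]; first by exists (repr a); exact: reprK.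
rewrite -[F x]/(f x) -(raddf0 F); split=> [/eqP|Jx].
  by rewrite /= /f -Quotient.idealrBE subr0 => /asboolP.
by apply/eqP; rewrite /= /f -Quotient.idealrBE subr0; exact/asboolP.
Qed.

Section Subadditivity.
Variables (R : comNzRingType) (V : lmodType R).

Lemma length_leD (B M Z : set V) a b :
  submodule B -> submodule M -> B `<=` M -> M `<=` Z -> submodule Z ->
  length_le B M a -> length_le M Z b -> length_le B Z (a + b).
Proof.
move=> sB sM BM MZ sZ ha hb l ch.
have := @has_chain_split R R R V V V (fun N => N `&` M) (fun N => sum_set N M) B Z M Z
  _ _ _ _ l B _ ch.
case.
- by move=> N [sN BN NZ]; split; [exact: submoduleI|move=> x []].
- by move=> N [sN BN NZ]; split; [exact: submodule_add|exact: sum_set_min].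
- move=> N N' NN'; split; first by move=> x [/NN'].
  by move=> _ [x [y [Nx My ->]]]; exists x, y; split=> //; exact: NN'.
- move=> N N' [sN BN NZ] [sN' BN' NZ'] NN' ff gg x N'x.
  have [] := gg x; first by exists x, 0; rewrite addr0; split=> //; exact: submodule0.
  move=> y [z [Ny Mz xE]]; rewrite xE; apply: submoduleD => //.
  have [] // : (N `&` M) z; apply: ff; split=> //.
  rewrite -[z](addKr y) -xE addrC; apply: submoduleB => //; exact: NN'.
- by split=> //; exact: subset_trans MZ.
move=> m [n [-> cm cn]]; apply: leq_add.
  by apply: ha; apply: has_chainS cm => x Bx; split=> //; exact: BM.
by apply: hb; apply: has_chainS cn; exact: sum_setr.
Qed.

Lemma has_chain_cat (N Z N' Z' : set V) a b :
  N `<=` Z -> Z `<=` N' -> Z `<=` Z' -> has_chain Z a N -> has_chain Z' b N' ->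
  has_chain Z' (a + b) N.
Proof.
move=> NZ ZN' ZZ'; elim: a N NZ => [|a IH] N NZ /=.
  by move=> _; apply: has_chainS; exact: subset_trans ZN'.
case=> M [sM NM MZ nMN ch] ch'; exists M; split=> //; last exact: IH.
exact: subset_trans ZZ'.
Qed.

End Subadditivity.

Section PrincipalMultiples.
Variables (R : comNzRingType).
Implicit Type x : R.

Definition multiples x : set R^o := fun y => exists z, y = x * z.

Lemma submodule_multiples x : submodule (multiples x).
Proof.
split; first by exists 0; rewrite mulr0.
by move=> a _ _ [u ->] [v ->]; exists (a * u + v); rewrite mulrDr mulrCA.
Qed.

Lemma submodule_colon (N : set R^o) x : submodule N -> submodule (fun y : R^o => N (x * y)).
Proof.
move=> sN; split=> [|a u v Nu Nv]; first by rewrite mulr0; exact: (submodule0 sN).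
by rewrite mulrDr mulrCA; exact: (proj2 sN).
Qed.

(* The quotient of x^i R + I by x^(i+1) R + I is a quotient of R / (x R + I). *)
Lemma length_le_power (I : set R^o) x q n :
  submodule I -> I (x ^+ q) -> length_le (sum_set (multiples x) I) setT n ->
  length_le I setT (q * n).
Proof.
move=> sI Ixq hn.
have sS y : submodule (sum_set (multiples y) I).
  by apply: submodule_add => //; exact: submodule_multiples.
have -> : I = sum_set (multiples (x ^+ q)) I.
  apply/seteqP; split; first by apply: sum_setr; exact: submodule_multiples.
  apply: sum_set_min => // _ [z ->]; rewrite mulrC; exact: (submoduleZ _ sI).
elim: q {Ixq} => [|q IH].
  move=> [|l] //= [N [sN _ _ nN _]]; case: nN => y _; exists y, 0; rewrite addr0.
  by split=> //; [exists y; rewrite mul1r|exact: (submodule0 sI)].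
have incl : sum_set (multiples (x ^+ q.+1)) I `<=` sum_set (multiples (x ^+ q)) I.
  apply: sum_set_min; first exact: sS.
    move=> _ [z ->]; apply: (sum_setl sI); exists (x * z); rewrite mulrA -exprSr//.
  by apply: sum_setr; exact: submodule_multiples.
rewrite mulSn; apply: (length_leD _ _ incl) => //.
move=> l ch; apply: hn.
pose f (N : set R^o) : set R^o := fun y => N (x ^+ q * y).
suff : has_chain setT l (f (sum_set (multiples (x ^+ q.+1)) I)).
  apply: has_chainS; apply: sum_set_min; first exact: submodule_colon.
    by move=> _ [z ->]; apply: (sum_setl sI); exists z; rewrite mulrA -exprSr.
  by move=> y Iy; apply: sum_setr; [exact: submodule_multiples|exact: (submoduleZ _ sI)].
apply: (@has_chain_map R R _ _ f (sum_set (multiples (x ^+ q.+1)) I)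
  (sum_set (multiples (x ^+ q)) I)) ch => //.
- by move=> N [sN _ _]; split=> //; exact: submodule_colon.
- by move=> N N' NN' y; exact: NN'.
- move=> N N' [sN BN NZ] [sN' BN' NZ'] NN' ff z N'z.
  have [_ [mu [[y ->] Imu zE]]] := NZ' _ N'z.
  have Nmu : N mu by apply: BN; apply: sum_setr => //; exact: submodule_multiples.
  rewrite zE; apply: (submoduleD sN) => //; apply: ff.
  by rewrite /f -[_ * y](addrK mu) -zE; apply: (submoduleB sN') => //; exact: NN'.
by split.
Qed.

End PrincipalMultiples.

Lemma length_le_surj (R A : comNzRingType) (pi : {rmorphism R -> A}) (I : set A^o) n :
  (forall a, exists x, pi x = a) -> submodule I ->
  length_le I setT n -> length_le ((fun x => I (pi x)) : set R^o) setT n.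
Proof.
move=> surj sI hn l ch; apply: hn.
pose f (N : set R^o) : set A^o := fun a => exists x, N x /\ pi x = a.
suff : has_chain setT l (f (fun x => I (pi x))).
  by apply: has_chainS => a Ia; have [x xa] := surj a; exists x; rewrite xa.
apply: (@has_chain_map R A R^o A^o f (fun x => I (pi x)) setT) ch => //.
- move=> N [sN _ _]; split=> //; split.
    by exists 0; rewrite rmorph0; split=> //; exact: (submodule0 sN).
  move=> a _ _ [x [Nx <-]] [y [Ny <-]]; have [b <-] := surj a.
  by exists (b * x + y); rewrite rmorphD rmorphM; split=> //; exact: (proj2 sN).
- by move=> N N' NN' _ [x [Nx <-]]; exists x; split=> //; exact: NN'.
- move=> N N' [sN BN _] _ _ H x Nx; have [|y [Ny e]] := H (pi x); first by exists x.
  rewrite -[x](subrK y); apply: (submoduleD sN) => //; apply: BN.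
  by rewrite rmorphB e subrr; exact: (submodule0 sI).
split=> //; split; first by rewrite rmorph0; exact: (submodule0 sI).
by move=> a x y Ix Iy; rewrite rmorphD rmorphM; exact: (proj2 sI).
Qed.

Section LowerBound.
Variables (R : comNzRingType) (m : set R^o).
Hypotheses (nR : noeth R) (sm : submodule m) (m1 : ~ m 1).

Definition pset (P : {pred R}) : set R^o := fun x => x \in P.

Lemma submodule_prime P : prime_ideal P -> submodule (pset P).
Proof. by case=> -[P0 _ PD] _; split=> // a x y; exact: PD. Qed.

(** Division by [x] modulo [P] loses only a bounded number of powers of [m]: Artin-Rees for
    [P + x R] writes the part of [x * y] in [m^n] as [p' + x * mu'] with [mu'] in [m^(n-c)], and
    primality cancels [x]. *)
Lemma prime_colon P x : prime_ideal P -> x \notin P ->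
  exists c, forall n y, sum_set (pset P) (ideal_pow m n) (x * y) ->
    sum_set (pset P) (ideal_pow m (n - c)) y.
Proof.
move=> pP xP; have sP := submodule_prime pP.
have [c Hc] := artin_rees nR sm (submodule_add sP (submodule_multiples x)).
exists c => n y [p [mu [Pp Hmu xyE]]].
have muE : mu = (- p) + x * y by rewrite xyE addKr.
have : ideal_mul (ideal_pow m (n - c)) (sum_set (pset P) (multiples x)) mu.
  apply: Hc => //; exists (- p), (x * y); split=> //; first exact: (submoduleN sP).
  by exists y.
have sK : submodule (fun z : R^o => exists p' mu', [/\ pset P p', ideal_pow m (n - c) mu'
    & z = p' + x * mu']).
  split; first by exists 0, 0; rewrite mulr0 addr0; split=> //; [exact: (submodule0 sP)|
    exact: (submodule0 (submodule_ideal_pow _ _))].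
  move=> a _ _ [p1 [mu1 [Pp1 Hmu1 ->]]] [p2 [mu2 [Pp2 Hmu2 ->]]].
  exists (a * p1 + p2), (a * mu1 + mu2); split; [exact: (proj2 sP)|
    exact: (proj2 (submodule_ideal_pow _ _))|].
  by rewrite -[a *: _]/(a * _); ring.
case/(ideal_mul_min sK).
  move=> u _ Hu [p1 [_ [Pp1 [z ->] ->]]]; exists (u * p1), (u * z); split.
  - exact: (submoduleZ _ sP).
  - by rewrite mulrC; exact: (submoduleZ _ (submodule_ideal_pow _ _)).
  - by rewrite mulrDr mulrCA.
move=> p' [mu' [Pp' Hmu' muE']]; exists (y - mu'), mu'; split=> //; last by rewrite subrK.
have : x * (y - mu') \in P.
  have -> : x * (y - mu') = p + p'.
    by rewrite mulrBr xyE muE' addrA addrK.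
  exact: (submoduleD sP).
by move=> /(proj2 pP); rewrite (negbTE xP).
Qed.

(** With [T i n = P_i + m^n], induction on [j] and [t] bounds the length of [R / T (d-j) (g (t+1))]
    below by ['C(t, j)]. Multiplication by an element of the next prime outside [P_i] provides
    Pascal's rule. *)
Lemma length_lower_bound d (c : nat -> {pred R}) :
  strict_chain (@prime_ideal R) d c -> (forall i x, (i <= d)%N -> x \in c i -> m x) ->
  exists g, (0 < g)%N /\ forall t, has_chain setT 'C(t, d) (ideal_pow m (g * t.+1)).
Proof.
move=> [pc sc] cm.
have /choice[b Hb] i : exists b : nat * R, (i < d)%N -> [/\ b.2 \in c i.+1, b.2 \notin c i &
    forall n y, sum_set (pset (c i)) (ideal_pow m n) (b.2 * y) ->
      sum_set (pset (c i)) (ideal_pow m (n - b.1)) y].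
  have [id|] := boolP (i < d)%N; last by exists (0%N, 0).
  have [_ /existsNP[x /not_implyP[xi1 /negP xi]]] := sc i id.
  by have [k Hk] := prime_colon (pc i (ltnW id)) xi; exists (k, x).
(* A step of length [g] in the exponent absorbs the loss of [prime_colon] for every prime of the
   chain; the successor makes [g] positive. *)
pose g := (\max_(i < d) (b i).1).+1; exists g; split=> // t.
pose T i n := sum_set (pset (c i)) (ideal_pow m n).
have sT i n : (i <= d)%N -> submodule (T i n).
  by move=> id; apply: submodule_add; [exact/submodule_prime/pc|exact: submodule_ideal_pow].
suff main j : (j <= d)%N -> forall t, has_chain setT 'C(t, j) (T (d - j)%N (g * t.+1)%N).
  by have := main d (leqnn d) t; rewrite subnn; apply: has_chainS; apply: sum_setr;
    exact/submodule_prime/pc.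
elim: j {t} => [_ t|j IHj jd t].
  rewrite bin0 subn0; exists setT; split=> // H; apply: m1.
  have : T d (g * t.+1)%N 1 by exact: H.
  move=> [y [z [Py Hz ->]]]; apply: (submoduleD sm); first exact: (cm d).
  apply: (ideal_pow1 sm); apply: ideal_pow_leq Hz; by rewrite muln_gt0.
elim: t => [//|t IHt].
set i := (d - j.+1)%N in IHt *.
have id : (i < d)%N by rewrite /i; lia.
have [xi1 xi Hcol] := Hb i id; set x := (b i).2 in xi1 xi Hcol.
have bg : ((b i).1 <= g)%N by rewrite /g ltnW// ltnS; apply: (leq_bigmax (Ordinal id)).
have sP := submodule_prime (pc i (ltnW id)).
have sIm k : submodule (ideal_pow m k) by exact: submodule_ideal_pow.
rewrite binS.
(* The chain is cut at [Z]: below it multiplication by [x] transports the chain for [t], above it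
   lies the chain for the larger prime. *)
pose Z := sum_set (T i (g * t.+2)%N) (multiples x).
have Ti1 : Z `<=` T i.+1 (g * t.+2)%N.
  have sc1 : pset (c i) `<=` pset (c i.+1) by move=> y; exact: (proj1 (sc i id)).
  apply: sum_set_min; first exact: sT.
    apply: sum_set_min; first exact: sT.
      by apply: subset_trans sc1 _; apply: sum_setl.
    by apply: sum_setr; exact/submodule_prime/pc.
  move=> _ [y ->]; apply: sum_setl => //; rewrite mulrC.
  by apply: (submoduleZ _ (submodule_prime (pc _ id))).
apply: (has_chain_cat (Z := Z) (N' := T i.+1 (g * t.+2)%N)) => //.
- by apply: sum_setl; exact: submodule_multiples.
- pose f (N : set R^o) := sum_set (T i (g * t.+2)%N) ((fun y => x * y) @` N).
  have sx (N : set R^o) : submodule N -> submodule ((fun y => x * y) @` N : set R^o).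
    move=> sN; split; first by exists 0; [exact: (submodule0 sN)|rewrite mulr0].
    move=> a _ _ [u Nu <-] [v Nv <-]; exists (a * u + v); first exact: (proj2 sN).
    by rewrite mulrDr mulrCA.
  suff : has_chain Z 'C(t, j.+1) (f (T i (g * t.+1)%N)).
    by apply: has_chainS; apply: sum_setl; apply: sx; apply: sT; exact: ltnW.
  apply: (@has_chain_map R R _ _ f (T i (g * t.+1)%N) setT) IHt => //.
  + move=> N [sN BN _]; split; first by apply: submodule_add; [apply: sT; exact: ltnW|exact: sx].
    apply: sum_set_min.
    * by apply: submodule_add; [apply: sT; exact: ltnW|exact: submodule_multiples].
    * by apply: sum_setl; exact: submodule_multiples.
    * by move=> _ [y _ <-]; apply: sum_setr; [apply: sT; exact: ltnW|exists y].
  + move=> N N' NN' _ [u [_ [Tu [y Ny <-] ->]]]; exists u, (x * y); split=> //.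
    by exists y => //; exact: NN'.
  + move=> N N' [sN BN _] [sN' BN' _] NN' ff y N'y.
    have [] := ff (x * y).
      by exists 0, (x * y); rewrite add0r; split=> //;
        [apply: (submodule0 (sT _ _ _)); exact: ltnW | exists y].
    move=> u [_ [Tu [z Nz <-] xyE]].
    have : T i (g * t.+2 - (b i).1)%N (y - z).
      by apply: Hcol; rewrite mulrBr xyE addrK.
    move=> Tyz; rewrite -[y](subrK z); apply: (submoduleD sN) => //; apply: BN.
    move: Tyz => [p [mu [Pp Hmu ->]]]; exists p, mu; split=> //.
    by apply: ideal_pow_leq Hmu; rewrite mulnS; lia.
  + by split=> //; apply: sT; exact: ltnW.
- have -> : i.+1 = (d - j)%N by rewrite /i; lia.
  by apply: (has_chain_leq _ (IHj _ t.+1)); [exact: leq_bin2l|lia].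
Qed.

End LowerBound.

Lemma ffact_lower t d : ((t - d) ^ d <= t ^_ d)%N.
Proof.
elim: d => [|d IH]; first by rewrite ffactn0.
rewrite ffactnSr expnSr; apply: leq_mul; last by apply: leq_sub2l.
apply: leq_trans IH; case: (posnP d) => [->//|d0].
by rewrite leq_exp2r ?leq_sub2l.
Qed.

(** Bernoulli's inequality for [(1 + 1/c)^f], cleared of denominators. *)
Lemma expn_ratio_unbounded c f : ((c + f) * c ^ f <= c * c.+1 ^ f)%N.
Proof.
elim: f => [|f IH]; first by rewrite addn0.
rewrite (expnS c.+1) mulnCA; apply: leq_trans (leq_mul (leqnn c.+1) IH).
by rewrite expnS !mulnA leq_mul2r; apply/orP; right; nia.
Qed.

(** Along [t + 1 = 2^(f+1)] the binomial grows like [(2^d)^f], the bound like [b^f]. If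
    [b <= c = 2^d - 1], the ratio [((c+1)/c)^f] would stay below the constant [K]. *)
Lemma binomial_growth d b h g : (0 < g)%N ->
  (forall e t, (g * t.+1 <= 2 ^ e)%N -> ('C(t, d) <= h * b ^ e)%N) -> (2 ^ d <= b)%N.
Proof.
move=> g0 H; rewrite leqNgt; apply/negP => bd.
pose c := (2 ^ d).-1; have cE : c.+1 = (2 ^ d)%N by rewrite prednK// expn_gt0.
have bc : (b <= c)%N by rewrite -ltnS cE.
pose K := (2 ^ d * d`! * h * b ^ g)%N.
have key f : (d < f)%N -> (c.+1 ^ f <= K * c ^ f)%N.
  case: f => // f df.
  have f2 : (2 * d.+1 <= 2 ^ f.+1)%N.
    rewrite expnS leq_mul2l /=; apply: (leq_trans (ltn_expl d (ltnSn 1))).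
    by rewrite leq_exp2l.
  (* From [g <= 2^g]: the exponent [e = g + f + 1] is large enough for this [t]. *)
  have Hg : (g * (2 ^ f.+1).-1.+1 <= 2 ^ (g + f.+1))%N.
    rewrite prednK ?expn_gt0// expnD leq_mul2r; apply/orP; right.
    exact/ltnW/ltn_expl.
  have := H _ _ Hg; rewrite -(leq_pmul2r (fact_gt0 d)) bin_ffact => /(leq_trans (ffact_lower _ _)) Hle.
  have l1 : ((2 ^ f) ^ d <= ((2 ^ f.+1).-1 - d) ^ d)%N.
    case: (posnP d) => [->//|d0]; rewrite leq_exp2r//.
    by move: f2; rewrite expnS; lia.
  rewrite cE -expnM (mulnC d) expnM expnS expnMn.
  apply: leq_trans (leq_mul (leqnn _) (leq_trans l1 Hle)) _.
  rewrite /K expnD.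
  have -> : (2 ^ d * (h * (b ^ g * b ^ f.+1) * d`!) = 2 ^ d * d`! * h * b ^ g * b ^ f.+1)%N by lia.
  by apply: leq_mul => //; rewrite leq_exp2r.
have [c0|c0] := posnP c.
  by have := key d.+1 (ltnSn _); rewrite c0 exp1n exp0n// muln0.
(* For this exponent [f] the two estimates give [c + f <= c * K], which is false. *)
have := expn_ratio_unbounded c (c * K + d.+1).
have := key (c * K + d.+1)%N; rewrite -ltnS ltnS => /(_ ltac:(lia)) Hk.
move=> /leq_trans/(_ (leq_mul (leqnn c) Hk)).
by rewrite mulnA leq_pmul2r ?expn_gt0 ?c0//; lia.
Qed.

(** * Local rings *)

Definition invertible (R : comNzRingType) (x : R) : Prop := exists y, x * y = 1.

(** By Zorn's lemma a non-unit lies in a maximal ideal, and [m] is the only one. *)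
Lemma local_invertible (R : comNzRingType) (m : {pred R}) x :
  noetherian_local m -> x \notin m -> invertible x.
Proof.
move=> [_ _ uniq] xm; apply: contrapT => nx; move/negP: xm; apply.
pose P (A : set R^o) := A = set0 \/ [/\ submodule A, A x & ~ A 1].
have [|A [PA maxA]] := @Zorn_bigcup R P.
  move=> F FP tot; have [ne|/forallNP ne] := pselect (exists A, F A /\ A !=set0); last first.
    left; apply/seteqP; split=> // y [A FA Ay]; apply: (ne A); split=> //; by exists y.
  right; have [A0 [FA0 [y0 A0y]]] := ne.
  have good A y : F A -> A y -> [/\ submodule (A : set R^o), A x & ~ A 1].
    by move=> /FP[->|].
  have [sA0 A0x A01] := good _ _ FA0 A0y; split.
  - split; first by exists A0 => //; exact: (submodule0 sA0).
    move=> a y z [A FA Ay] [A' FA' A'z].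
    have [sA _ _] := good _ _ FA Ay; have [sA' _ _] := good _ _ FA' A'z.
    case: (tot _ _ FA FA') => AA.
      by exists A' => //; apply: (proj2 sA') => //; exact: AA.
    by exists A => //; apply: (proj2 sA) => //; exact: AA.
  - by exists A0.
  - by move=> [A FA A1]; have [] := good _ _ FA A1.
have sx := submodule_multiples x.
have mx1 : P (multiples x).
  right; split=> //; first by exists 1; rewrite mulr1.
  by move=> [y yE]; apply: nx; exists y.
case: PA => [A0|[sA Ax A1]].
  case: (maxA (multiples x)) => //; rewrite A0; split=> //.
  by move/(_ x); apply; exists 1; rewrite mulr1.
pose M : {pred R} := fun y => `[< A y >].
have ME y : (y \in M) <-> A y by rewrite unfold_in; split=> /asboolP.
have MM : maximal_ideal M.
  split.
    split; [exact/ME/(submodule0 sA)|by apply/negP => /ME|].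
    by move=> a u v /ME Au /ME Av; apply/ME; apply: (proj2 sA).
  move=> J [J0 J1 JD] MJ.
  pose B : set R^o := fun y => y \in J.
  have AB : A `<=` B by move=> y /ME /MJ.
  have [BA|nBA] := pselect (B `<=` A).
    by move=> y; apply/idP/idP => [yJ|/MJ//]; apply/ME; exact: BA.
  case: (maxA B) => //.
  right; split; [by split=> // a u v; exact: JD|exact: AB|by apply/negP].
by rewrite -(uniq M MM); apply/ME.
Qed.

Section NullHomotopy.
Variables (R : comNzRingType) (n : nat) (D : 'M[R]_n) (w : 'I_n -> nat) (a : R).
Hypotheses (D2 : D *m D = 0) (lD : lowering w D).

Lemma mulmx_rows_eq p q (r : 'rV[R]_p) (X Y : 'M[R]_(p, q)) (P : pred 'I_p) :
  (forall i, r 0 i != 0 -> P i) -> (forall i, P i -> row i X = row i Y) -> r *m X = r *m Y.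
Proof.
move=> rP XY; rewrite !mulmx_sum_row; apply: eq_bigr => i _.
by have [->|/rP/XY->//] := eqVneq (r 0 i) 0; rewrite !scale0r.
Qed.

Lemma row_scalar_mx p (c : R) (i : 'I_p) : row i c%:M = c *: delta_mx 0 i.
Proof. by rewrite -scalemx1 linearZ /= row1. Qed.

(** A null-homotopy of a power of [a], unlike the mere annihilation of homology, is preserved by
    every base change. It is built degree by degree, each degree costing a further factor
    [a ^+ N]. *)
Lemma null_homotopy N :
  (forall z : 'rV[R]_n, z *m D = 0 -> exists y, a ^+ N *: z = y *m D) ->
  exists K (s : 'M[R]_n), s *m D + D *m s = (a ^+ K)%:M.
Proof.
move=> HN.
suff main c : exists K (s : 'M[R]_n), forall i, (w i < c)%N ->
    row i (s *m D + D *m s) = a ^+ K *: delta_mx 0 i.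
  have [K [s Hs]] := main (\max_i w i).+1; exists K, s; apply/row_matrixP => i.
  by rewrite Hs ?row_scalar_mx// ltnS; exact: leq_bigmax.
elim: c => [|c [K [s Hs]]]; first by exists 0%N, 0 => i; rewrite ltn0.
(* In degree [c] this is a cycle: [row i D] is supported below degree [c], where [s] is already a
   homotopy. *)
pose z i : 'rV[R]_n := a ^+ K *: delta_mx 0 i - row i D *m s.
have zD i : w i = c -> z i *m D = 0.
  move=> wi; rewrite mulmxBl -scalemxAl -rowE -mulmxA.
  have -> : row i D *m (s *m D) = row i D *m ((a ^+ K)%:M - D *m s).
    apply: (@mulmx_rows_eq _ _ _ _ _ (fun j => w j < c)%N) => j.
      by rewrite mxE => /lD; rewrite wi.
    by move=> /Hs; rewrite linearD linearB /= row_scalar_mx => /(canRL (addrK _)).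
  by rewrite mulmxBr mulmxA -(row_mul i D D) D2 row0 mul0mx subr0 mul_mx_scalar subrr.
have /choice[y Hy] i : exists y, w i = c -> a ^+ N *: z i = y *m D.
  have [/zD/HN[y yE]|] := pselect (w i = c); last by exists 0.
  by exists y.
exists (K + N)%N, (\matrix_i (if w i == c then y i else a ^+ N *: row i s)) => i.
rewrite ltnS => wi; rewrite linearD /= !row_mul rowK.
have -> : row i D *m (\matrix_i0 (if w i0 == c then y i0 else a ^+ N *: row i0 s)) =
    row i D *m (a ^+ N *: s).
  apply: (@mulmx_rows_eq _ _ _ _ _ (fun j => w j < c)%N) => j.
    by rewrite mxE => /lD/leq_trans; apply.
  by rewrite rowK linearZ /=; case: ltngtP.
rewrite -scalemxAr addnC exprD -scalerA; case: eqP => [wc|/eqP wc].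
  by rewrite -Hy// -scalerDr subrK.
have {}wi : (w i < c)%N by rewrite ltn_neqAle wc.
by rewrite -scalemxAl -scalerDr -!row_mul -linearD /= Hs.
Qed.

End NullHomotopy.

Lemma noeth_surj (R A : comNzRingType) (pi : {rmorphism R -> A}) :
  (forall a, exists x, pi x = a) -> noeth R -> noeth A.
Proof.
move=> surj nR I sI.
have [|J [u [Iu Hu]]] := nR (fun x => I (pi x)).
  split; first by rewrite rmorph0; exact: (submodule0 sI).
  by move=> a x y Ix Iy; rewrite rmorphD rmorphM; exact: (proj2 sI).
exists J, (pi \o u); split=> // a Ia; have [x xE] := surj a.
have [|b bE] := Hu x; first by rewrite xE.
exists (pi \o b); rewrite -xE bE rmorph_sum; apply: eq_bigr => j _.
by rewrite rmorphM.
Qed.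

Section FiniteLength.
Variables (R : comNzRingType) (V : lmodType R).
Implicit Type B Z : set V.

Definition line (v : V) : set V := fun x => exists a, x = a *: v.

Lemma submodule_line v : submodule (line v).
Proof.
split; first by exists 0; rewrite scale0r.
by move=> c _ _ [a ->] [b ->]; exists (c * a + b); rewrite scalerDl scalerA.
Qed.

(** A submodule strictly above [B] contains, modulo [B], some [x *: v] outside [B]; then [x] is
    invertible and the whole line is reached. *)
Lemma length_le_line B v : submodule B -> (forall x, invertible x \/ B (x *: v)) ->
  length_le B (sum_set B (line v)) 1.
Proof.
move=> sB Hv [|[|l]] //= [N1 [sN1 BN1 N1Z nN1 [N2 [sN2 N12 N2Z nN2 _]]]].
exfalso; apply: nN1 => y N1y; have [b [_ [Bb [x ->] yE]]] := N1Z _ N1y.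
rewrite yE; apply: submoduleD => //; case: (Hv x) => // -[x' xx'].
exfalso; apply: nN2; apply: subset_trans N2Z _; apply: sum_set_min => // _ [c ->].
apply: submoduleZ => //; rewrite -[v]scale1r -xx' mulrC -scalerA; apply: submoduleZ => //.
by rewrite -[x *: v](addKr b) -yE addrC; apply: submoduleB => //; exact: BN1.
Qed.

Fixpoint span_over B (s : seq V) : set V :=
  if s is v :: s' then sum_set (span_over B s') (line v) else B.

Lemma submodule_span_over B s : submodule B -> submodule (span_over B s).
Proof.
by move=> sB; elim: s => //= v s IH; apply: submodule_add => //; exact: submodule_line.
Qed.

Lemma span_over_sub B s : submodule B -> B `<=` span_over B s.
Proof.
move=> sB; elim: s => //= v s IH; apply: subset_trans IH _.
by apply: sum_setl; exact: submodule_line.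
Qed.

Lemma length_le_span B s : submodule B ->
  (forall v x, v \in s -> invertible x \/ B (x *: v)) -> length_le B (span_over B s) (size s).
Proof.
move=> sB; elim: s => [|v s IH] Hs.
  by case=> [|l] //= [N [_ _ NB nNB _]].
have sS := submodule_span_over s sB.
rewrite /= -addn1; apply: (length_leD (M := span_over B s)) => //.
- exact: span_over_sub.
- by apply: sum_setl; exact: submodule_line.
- by apply: submodule_add => //; exact: submodule_line.
- by apply: IH => u x us; apply: Hs; rewrite inE us orbT.
- apply: length_le_line => // x; case: (Hs v x (mem_head _ _)); first by left.
  by right; exact: span_over_sub.
Qed.

Lemma length_le_fin_gen B Z : submodule B -> fin_gen Z -> (forall x z, Z z -> invertible x \/ B (x *: z)) ->
  exists h, length_le B Z h.
Proof.
move=> sB [I [u [Zu Hu]]] HZ; exists (size [seq u i | i <- enum I]).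
apply: length_leS (length_le_span sB _) => //; last first.
  by move=> _ x /mapP[i _ ->]; exact: HZ.
have sS := submodule_span_over [seq u i | i <- enum I] sB.
move=> z /Hu[a ->]; apply: submodule_sum => // i _; apply: submoduleZ => //.
have : i \in enum I by rewrite mem_enum.
elim: (enum I) => //= j e IH; rewrite inE => /orP[/eqP->|/IH].
  apply: sum_setr; first exact: submodule_span_over.
  by exists 1; rewrite scale1r.
by apply: sum_setl; exact: submodule_line.
Qed.

End FiniteLength.

Fixpoint in_span (R : comNzRingType) (s : seq R) (x : R) : Prop :=
  if s is a :: s' then exists c y, in_span s' y /\ x = c * a + y else x = 0.

(* The powers of one generator at a time are used to filter Z over B. *)
Lemma length_le_nilpotent (A : comNzRingType) n (L M : seq A) (B Z : set 'rV[A]_n) :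
  noeth A -> submodule B -> submodule Z -> B `<=` Z ->
  (forall x, invertible x \/ exists y z, [/\ in_span L y, in_span M z & x = y + z]) ->
  (forall a z, a \in M -> Z z -> B (a *: z)) ->
  (forall a, a \in L -> exists K, forall z, Z z -> B (a ^+ K *: z)) ->
  exists h, length_le B Z h.
Proof.
move=> nA; elim: L M B Z => [|a L IH] M B Z sB sZ BZ gen HM HL.
  apply: length_le_fin_gen => //; first exact: noeth_row.
  move=> x v Zv; case: (gen x) => [|[_ [z [-> Mz ->]]]]; first by left.
  right; rewrite add0r; elim: M HM {gen} z Mz => [|b M IHM] HM z; first by move=> ->; rewrite scale0r; exact: submodule0.
  move=> [c [y [My ->]]]; rewrite scalerDl -scalerA; apply: (proj2 sB).
    by apply: HM => //; exact: mem_head.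
  by apply: IHM My => b' u bM; apply: HM; rewrite inE bM orbT.
have [K HK] := HL a (mem_head _ _).
(* On the layers of the filtration by [B + a^i Z] the generator [a] acts as zero, so it moves from
   [L], generators with some power killing [Z/B], to [M], those killing [Z/B] themselves. *)
pose T i := sum_set B (fun z => exists2 y, Z y & z = a ^+ i *: y).
have sp i : submodule (fun z => exists2 y, Z y & z = a ^+ i *: y).
  split; first by exists 0; [exact: submodule0|rewrite scaler0].
  move=> c _ _ [y Zy ->] [y' Zy' ->]; exists (c *: y + y'); first exact: (proj2 sZ).
  by rewrite scalerDr !scalerA mulrC.
have sT i : submodule (T i) by exact: submodule_add.
have TZ i : T i `<=` Z.
  by apply: sum_set_min => // _ [y Zy ->]; exact: submoduleZ.
have TS i : T i.+1 `<=` T i.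
  apply: sum_set_min => //; first exact: sum_setl.
  move=> _ [y Zy ->]; apply: sum_setr => //; exists (a *: y); first exact: submoduleZ.
  by rewrite scalerA -exprSr.
have BT i : B `<=` T i by exact: sum_setl.
have step i : exists h, length_le (T i.+1) (T i) h.
  apply: (IH (a :: M)) => //.
  - move=> x; case: (gen x) => [|[_ [z [[c [y [Ly ->]]] Mz ->]]]]; first by left.
    right; exists y, (c * a + z); split=> //; first by exists c, z.
    by rewrite addrCA addrA.
  - move=> b z; rewrite inE => /orP[/eqP->|bM] Tz; last by apply: BT; apply: HM => //; exact: (TZ _ _ Tz).
    have [b' [_ [Bb' [y Zy ->] ->]]] := Tz; rewrite scalerDr; apply: submoduleD => //.
      by apply: BT; exact: submoduleZ.
    by apply: sum_setr => //; exists y; rewrite // scalerA -exprS.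
  - move=> b bL; have [K' HK'] : exists K, forall z, Z z -> B (b ^+ K *: z).
      by apply: HL; rewrite inE bL orbT.
    by exists K' => z Tz; apply: BT; apply: HK'; exact: (TZ _ _ Tz).
suff main i : exists h, length_le (T i) Z h.
  have [h Hh] := main K; exists h; apply: length_leS Hh => //.
  by apply: sum_set_min => // _ [y Zy ->]; exact: HK.
elim: i => [|i [h Hh]].
  exists 0%N => -[|l] //= [N [_ _ NZ nN _]]; exfalso; apply: nN => z /NZ Zz.
  by apply: sum_setr => //; exists z; rewrite ?scale1r.
have [h' Hh'] := step i; exists (h' + h)%N.
by apply: (length_leD (M := T i)).
Qed.

Lemma in_span_fin_gen (R : comNzRingType) (I : finType) (u a : I -> R) :
  in_span [seq u i | i <- enum I] (\sum_j a j * u j).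
Proof.
rewrite -big_enum /=; elim: (enum I) => [|i s IH] /=; first by rewrite big_nil.
by rewrite big_cons; exists (a i); eexists; split; [exact: IH|].
Qed.

Lemma in_span_map (R A : comNzRingType) (pi : {rmorphism R -> A}) s x :
  in_span s x -> in_span [seq pi a | a <- s] (pi x).
Proof.
elim: s x => [x ->|a s IH x [c [y [sy ->]]]] /=; first exact: rmorph0.
by exists (pi c), (pi y); rewrite rmorphD rmorphM; split=> //; exact: IH.
Qed.

(** Powers of the generators of [m] are null-homotopic, so over [A] their images act nilpotently on
    homology; being finitely generated over a local ring, the homology has finite length. *)
Lemma hlen_base_change (R A : comNzRingType) (pi : {rmorphism R -> A}) (m : {pred R}) n
    (D : 'M[R]_n) w :
  noetherian_local m -> (forall a, exists x, pi x = a) ->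
  D *m D = 0 -> lowering w D ->
  (forall a, a \in m -> exists N, forall z : 'rV[R]_n, z *m D = 0 ->
     exists y, a ^+ N *: z = y *m D) ->
  exists h, hlen setT (mulmxr (map_mx pi D) : 'rV[A]_n -> _) h.
Proof.
move=> locR surj D2 lD HN; have [nR [[m0 m1 mD] _] _] := locR.
have sm : submodule (pset m) by split=> // a x y; exact: mD.
have [I [u [mu Hu]]] := noetherian_noeth nR sm.
have DD2 : map_mx pi D *m map_mx pi D = 0 by rewrite -map_mxM D2 map_mx0.
apply: (@length_le_nilpotent A n [seq pi a | a <- [seq u i | i <- enum I]] [::]).
- exact: noeth_surj surj (noetherian_noeth nR).
- exact: (submodule_im (mulmxr (map_mx pi D)) (@submoduleT _ _)).
- split; first by split=> //=; rewrite mul0mx.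
  by move=> a x y [_ /= x0] [_ /= y0]; split=> //=; rewrite mulmxDl -scalemxAl x0 y0 scaler0 addr0.
- by move=> _ [y _ <-]; split=> //=; rewrite -mulmxA DD2 mulmx0.
- move=> a; have [x <-] := surj a; have [xm|xm] := boolP (x \in m).
    have [b ->] := Hu x xm; right; exists (pi (\sum_j b j *: u j)), 0; rewrite addr0.
    by split=> //; apply: in_span_map; exact: in_span_fin_gen.
  left; have [y xy] := local_invertible locR xm.
  by exists (pi y); rewrite -rmorphM xy rmorph1.
- by [].
- move=> _ /mapP[x /mapP[i _ ->] ->].
  have [N HNi] := HN (u i) (mu i).
  have [K [s Hs]] := null_homotopy D2 lD HNi; exists K => z [_ /= zD].
  exists (z *m map_mx pi s) => //=.
  move/(congr1 (map_mx pi)): Hs; rewrite map_mxD !map_mxM map_scalar_mx rmorphXn => Hs.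
  by rewrite -mul_mx_scalar -Hs mulmxDr !mulmxA zD mul0mx addr0.
Qed.

Theorem local_rank_bound (R : comNzRingType) (m : {pred R}) d c n (D : 'M[R]_n) w :
  noetherian_local m -> strict_chain (@prime_ideal R) d c -> (2%:R : R) \in m ->
  D *m D = 0 -> lowering w D -> (0 < n)%N -> (forall i j, D i j \in m) ->
  (forall a, a \in m -> exists N, forall z : 'rV[R]_n, z *m D = 0 ->
     exists y, a ^+ N *: z = y *m D) ->
  (2 ^ d <= 2 * n)%N.
Proof.
move=> locR pc m2 D2 lD n0 Dm HN; have [nR [[m0 m1 mD] _] _] := locR.
have sm : submodule (pset m) by split=> // a x y; exact: mD.
have mm1 : ~ pset m 1 by exact/negP.
have c_m i x : (i <= d)%N -> x \in c i -> x \in m.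
  move=> id xc; apply: contraT => /(local_invertible locR)[y xy].
  have [[_ /negP c1 _] _] := proj1 pc i id; case: c1.
  by rewrite -xy mulrC; exact: (submoduleZ y (submodule_prime (proj1 pc i id)) xc).
(* The primes of the chain lie in [m], since they contain no unit; this gives the lower estimate. *)
have [g [g0 Hg]] := length_lower_bound (noetherian_noeth nR) sm mm1 pc c_m.
have [|A [pi [surj kerpi]]] := quotient_ring (submodule_multiples (2%:R : R)).
  move=> [y y2]; apply: mm1; rewrite y2 mulrC; exact: (submoduleZ y sm m2).
have [h Hh] := hlen_base_change locR surj D2 lD HN.
have char2 (x : A) : x + x = 0.
  have [y <-] := surj x; rewrite -rmorphD; apply/kerpi; exists y.
  by rewrite mulr_natl mulr2n.
pose I k : set A^o := fun a => exists x, ideal_pow (pset m) k x /\ pi x = a.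
have sI : ring_filtration I.
  split=> [k|a b _ _ [x [Hx <-]] [y [Hy <-]]]; last first.
    by exists (x * y); rewrite rmorphM; split=> //; exact: ideal_powM.
  split; first by exists 0; rewrite rmorph0; split=> //; exact: (submodule0 (submodule_ideal_pow _ _)).
  move=> a _ _ [x [Hx <-]] [y [Hy <-]]; have [b <-] := surj a.
  exists (b * x + y); rewrite rmorphD rmorphM; split=> //.
  exact: (proj2 (submodule_ideal_pow _ _)).
have DD2 : map_mx pi D *m map_mx pi D = 0 by rewrite -map_mxM D2 map_mx0.
have lDD : lowering w (map_mx pi D).
  by move=> i j; rewrite mxE => nz; apply: lD; apply: contraNneq nz => ->; rewrite rmorph0.
have DI i j : I 1%N (map_mx pi D i j).
  exists (D i j); rewrite mxE; split=> //=; rewrite -[D i j]mulr1.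
  by apply: ideal_mul_in => //; exact: Dm.
apply: (@binomial_growth _ _ h g g0) => e t gt.
have H1 := length_growth (e := e) char2 sI DD2 lDD n0 DI Hh; rewrite mul1n in H1.
have H2 := length_le_surj surj (proj1 sI _) H1.
have H3 : length_le (sum_set (multiples (2%:R : R)) (ideal_pow (pset m) (2 ^ e))) setT (n ^ e * h).
  apply: length_leS H2 => // x [y [Hy e1]].
  exists (x - y), y; split=> //; last by rewrite subrK.
  by apply/kerpi; rewrite rmorphB e1 subrr.
(* The passage from [R/2] back to [R] takes [2^e] layers, which turns [n^e] into [(2 * n)^e]. *)
have Hpow k : ideal_pow (pset m) k ((2%:R : R) ^+ k).
  elim: k => [|k IH] //; rewrite exprS; exact: ideal_mul_in.
have H4 := length_le_power (submodule_ideal_pow _ _) (Hpow (2 ^ e)%N) H3.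
have : ('C(t, d) <= 2 ^ e * (n ^ e * h))%N.
  by apply: H4; apply: has_chainS (Hg t); exact: ideal_pow_leq.
by rewrite expnMn [(h * _)%N]mulnC mulnA.
Qed.

(** * Minimal models *)

Section Graded.
Variable R : comNzRingType.

Definition graded p q (v : 'I_p -> nat) (w : 'I_q -> nat) (c : nat) (X : 'M[R]_(p, q)) : Prop :=
  forall i j, X i j != 0 -> v i = (w j + c)%N.

Lemma gradedM p q r (u : 'I_p -> nat) (v : 'I_q -> nat) (w : 'I_r -> nat) c c' X Y :
  graded u v c X -> graded v w c' Y -> graded u w (c' + c) (X *m Y).
Proof.
move=> HX HY i j; rewrite mxE => nz.
have [|] := boolP [exists k, (X i k != 0) && (Y k j != 0)].
  by case/existsP => k /andP[/HX-> /HY->]; rewrite addnA.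
rewrite negb_exists => /forallP H; case/eqP: nz; rewrite big1// => k _.
by have := H k; rewrite negb_and !negbK => /orP[/eqP->|/eqP->]; rewrite ?mul0r ?mulr0.
Qed.

Lemma gradedB p q (v : 'I_p -> nat) (w : 'I_q -> nat) c X Y :
  graded v w c X -> graded v w c Y -> graded v w c (X - Y).
Proof.
move=> HX HY i j; rewrite !mxE => nz.
have [X0|/HX//] := eqVneq (X i j) 0; have [Y0|/HY//] := eqVneq (Y i j) 0.
by move: nz; rewrite X0 Y0 subrr eqxx.
Qed.

Lemma graded1 p (w : 'I_p -> nat) : graded w w 0 1%:M.
Proof. by move=> i j; rewrite mxE addn0; case: (i =P j) => [->|] //; rewrite eqxx. Qed.

Lemma graded_lowering p (w : 'I_p -> nat) X : graded w w 1 X -> lowering w X.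
Proof. by move=> H i j /H->; rewrite addn1. Qed.

Lemma mulmx_ext p q (X Y : 'M[R]_(p, q)) : (forall x : 'rV_p, x *m X = x *m Y) -> X = Y.
Proof. by move=> H; apply/row_matrixP => i; rewrite !rowE. Qed.

Section Selection.
Variables (n : nat) (S : {set 'I_n}).

Definition select_mx : 'M[R]_(#|S|, n) := \matrix_(a, b) (b == enum_val a)%:R.

Lemma select_mx0 (x : 'rV[R]_#|S|) k : k \notin S -> (x *m select_mx) 0 k = 0.
Proof.
move=> kS; rewrite mxE big1// => a _; rewrite mxE; case: eqP => [e|]; rewrite ?mulr0//.
by move: kS; rewrite e enum_valP.
Qed.

Lemma select_mxK : select_mx *m select_mx^T = 1%:M.
Proof.
apply/matrixP => a b; rewrite !mxE (bigD1 (enum_val a))//= big1 => [|k ka].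
  by rewrite !mxE eqxx mul1r addr0 (inj_eq enum_val_inj).
by rewrite mxE (negbTE ka) mul0r.
Qed.

Lemma select_mxTK (x : 'rV[R]_n) k :
  (x *m select_mx^T *m select_mx) 0 k = if k \in S then x 0 k else 0.
Proof.
case: (boolP (k \in S)) => [kS|]; last exact: select_mx0.
rewrite mxE (bigD1 (enum_rank_in kS k))//= big1 => [|a ak].
  rewrite !mxE enum_rankK_in// eqxx mulr1 addr0 (bigD1 k)//= big1 => [|l lk].
    by rewrite !mxE enum_rankK_in// eqxx mulr1 addr0.
  by rewrite !mxE enum_rankK_in// (negbTE lk) mulr0.
rewrite !mxE; case: (k =P _) => [e|]; rewrite ?mulr0//.
by case/eqP: ak; apply: enum_val_inj; rewrite enum_rankK_in.
Qed.

Lemma select_mx_supp (x : 'rV[R]_n) :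
  (forall k, x 0 k != 0 -> k \in S) -> x *m select_mx^T *m select_mx = x.
Proof.
move=> H; apply/rowP => k; rewrite select_mxTK; case: ifPn => // kS.
by apply/esym/eqP/contraT => /H; rewrite (negbTE kS).
Qed.

Lemma select_mx_graded (w : 'I_n -> nat) : graded (fun a => w (enum_val a)) w 0 select_mx.
Proof.
by move=> a b; rewrite mxE addn0; case: (b =P _) => [->|] //; rewrite eqxx.
Qed.

Lemma select_mx_tr_graded (w : 'I_n -> nat) : graded w (fun a => w (enum_val a)) 0 select_mx^T.
Proof.
by move=> a b; rewrite !mxE addn0; case: (a =P _) => [->|] //; rewrite eqxx.
Qed.

End Selection.

Section Elimination.
Variables (n : nat) (D : 'M[R]_n) (w : 'I_n -> nat) (i j : 'I_n) (u : R).
Hypotheses (D2 : D *m D = 0) (gD : graded w w 1 D) (Du : D i j * u = 1).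

Let wij : w i = (w j).+1.
Proof.
rewrite (gD (i := i) (j := j)) ?addn1//; apply: contra_eq_neq Du => ->.
by rewrite mul0r eq_sym oner_neq0.
Qed.

Let ij : (i == j) = false.
Proof. by apply/eqP => e; move: wij; rewrite e => /n_Sn. Qed.

(** Sends basis vector [j] to [u] times basis vector [i]: the inverse of the unit entry [D i j]. *)
Definition elim_htpy : 'M[R]_n := u *: delta_mx j i.
Definition elim_set := [set k : 'I_n | (k != i) && (k != j)]%SET.
Local Notation elim_in := (select_mx elim_set).
Definition elim_proj : 'M[R]_n := 1%:M - elim_htpy *m D - D *m elim_htpy.

Lemma mul_elim_htpy (x : 'rV[R]_n) : x *m elim_htpy = (x 0 j * u) *: delta_mx 0 i.
Proof.
apply/rowP => k; rewrite !mxE (bigD1 j)//= big1 => [|l lj].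
  by rewrite !mxE !eqxx addr0 mulrA.
by rewrite !mxE (negbTE lj) /= !mulr0.
Qed.

Lemma elim_inTK (x : 'rV[R]_n) :
  x *m elim_in^T *m elim_in = x - x 0 i *: delta_mx 0 i - x 0 j *: delta_mx 0 j.
Proof.
apply/rowP => k; rewrite select_mxTK !mxE eqxx /= !inE.
have [->|ki] := eqVneq k i; first by rewrite ij mulr1 mulr0 subr0 subrr.
by have [->|kj] := eqVneq k j; rewrite ?mulr1 ?mulr0 ?subr0 ?subrr.
Qed.

Let dlt : {linear 'rV[R]_n -> 'rV[R]_n} := mulmxr D.
Let hh : {linear 'rV[R]_n -> 'rV[R]_n} := mulmxr elim_htpy.
Let ii : {linear 'rV[R]_#|elim_set| -> 'rV[R]_n} := mulmxr elim_in.
Let pp : {linear 'rV[R]_n -> 'rV[R]_#|elim_set|} := mulmxr elim_in^T.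

Let projE x : retract_proj dlt hh x = x *m elim_proj.
Proof. by rewrite /retract_proj /elim_proj !mulmxBr mulmx1 /= !mulmxA. Qed.

Let dlt2 x : dlt (dlt x) = 0.
Proof. by rewrite /= -mulmxA D2 mulmx0. Qed.

Let rowD : (row i D) 0 j = D i j. Proof. by rewrite mxE. Qed.

Let h2 x : hh (hh x) = 0.
Proof. by rewrite /= !mul_elim_htpy !mxE [j == i]eq_sym ij andbF mulr0 mul0r scale0r. Qed.

Let hdh x : hh (dlt (hh x)) = hh x.
Proof.
rewrite /= [x *m _]mul_elim_htpy -scalemxAl -rowE mul_elim_htpy; congr (_ *: _).
by rewrite !mxE -mulrA Du mulr1.
Qed.

Let pi1 x : pp (ii x) = x.
Proof. by rewrite /= -mulmxA select_mxK mulmx1. Qed.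

Let hi0 x : hh (ii x) = 0.
Proof. by rewrite /= mul_elim_htpy select_mx0 ?mul0r ?scale0r// !inE eqxx andbF. Qed.

Let ph0 x : pp (hh x) = 0.
Proof.
rewrite /= mul_elim_htpy -scalemxAl -rowE; apply/rowP => a; rewrite !mxE.
case: eqP => [e|]; rewrite ?mulr0//.
by have := enum_valP a; rewrite -e !inE eqxx.
Qed.

Let qipq x : retract_proj dlt hh (ii (pp (retract_proj dlt hh x))) = retract_proj dlt hh x.
Proof.
set y := retract_proj dlt hh x.
(* The inclusion after the projection [pp] forgets coordinates [i] and [j] of [y]. The latter is
   zero because [hh y = 0] and [u] is a unit, the former is irrelevant because [retract_proj] kills
   basis vector [i]. *)
have hy : hh y = 0.
  by rewrite /y /retract_proj !linearB hdh h2 subr0 subrr.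
have yj : y 0 j = 0.
  move/rowP/(_ i): hy; rewrite /= mul_elim_htpy !mxE !eqxx mulr1 => yu.
  by rewrite -[LHS]mulr1 -Du mulrCA yu mulr0.
have qi : retract_proj dlt hh (delta_mx 0 i) = 0.
  rewrite /retract_proj /= mul_elim_htpy mxE [j == i]eq_sym ij andbF mul0r scale0r mul0mx subr0.
  by rewrite -rowE mul_elim_htpy rowD Du scale1r subrr.
rewrite -[ii _]/(y *m elim_in^T *m elim_in) elim_inTK yj scale0r subr0.
by rewrite linearB linearZ /= qi scaler0 subr0 retract_proj_idem.
Qed.

Let Phi := elim_in *m elim_proj.
Let Psi := elim_proj *m elim_in^T.
Let D' := Phi *m D *m elim_in^T.
Let inE' x : retract_in dlt hh ii x = x *m Phi.
Proof. by rewrite /retract_in /= projE mulmxA. Qed.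
Let outE' x : retract_out dlt hh pp x = x *m Psi.
Proof. by rewrite /retract_out /= projE mulmxA. Qed.
Let diffE' x : retract_diff dlt hh ii pp x = x *m D'.
Proof. by rewrite /retract_diff /= projE !mulmxA. Qed.

(** Gaussian elimination: a unit entry splits off a contractible piece of rank 2, and the
    differential is transferred to the remaining basis vectors. *)
Lemma elimination : exists n' (E : 'M[R]_n') (v : 'I_n' -> nat) (F : 'M[R]_(n', n))
    (G : 'M[R]_(n, n')) (H : 'M[R]_n),
  [/\ (n' < n)%N, E *m E = 0, graded v v 1 E, graded v w 0 F & graded w v 0 G] /\
  [/\ F *m D = E *m F, D *m G = G *m E, F *m G = 1%:M & G *m F = 1%:M - H *m D - D *m H].
Proof.
exists #|elim_set|, D', (fun a => w (enum_val a)), Phi, Psi, elim_htpy.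
pose v (a : 'I_#|elim_set|) := w (enum_val a).
have gi : graded v w 0 elim_in by exact: select_mx_graded.
have giT : graded w v 0 elim_in^T by exact: select_mx_tr_graded.
have gq : graded w w 0 elim_proj.
  apply: gradedB; first apply: gradedB; first exact: graded1.
    move=> a b; rewrite mxE (bigD1 i)//= big1 => [|k ki]; last first.
      by rewrite !mxE (negbTE ki) andbF mulr0 mul0r.
    rewrite !mxE eqxx andbT addr0; have [->|_] := eqVneq a j; last by rewrite mulr0 mul0r eqxx.
    rewrite mulr1 => nz; have : D i b != 0 by apply: contraNneq nz => ->; rewrite mulr0.
    by move=> /gD; rewrite wij; lia.
  move=> a b; rewrite mxE (bigD1 j)//= big1 => [|k kj]; last first.
    by rewrite !mxE (negbTE kj) !mulr0.
  rewrite !mxE eqxx addr0 /=; have [->|_] := eqVneq b i; last by rewrite !mulr0 eqxx.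
  rewrite mulr1 => nz; have : D a j != 0 by apply: contraNneq nz => ->; rewrite mul0r.
  by move=> /gD ->; rewrite wij; lia.
have gPhi : graded v w 0 Phi by exact: (gradedM gi gq).
have gPsi : graded w v 0 Psi by exact: (gradedM gq giT).
split; split=> //.
- have := cardsC elim_set; rewrite card_ord => e; rewrite -[X in (_ < X)%N]e.
  rewrite -[X in (X < _)%N]addn0 ltn_add2l card_gt0; apply/set0Pn; exists i.
  by rewrite !inE eqxx.
- apply: mulmx_ext => x; rewrite mulmxA -!diffE' mulmx0.
  exact: (@retract_diff2 _ _ _ dlt hh ii pp).
- exact: (gradedM (gradedM gPhi gD) giT).
- apply: mulmx_ext => x; rewrite [LHS]mulmxA [RHS]mulmxA -inE' -diffE' -inE'.
  by rewrite (retract_ind (h := hh) (i := ii) (p := pp)).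
- apply: mulmx_ext => x; rewrite [LHS]mulmxA [RHS]mulmxA -!outE' -diffE'.
  exact: (retract_outd (dlt := dlt) (h := hh) (i := ii) (p := pp)).
- apply: mulmx_ext => x; rewrite [LHS]mulmxA mulmx1 -inE' -outE'.
  exact: (@retract_outK _ _ _ dlt hh ii pp).
- apply: mulmx_ext => x; rewrite [LHS]mulmxA -outE' -inE'.
  by rewrite (retract_inK (h := hh) (i := ii) (p := pp))// projE.
Qed.

End Elimination.

Definition is_minimal_retract (m : {pred R}) n (D : 'M[R]_n) (w : 'I_n -> nat) n'
    (E : 'M[R]_n') (v : 'I_n' -> nat) (F : 'M[R]_(n', n)) (G : 'M[R]_(n, n'))
    (H : 'M[R]_n) : Prop :=
  [/\ forall i j, E i j \in m, E *m E = 0, graded v v 1 E, graded v w 0 F & graded w v 0 G] /\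
  [/\ F *m D = E *m F, D *m G = G *m E, F *m G = 1%:M & G *m F = 1%:M - H *m D - D *m H].

(** Unit entries are eliminated until none is left; the rank drops each time, and the homotopies
    compose as [H1 + G1 H2 F1]. *)
Lemma minimal_retract (m : {pred R}) : (forall x, x \notin m -> invertible x) ->
  forall n (D : 'M[R]_n) (w : 'I_n -> nat), D *m D = 0 -> graded w w 1 D ->
  exists n' (E : 'M[R]_n') (v : 'I_n' -> nat) (F : 'M[R]_(n', n))
    (G : 'M[R]_(n, n')) (H : 'M[R]_n),
  (n' <= n)%N /\ is_minimal_retract m D w E v F G H.
Proof.
move=> locR n; elim/ltn_ind: n => n IH D w D2 gD.
have [Dm|] := pselect (forall i j, D i j \in m).
  exists n, D, w, 1%:M, 1%:M, 0; split=> //.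
  rewrite /is_minimal_retract !mulmx1 !mul1mx mul0mx mulmx0 !subr0.
  by split; split=> //; exact: graded1.
move=> /existsNP[i /existsNP[j /negP/locR[u Du]]].
have [n1 [E1 [v1 [F1 [G1 [H1 [[nn1 E12 gE1 gF1 gG1] [FD1 DG1 FG1 GF1]]]]]]]] := elimination D2 gD Du.
have [n2 [E2 [v2 [F2 [G2 [H2 [n21 [[Em E22 gE2 gF2 gG2] [FD2 DG2 FG2 GF2]]]]]]]]] := IH _ nn1 _ _ E12 gE1.
exists n2, E2, v2, (F2 *m F1), (G1 *m G2), (H1 + G1 *m H2 *m F1); split; first exact: leq_trans n21 (ltnW nn1).
split; split=> //.
- exact: (gradedM gF2 gF1).
- exact: (gradedM gG1 gG2).
- by rewrite -mulmxA FD1 !mulmxA FD2.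
- by rewrite mulmxA DG1 -!mulmxA DG2.
- by rewrite mulmxA -(mulmxA F2) FG1 mulmx1.
- rewrite mulmxA -(mulmxA G1) GF2 mulmxBr mulmxBr mulmx1 mulmxBl mulmxBl GF1.
  rewrite mulmxDl mulmxDr !opprD !addrA; congr (_ - _); last by rewrite !mulmxA DG1.
  rewrite [RHS]addrAC; congr (_ - _ - _).
  by rewrite -!mulmxA FD1.
Qed.

End Graded.

(** * Homology, Betti numbers and resolutions *)

Lemma fsum_nat_ereal (b : nat -> nat) (A : set nat) : finite_set A ->
  exists n : nat, \sum_(j \in A) (((b j)%:R : rat)%:E : \bar rat)%E = ((n%:R : rat)%:E)%E.
Proof.
move=> fA; rewrite fsbig_finite//.
suff H (s : seq nat) : exists n : nat,
    (\sum_(j <- s) (((b j)%:R : rat)%:E : \bar rat) = (n%:R : rat)%:E)%E by exact: H.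
elim: s => [|j s [n IH]]; first by exists 0%N; rewrite big_nil.
by exists (b j + n)%N; rewrite big_cons IH natrD.
Qed.

(* In \bar rat a supremum may fail to exist, but it does for a set of natural numbers. *)
Lemma partial_sum_le_esum (b : nat -> nat) N :
  (((\sum_(j < N) b j)%:R : rat)%:E <=
    \esum_(j in [set: nat]) ((b j)%:R : rat)%:E)%E.
Proof.
rewrite /esum /ereal_sup /supremum; set S := [set _ | _ in _].
have SN : S (((\sum_(j < N) b j)%:R : rat)%:E)%E.
  exists `I_N; first by split=> //; exact: finite_II.
  by rewrite -fsbig_ord natr_sum sumEFin.
have Snat x : S x -> exists n : nat, x = ((n%:R : rat)%:E)%E.
  by move=> [A [fA _] <-]; exact: fsum_nat_ereal.
case: eqP => [S0|_]; first by move: SN; rewrite S0.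
suff [s Ss] : exists s, supremums S s.
  by have [us _] := xgetI -oo%E Ss; exact: us.
have [[K HK]|unb] := pselect (exists K : nat, forall n : nat, S ((n%:R : rat)%:E)%E -> (n <= K)%N).
  have ex : exists n, `[< S ((n%:R : rat)%:E)%E >] by exists (\sum_(j < N) b j)%N; exact/asboolP.
  have bd n : `[< S ((n%:R : rat)%:E)%E >] -> (n <= K)%N by move=> /asboolP /HK.
  case: (ex_maxnP ex bd) => M /asboolP SM HM; exists (M%:R : rat)%:E%E; split.
    move=> x Sx; have [n xn] := Snat x Sx; rewrite xn lee_fin ler_nat; apply: HM.
    by apply/asboolP; rewrite -xn.
  by move=> y; apply.
exists +oo%E; split; first by move=> x _; exact: leey.
move=> [y| |] Hy //; last by have := Hy _ SN.
exfalso; apply: unb; exists (Num.bound `|y|) => n Sn.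
have := Hy _ Sn; rewrite lee_fin => ny; rewrite -(ler_nat rat); apply: le_trans ny _.
exact/ltW/(le_lt_trans (ler_norm y))/archi_boundP/normr_ge0.
Qed.

Section HomologyClasses.
Variables (R : comNzRingType) (m n p : nat) (A : 'M[R]_(m, n)) (B : 'M[R]_(n, p)).

Definition hclass (z : 'rV[R]_n) (zB : z *m B = 0) : mx_homology A B :=
  quot_class (boundary_submod A B) (Cycles (introT eqP zB)).

Lemma hclass_eq0 z (zB : z *m B = 0) :
  hclass zB = 0 <-> exists y, y *m A = z.
Proof.
rewrite -[0 in X in X <-> _](_ : quot_class (boundary_submod A B) 0 = 0); last first.
  exact: (raddf0 (\pi_(Quotient.quot (submod_zmod (boundary_submod A B))))%qT).
split=> [/eqP|H].
  by rewrite /hclass quot_classE subr0 => /asboolP.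
by apply/eqP; rewrite /hclass quot_classE subr0; exact/asboolP.
Qed.

Lemma hclass_surj (u : mx_homology A B) : exists (z : 'rV_n) (zB : z *m B = 0), u = hclass zB.
Proof.
have [[z zB] ->] := quot_class_surj u.
exists z, (elimT eqP zB); rewrite /hclass; congr quot_class.
exact: val_inj.
Qed.

Lemma hclass_linear a z1 z2 (z1B : z1 *m B = 0) (z2B : z2 *m B = 0)
    (zB : (a *: z1 + z2) *m B = 0) :
  hclass zB = a *: hclass z1B + hclass z2B.
Proof.
rewrite -[a *: hclass z1B]/(quot_scale a (hclass z1B)) /hclass -quot_classZ -quot_classD.
by congr quot_class; apply: val_inj.
Qed.

Lemma nontrivial_homology :
  nontrivial (mx_homology A B) <-> exists z : 'rV_n, z *m B = 0 /\ ~ exists y, y *m A = z.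
Proof.
split=> [[u /eqP u0]|[z [zB H]]].
  have [z [zB uE]] := hclass_surj u; exists z; split=> // H; apply: u0.
  by rewrite uE; apply/hclass_eq0.
by exists (hclass zB); apply/eqP => /hclass_eq0.
Qed.

End HomologyClasses.

Lemma vdimE (k : fieldType) (V : lmodType k) n (e : {linear 'rV[k]_n -> V}) :
  bijective e -> vdim V = n.
Proof.
move=> be; rewrite /vdim; apply: (@xget_unique _ 0%N); first by exists e.
have le_dim n1 n2 (e1 : {linear 'rV[k]_n1 -> V}) (e2 : {linear 'rV[k]_n2 -> V}) :
    bijective e1 -> bijective e2 -> (n1 <= n2)%N.
  move=> [g1 e1K g1K] [g2 e2K g2K].
  have lin m1 (f : {linear 'rV[k]_m1 -> V}) f1 : cancel f f1 -> cancel f1 f -> linear f1.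
    by move=> K1 K2 a u v; apply: (can_inj K1); rewrite linearP !K2.
  pose G1 : {linear V -> 'rV[k]_n1} := HB.pack g1 (GRing.isLinear.Build _ _ _ _ g1 (lin _ _ _ e1K g1K)).
  pose G2 : {linear V -> 'rV[k]_n2} := HB.pack g2 (GRing.isLinear.Build _ _ _ _ g2 (lin _ _ _ e2K g2K)).
  apply: (@mulmx1_min _ _ _ (lin1_mx (G2 \o e1)) (lin1_mx (G1 \o e2))).
  apply: mulmx_ext => x; rewrite mulmxA !mul_rV_lin1 mulmx1 /=.
  by rewrite -[e2 (g2 _)]g2K e2K g2K e1K.
by move=> n' [e' be']; apply/eqP; rewrite eqn_leq (le_dim _ _ _ _ be' be) (le_dim _ _ _ _ be be').
Qed.

(** If [a^n u] were nonzero, the submodules generated by [a^(n+1) u], ..., [a u], [u] would form a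
    strict chain of length [n + 1]: equality of two neighbours gives [(1 - r a) a^k u = 0], and
    [1 - r a] is a unit. *)
Lemma finite_length_power (R : comNzRingType) (m : {pred R}) (M : lmodType R) a :
  noetherian_local m -> finite_length M -> a \in m ->
  exists N, forall u : M, a ^+ N *: u = 0.
Proof.
move=> locR [n Hn] am; exists n => u; apply: contrapT => nz.
have [_ [[m0 m1 mD] _] _] := locR.
pose c i : {pred M} := fun x => `[< exists r, x = r *: (a ^+ (n.+1 - i) *: u) >].
suff /Hn : strict_chain (fun N : {pred M} => GRing.submod_closed N) n.+1 c by rewrite ltnn.
split=> [i _|i id].
  split; first by rewrite unfold_in; apply/asboolP; exists 0; rewrite scale0r.
  move=> b x y /asboolP[r ->] /asboolP[r' ->]; rewrite unfold_in; apply/asboolP.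
  by exists (b * r + r'); rewrite scalerDl !scalerA mulrA.
split.
  move=> x; rewrite !unfold_in => /asboolP[r ->]; apply/asboolP; exists (r * a).
  by rewrite -!scalerA; congr (_ *: _); rewrite scalerA -exprS; congr (_ ^+ _ *: _); lia.
move=> H; apply: nz.
have : a ^+ (n.+1 - i.+1) *: u \in c i.+1.
  by rewrite unfold_in; apply/asboolP; exists 1; rewrite scale1r.
move=> /H; rewrite unfold_in => /asboolP[r].
have -> : (n.+1 - i = (n - i).+1)%N by lia.
rewrite subSS exprS -scalerA scalerA => /eqP; rewrite -subr_eq0 -{1}[_ *: u]scale1r -scalerBl => /eqP e.
have [|y ry] := local_invertible (x := 1 - r * a) locR.
  apply/negP => H1; move/negP: m1; apply.
  have -> : 1 = r * a + (1 - r * a) by rewrite addrC subrK.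
  exact: mD.
have e0 : a ^+ (n - i) *: u = 0.
  by rewrite -[LHS]scale1r -ry mulrC -scalerA e scaler0.
have -> : a ^+ n = a ^+ i * a ^+ (n - i) by rewrite -exprD subnKC.
by rewrite -scalerA e0 scaler0.
Qed.

Section Totalization.
Variables (r : nat -> nat) (N : nat).

(** Basis of the sum of the terms in degrees at most [N]: the rank bound is about one square matrix,
    so the complex is flattened into one differential module. *)
Definition tot_index : seq (nat * nat) :=
  [seq (j, a) | j <- iota 0 N.+1, a <- iota 0 (r j)].
Definition tot_rank : nat := size tot_index.
Definition tot_deg (b : 'I_tot_rank) : nat := (nth (0%N, 0%N) tot_index b).1.

Lemma tot_rankE : tot_rank = (\sum_(j < N.+1) r j)%N.
Proof.
rewrite /tot_rank size_allpairs_dep sumnE big_map -(big_mkord xpredT (fun j => r j)).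
by rewrite /index_iota subn0; apply: eq_bigr => j _; rewrite size_iota.
Qed.

Lemma tot_index_uniq : uniq tot_index.
Proof.
apply: allpairs_uniq_dep; first exact: iota_uniq.
  by move=> j _; exact: iota_uniq.
by move=> [j a] [j' a'] _ _ /= [-> ->].
Qed.

Lemma mem_tot_index j a : ((j, a) \in tot_index) = (j <= N)%N && (a < r j)%N.
Proof.
apply/allpairsPdep/andP => [[j' [a' [+ + [-> ->]]]]|[jN ar]].
  by rewrite !mem_iota !add0n ltnS /= => -> ->.
by exists j, a; rewrite !mem_iota !add0n ltnS.
Qed.

Section Inclusion.
Variable R : comNzRingType.

(* The rows of tot_in j embed R^(r j) as the degree j summand of R^tot_rank. *)
Definition tot_in (j : nat) : 'M[R]_(r j, tot_rank) :=
  \matrix_(a, b) (nth (0%N, 0%N) tot_index b == (j, val a))%:R.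

Lemma tot_inK j : (j <= N)%N -> tot_in j *m (tot_in j)^T = 1%:M.
Proof.
move=> jN; apply/matrixP => a a'; rewrite !mxE.
have Ha : (j, val a) \in tot_index by rewrite mem_tot_index jN ltn_ord.
have Hi : (index (j, val a) tot_index < tot_rank)%N by rewrite index_mem.
rewrite (bigD1 (Ordinal Hi))//= big1 => [|b].
  by rewrite !mxE /= nth_index// eqxx mul1r addr0 xpair_eqE eqxx.
move=> bi; rewrite !mxE; case: (_ =P (j, val a)) => [e|]; rewrite ?mul0r//.
case/eqP: bi; apply: val_inj => /=; rewrite -e index_uniq//.
exact: tot_index_uniq.
Qed.

Lemma tot_in_orth j l : j != l -> tot_in j *m (tot_in l)^T = 0.
Proof.
move=> jl; apply/matrixP => a a'; rewrite !mxE big1// => b _; rewrite !mxE.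
case: (_ =P (j, val a)) => [->|]; rewrite ?mul0r// mul1r xpair_eqE (negbTE jl).
by [].
Qed.

Lemma tot_in_graded j : graded (fun=> j) tot_deg 0 (tot_in j).
Proof.
move=> a b; rewrite mxE addn0 /tot_deg; case: (_ =P (j, val a)) => [->//|].
by rewrite eqxx.
Qed.

Lemma tot_in_sum : \sum_(j < N.+1) (tot_in j)^T *m tot_in j = 1%:M.
Proof.
apply/matrixP => b b'; rewrite summxE mxE.
have /mem_nth : (b < size tot_index)%N by exact: ltn_ord.
move/(_ (0%N, 0%N)); case e: (nth _ _ _) => [j a]; rewrite mem_tot_index => /andP[jN ar].
rewrite -ltnS in jN; rewrite (bigD1 (Ordinal jN))//= big1 => [|l lj]; last first.
  rewrite mxE big1// => c _; rewrite !mxE e xpair_eqE.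
  by case: (j =P l :> nat) => [jl|_]; [case/eqP: lj; exact: val_inj|rewrite mul0r].
rewrite addr0 mxE (bigD1 (Ordinal ar))//= big1 => [|c ca]; last first.
  rewrite !mxE e xpair_eqE eqxx /=.
  by case: (a =P c :> nat) => [ac|_]; [case/eqP: ca; exact: val_inj|rewrite mul0r].
rewrite !mxE e eqxx mul1r addr0 -e; congr (_%:R).
by rewrite nth_uniq ?tot_index_uniq// eq_sym.
Qed.

Lemma tot_in_tr_graded j : graded tot_deg (fun=> j) 0 (tot_in j)^T.
Proof. by move=> b a; rewrite mxE addn0 => /tot_in_graded; rewrite addn0. Qed.

End Inclusion.

Lemma map_tot_in (R S : comNzRingType) (f : {rmorphism R -> S}) j :
  map_mx f (tot_in R j) = tot_in S j.
Proof. by apply/matrixP => a b; rewrite !mxE rmorph_nat. Qed.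

End Totalization.

Lemma graded_sum (R : comNzRingType) p q (v : 'I_p -> nat) (w : 'I_q -> nat) c
    (I : finType) (X : I -> 'M[R]_(p, q)) :
  (forall i, graded v w c (X i)) -> graded v w c (\sum_i X i).
Proof.
move=> H a b; rewrite summxE => nz.
have [|] := boolP [exists i, X i a b != 0]; first by case/existsP => i /H.
rewrite negb_exists => /forallP H0; case/eqP: nz; rewrite big1// => i _.
by have := H0 i; rewrite negbK => /eqP.
Qed.

Section TotalComplex.
Variables (R : comNzRingType) (P : free_complex R) (N : nat).
Local Notation n := (tot_rank (rk P) N).
Local Notation E := (tot_in (rk P) N R).
Local Notation w := (@tot_deg (rk P) N).

Definition tot_diff : 'M[R]_n :=
  \sum_(j < N) (E j.+1)^T *m differential P j *m E j.

Lemma tot_in_diff0 : E 0 *m tot_diff = 0.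
Proof. by rewrite mulmx_sumr big1// => j _; rewrite !mulmxA tot_in_orth// !mul0mx. Qed.

Lemma tot_in_diffS j : (j < N)%N -> E j.+1 *m tot_diff = differential P j *m E j.
Proof.
move=> jN; rewrite mulmx_sumr (bigD1 (Ordinal jN))//= big1 => [|l lj].
  by rewrite addr0 !mulmxA tot_inK// mul1mx.
rewrite !mulmxA tot_in_orth ?mul0mx// eqSS eq_sym; apply: contraNneq lj => lj.
by apply/eqP; exact: val_inj.
Qed.

Lemma tot_diff_proj j : (j < N)%N ->
  tot_diff *m (E j)^T = (E j.+1)^T *m differential P j.
Proof.
move=> jN; rewrite mulmx_suml (bigD1 (Ordinal jN))//= big1 => [|l lj].
  by rewrite addr0 -!mulmxA tot_inK ?mulmx1// ltnW.
rewrite -!mulmxA tot_in_orth ?mulmx0//; apply: contraNneq lj => lj.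
Qed.

Lemma tot_diff2 : tot_diff *m tot_diff = 0.
Proof.
rewrite {1}/tot_diff mulmx_suml big1// => -[[|j] jN] _ /=.
  by rewrite -mulmxA tot_in_diff0 mulmx0.
rewrite -mulmxA tot_in_diffS ?(ltnW jN)// mulmxA -(mulmxA (E j.+2)^T).
by rewrite differential2 mulmx0 mul0mx.
Qed.

Lemma tot_diff_graded : graded w w 1 tot_diff.
Proof.
apply: graded_sum => j.
have gd : graded (fun=> j.+1) (fun=> j : nat) 1 (differential P j).
  by move=> a b _; rewrite addn1.
exact: (gradedM (gradedM (tot_in_tr_graded (r := rk P) (N := N) (j := j.+1)) gd) (tot_in_graded (j := j))).
Qed.

Lemma tot_in_cycle j (x : 'rV[R]_(rk P j)) : (j <= N)%N ->
  x *m diff_out P j = 0 -> x *m E j *m tot_diff = 0.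
Proof.
case: j x => [|j] x jN xD; first by rewrite -mulmxA tot_in_diff0 mulmx0.
by rewrite -mulmxA tot_in_diffS// mulmxA [x *m _]xD mul0mx.
Qed.

Lemma tot_cycle_proj j (z : 'rV[R]_n) : (j <= N)%N ->
  z *m tot_diff = 0 -> z *m (E j)^T *m diff_out P j = 0.
Proof.
case: j => [|j] jN zD; first by rewrite mulmx0.
by rewrite /= -mulmxA -tot_diff_proj// mulmxA zD mul0mx.
Qed.

Lemma tot_split (z : 'rV[R]_n) : z = \sum_(j < N.+1) z *m (E j)^T *m E j.
Proof.
rewrite -[LHS]mulmx1 -(tot_in_sum (rk P) N R) mulmx_sumr.
by apply: eq_bigr => j _; rewrite mulmxA.
Qed.

Lemma tot_boundary j (y : 'rV[R]_(rk P j.+1)) : (j < N)%N ->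
  y *m differential P j *m E j = y *m E j.+1 *m tot_diff.
Proof. by move=> jN; rewrite -!mulmxA tot_in_diffS. Qed.

End TotalComplex.

Lemma map_tot_diff (R S : comNzRingType) (f : {rmorphism R -> S}) (P : free_complex R) N :
  map_mx f (tot_diff P N) = tot_diff (base_change f P) N.
Proof.
rewrite /tot_diff raddf_sum /=; apply: eq_bigr => j _.
by rewrite !map_mxM -map_trmx !map_tot_in.
Qed.

Lemma graded_supp (R : comNzRingType) p q (v : 'I_p -> nat) (w : 'I_q -> nat) c
    (X : 'M[R]_(p, q)) (x : 'rV[R]_p) (Q : nat -> Prop) :
  graded v w c X -> (forall i, x 0 i != 0 -> Q (v i)) ->
  forall j, (x *m X) 0 j != 0 -> Q (w j + c)%N.
Proof.
move=> gX xQ j; rewrite mxE => nz.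
have [|] := boolP [exists i, (x 0 i != 0) && (X i j != 0)].
  by case/existsP => i /andP[/xQ Qi /gX <-].
rewrite negb_exists => /forallP H0; case/eqP: nz; rewrite big1// => i _.
by have := H0 i; rewrite negb_and !negbK => /orP[/eqP->|/eqP->]; rewrite ?mul0r ?mulr0.
Qed.

(** * Truncation at a gap of the minimal model *)

Section Truncated.
Variables (R : comNzRingType) (m : {pred R}) (d : nat) (c : nat -> {pred R}).
Hypotheses (locR : noetherian_local m) (pc : strict_chain (@prime_ideal R) d c).
Hypothesis m2 : (2%:R : R) \in m.
Variables (P : free_complex R) (N L : nat).
Local Notation D := (tot_diff P N).
Local Notation w := (@tot_deg (rk P) N).
Local Notation I_ := (tot_in (rk P) N R).
Hypothesis LN : (L < N)%N.
Hypothesis killP : forall a, a \in m -> exists M, forall j (x : 'rV[R]_(rk P j)), (j <= L)%N ->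
  x *m diff_out P j = 0 -> exists y, a ^+ M *: x = y *m differential P j.
Hypothesis nexact : exists j (x : 'rV[R]_(rk P j)),
  [/\ (j <= L)%N, x *m diff_out P j = 0 & ~ exists y, y *m differential P j = x].
Variables (n' : nat) (E : 'M[R]_n') (v : 'I_n' -> nat) (F : 'M[R]_(n', tot_rank (rk P) N))
  (G : 'M[R]_(tot_rank (rk P) N, n')) (H : 'M[R]_(tot_rank (rk P) N)).
Hypothesis minE : is_minimal_retract m D w E v F G H.
Hypothesis vL : forall b, v b != L.+1.

(** By [vL] the minimal model is zero in degree [L.+1], so no boundaries enter the part in degrees
    at most [L] from above, and truncating there does not enlarge the homology. *)
Definition low : {set 'I_n'} := [set b | (v b <= L)%N]%SET.
Local Notation S_ := (select_mx R low).

Lemma low_supp (x : 'rV[R]_n') :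
  (forall b, x 0 b != 0 -> (v b <= L.+1)%N) -> x *m S_^T *m S_ = x.
Proof.
move=> Hx; apply: select_mx_supp => b /Hx; rewrite inE leq_eqVlt (negbTE (vL b)).
by rewrite ltnS.
Qed.

Lemma tot_in_supp j (x : 'rV[R]_(rk P j)) b : (x *m I_ j) 0 b != 0 -> w b = j.
Proof.
move=> nz; rewrite -[w b]addn0.
by apply: (graded_supp (Q := fun k => k = j) (tot_in_graded (j := j)) _ nz).
Qed.

(** If this part were empty, [G] would kill every cycle of degree at most [L], and the homotopy [H]
    would exhibit it as a boundary, against [nexact]. *)
Lemma low_nonempty : (0 < #|low|)%N.
Proof.
have [[Em E2 gE gF gG] [FD DG FG GF]] := minE.
rewrite lt0n; apply/negP => /eqP/cards0_eq S0.
have [j [x [jL xD nx]]] := nexact; apply: nx.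
have jN : (j < N)%N by exact: leq_ltn_trans LN.
pose z := x *m I_ j.
have zD : z *m D = 0 by apply: tot_in_cycle => //; exact: ltnW.
have zG : z *m G = 0.
  apply/rowP => b; rewrite [RHS]mxE; apply/eqP/contraT => nz.
  have : (v b + 0 <= L)%N.
    by apply: (graded_supp (Q := fun k => (k <= L)%N) gG _ nz) => i /tot_in_supp ->.
  rewrite addn0 => vb; have : b \in low by rewrite inE.
  by rewrite S0 finset.in_set0.
have zE : z = z *m H *m D.
  have : z *m (G *m F) = 0 by rewrite mulmxA zG mul0mx.
  rewrite GF !mulmxBr mulmx1 [z *m (D *m H)]mulmxA zD mul0mx subr0 mulmxA => /eqP.
  by rewrite subr_eq0 => /eqP.
have -> : x = z *m (I_ j)^T by rewrite -mulmxA tot_inK ?mulmx1// ltnW.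
exists (z *m H *m (I_ j.+1)^T).
by rewrite [in RHS]zE -!mulmxA tot_diff_proj.
Qed.

Lemma truncated_bound : (2 ^ d <= 2 * #|low|)%N.
Proof.
have [[Em E2 gE gF gG] [FD DG FG GF]] := minE.
have lowE (x : 'rV[R]_#|low|) : x *m S_ *m E *m S_^T *m S_ = x *m S_ *m E.
  apply: low_supp => b nz.
  have : (v b + 1 <= L)%N; last by lia.
  apply: (graded_supp (Q := fun k => (k <= L)%N) gE _ nz) => i.
  by apply: contraNT => vi; rewrite select_mx0// inE.
pose D' := S_ *m E *m S_^T.
apply: (@local_rank_bound R m d c _ D' (fun a => v (enum_val a))) => //.
- apply: mulmx_ext => x; rewrite /D' mulmx0 !mulmxA.
  by rewrite lowE -(mulmxA (x *m S_)) E2 mulmx0 mul0mx.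
- apply: (@graded_lowering R).
  by have := gradedM (gradedM (@select_mx_graded R _ low v) gE) (@select_mx_tr_graded R _ low v).
- exact: low_nonempty.
- have [_ [[m0 m1 mD] _] _] := locR.
  have msum (I : finType) (f : I -> R) : (forall i, f i \in m) -> \sum_i f i \in m.
    move=> Hf; apply: (big_ind (fun x => x \in m)) => // x y xm ym.
    by rewrite -[x]mul1r; exact: mD.
  have mM x y : x \in m -> y * x \in m by move=> xm; rewrite -[y * x]addr0; exact: mD.
  move=> i j; rewrite /D' !mxE; apply: (msum) => b; rewrite mulrC; apply: (mM).
  by rewrite mxE; apply: (msum) => b'; exact: mM.
- move=> a /killP[M HM]; exists M => z zD'.
  pose z' := z *m S_.
  have z'E : z' *m E = 0.
    by rewrite /z' -lowE -!mulmxA (mulmxA S_) (mulmxA (S_ *m E)) (mulmxA z) zD' mul0mx.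
  have z'D : z' *m F *m D = 0 by rewrite -mulmxA FD mulmxA z'E mul0mx.
  have supp b : (z' *m F) 0 b != 0 -> (w b <= L)%N.
    move=> nz; rewrite -[w b]addn0.
    apply: (graded_supp (Q := fun k => (k <= L)%N) gF _ nz) => i.
    by apply: contraNT => vi; rewrite select_mx0// inE.
  (* The cycle is carried to [P] by [F] and killed there degree by degree; [G] brings the bounding
     element back. *)
  have Hex (j : 'I_L.+1) : exists y : 'rV[R]_(rk P j.+1),
      a ^+ M *: (z' *m F *m (I_ j)^T) = y *m differential P j.
    apply: HM; first by rewrite -ltnS.
    by apply: tot_cycle_proj => //; have := ltn_ord j; lia.
  pose y j := projT1 (cid (Hex j)); 
  have Hy (j : 'I_L.+1) : a ^+ M *: (z' *m F *m (I_ j)^T) = y j *m differential P j := projT2 (cid (Hex j)).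
  pose Y := \sum_(j < L.+1) y j *m I_ j.+1.
  have YD : a ^+ M *: (z' *m F) = Y *m D.
    rewrite {1}[z' *m F](@tot_split R P N) scaler_sumr /Y mulmx_suml.
    have -> : N.+1 = (L.+1 + (N - L))%N by lia.
    rewrite big_split_ord /= [X in _ + X]big1 ?addr0 => [|j _].
      apply: eq_bigr => j _; rewrite scalemxAl Hy.
      by apply: tot_boundary; have := ltn_ord j; lia.
    suff -> : z' *m F *m (I_ (L.+1 + j)%N)^T = 0 by rewrite mul0mx scaler0.
    apply/rowP => b; rewrite [RHS]mxE; apply/eqP/contraT => nz.
    have := graded_supp (Q := fun k => (k <= L)%N) (tot_in_tr_graded (j := (L.+1 + j)%N)) supp nz.
    by rewrite addn0; lia.
  exists (Y *m G *m S_^T).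
  (* [Y] reaches up to degree [L.+1]; the gap confines its image under [G] to [low]. *)
  have YG : Y *m G *m S_^T *m S_ = Y *m G.
    apply: low_supp => b nz.
    rewrite -[v b]addn0; apply: (graded_supp (Q := fun k => (k <= L.+1)%N) gG _ nz) => i.
    apply: contraNT; rewrite -ltnNge => Li; rewrite /Y summxE big1// => j _.
    by apply/eqP/contraT => /tot_in_supp wi; have := ltn_ord j; lia.
  have -> : z = z' *m S_^T by rewrite /z' -mulmxA select_mxK mulmx1.
  rewrite scalemxAl.
  have -> : a ^+ M *: z' = Y *m G *m E.
    by rewrite -(mulmxA Y) -DG mulmxA -YD -scalemxAl -(mulmxA z') FG mulmx1.
  by rewrite /D' !mulmxA YG.
Qed.

End Truncated.

Lemma map_graded (R S : comNzRingType) (f : {rmorphism R -> S}) p q (v : 'I_p -> nat)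
    (w : 'I_q -> nat) c (X : 'M[R]_(p, q)) : graded v w c X -> graded v w c (map_mx f X).
Proof.
by move=> gX i j; rewrite mxE => nz; apply: gX; apply: contraNneq nz => ->; rewrite rmorph0.
Qed.

Section BettiCount.
Variables (R : comNzRingType) (m : {pred R}) (k : fieldType) (pi : {rmorphism R -> k}).
Hypothesis resF : residue_field m pi.
Variables (P : free_complex R) (N : nat).
Local Notation D := (tot_diff P N).
Local Notation w := (@tot_deg (rk P) N).
Variables (n' : nat) (E : 'M[R]_n') (v : 'I_n' -> nat) (F : 'M[R]_(n', tot_rank (rk P) N))
  (G : 'M[R]_(tot_rank (rk P) N, n')) (H : 'M[R]_(tot_rank (rk P) N)).
Hypothesis minE : is_minimal_retract m D w E v F G H.
Variable j : nat.
Hypothesis jN : (j < N)%N.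
Local Notation Pk := (base_change pi P).
Local Notation I_ := (tot_in (rk P) N k).
Local Notation Dk := (tot_diff Pk N).
Local Notation Fk := (map_mx pi F).
Local Notation Gk := (map_mx pi G).
Local Notation Hk := (map_mx pi H).
Local Notation S := [set b | v b == j]%SET.
Local Notation S_ := (select_mx k S).

Let FD : Fk *m Dk = 0.
Proof.
have [[Em E2 gE gF gG] [FD DG FG GF]] := minE.
rewrite -map_tot_diff -map_mxM FD map_mxM; have -> : map_mx pi E = 0.
  by apply/matrixP => a b; rewrite !mxE; apply/eqP; rewrite -(proj2 resF).
by rewrite mul0mx.
Qed.

Let DG : Dk *m Gk = 0.
Proof.
have [[Em E2 gE gF gG] [_ DG _ GF]] := minE.
rewrite -map_tot_diff -map_mxM DG map_mxM; have -> : map_mx pi E = 0.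
  by apply/matrixP => a b; rewrite !mxE; apply/eqP; rewrite -(proj2 resF).
by rewrite mulmx0.
Qed.

Let FG : Fk *m Gk = 1%:M.
Proof. by have [_ [_ _ FG _]] := minE; rewrite -map_mxM FG map_mx1. Qed.

Let GF : Gk *m Fk = 1%:M - Hk *m Dk - Dk *m Hk.
Proof.
have [_ [_ _ _ GF]] := minE.
by rewrite -map_mxM GF !map_mxB map_mx1 !map_mxM map_tot_diff.
Qed.

Let gF : graded v w 0 Fk.
Proof. by have [[_ _ _ gF _] _] := minE; exact: map_graded. Qed.
Let gG : graded w v 0 Gk.
Proof. by have [[_ _ _ _ gG] _] := minE; exact: map_graded. Qed.

Let I_K : I_ j *m (I_ j)^T = 1%:M.
Proof. by apply: tot_inK; exact: ltnW. Qed.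

Let concentrated (z : 'rV[k]_(tot_rank (rk P) N)) :
  (forall b, z 0 b != 0 -> w b = j) -> z *m (I_ j)^T *m I_ j = z.
Proof.
move=> Hz; rewrite [RHS](@tot_split _ Pk N) (bigD1 (Ordinal (ltnW jN : (j < N.+1)%N)))//=.
rewrite big1 ?addr0// => l lj.
suff -> : z *m (I_ l)^T = 0 by rewrite mul0mx.
apply/rowP => b; rewrite [RHS]mxE; apply/eqP/contraT => nz.
have := graded_supp (Q := fun d => d = j) (tot_in_tr_graded (j := l)) Hz nz.
by rewrite addn0 => e; case/eqP: lj; exact: val_inj.
Qed.

Let lift_supp (x : 'rV[k]_#|S|) b : (x *m S_ *m Fk) 0 b != 0 -> w b = j.
Proof.
move=> nz; rewrite -[w b]addn0; apply: (graded_supp (Q := fun d => d = j) gF _ nz) => i.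
by move=> nz'; apply/eqP; apply: contraNT nz' => vi; rewrite select_mx0// inE.
Qed.

Let rep (x : 'rV[k]_#|S|) := x *m S_ *m Fk *m (I_ j)^T.

Let rep_cycle x : rep x *m diff_out Pk j = 0.
Proof.
apply: tot_cycle_proj; first exact: ltnW.
transitivity (x *m S_ *m (Fk *m Dk)); first exact/esym/mulmxA.
by rewrite FD mulmx0.
Qed.

Let class (x : 'rV[k]_#|S|) : homology Pk j := hclass (differential Pk j) (rep_cycle x).

Fact class_linear : linear class.
Proof.
move=> a x y; rewrite /class.
have e : rep (a *: x + y) = a *: rep x + rep y.
  by rewrite /rep !mulmxDl -!scalemxAl.
have c' : (a *: rep x + rep y) *m diff_out Pk j = 0 by rewrite -e rep_cycle.
rewrite -(hclass_linear _ _ _ c'); move: (rep_cycle _) c'; rewrite e => c1 c2.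
by congr hclass; exact: Prop_irrelevance.
Qed.

(** Over the residue field the minimal differential becomes zero, so each basis vector of degree [j]
    contributes one dimension. Surjectivity uses the homotopy [GF]; injectivity holds because [G]
    kills boundaries. *)
Lemma betti_count : vdim (homology Pk j) = #|S|.
Proof.
pose e : {linear 'rV[k]_#|S| -> homology Pk j} :=
  HB.pack class (GRing.isLinear.Build _ _ _ _ class class_linear).
apply: (vdimE (e := e)).
suff [g' [eK gK]] : exists g, cancel g e /\ injective e.
  by exists g' => // x; apply: gK; exact: eK.
have surj u : exists x, e x = u.
  have [z [zB ->]] := hclass_surj u; pose Z := z *m I_ j.
  have ZD : Z *m Dk = 0 by apply: tot_in_cycle => //; exact: ltnW.
  exists (Z *m Gk *m S_^T); apply/eqP; rewrite -subr_eq0; apply/eqP.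
  have zG : Z *m Gk *m S_^T *m S_ = Z *m Gk.
    apply: select_mx_supp => b nz; rewrite inE -[v b]addn0; apply/eqP.
    apply: (graded_supp (Q := fun d => d = j) gG _ nz) => i nzi.
    rewrite -[tot_deg i]addn0.
    by apply: (graded_supp (Q := fun d => d = j) (tot_in_graded (j := j)) _ nzi).
  have cyc : (rep (Z *m Gk *m S_^T) - z) *m diff_out Pk j = 0.
    by rewrite mulmxBl rep_cycle zB subrr.
  have -> : e (Z *m Gk *m S_^T) - hclass (differential Pk j) zB = hclass (differential Pk j) cyc.
    have cyc' : (-1 *: z + rep (Z *m Gk *m S_^T)) *m diff_out Pk j = 0.
      by rewrite scaleN1r addrC.
    transitivity (hclass (differential Pk j) cyc').
      by rewrite (hclass_linear (differential Pk j) zB (rep_cycle _)) scaleN1r addrC.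
    move: cyc cyc'; rewrite scaleN1r addrC => c1 c2.
    by congr hclass; exact: Prop_irrelevance.
  apply/hclass_eq0; exists (- (Z *m Hk *m (I_ j.+1)^T)).
  have a1 : Z *m Hk *m ((I_ j.+1)^T *m differential Pk j) = Z *m Hk *m (Dk *m (I_ j)^T) :=
    congr1 (mulmx (Z *m Hk)) (esym (tot_diff_proj Pk jN)).
  transitivity (- (Z *m Hk *m (Dk *m (I_ j)^T))); first by rewrite -a1 mulNmx mulmxA.
  have ZGF : Z *m Gk *m Fk = Z - Z *m Hk *m Dk.
    rewrite -mulmxA GF !mulmxBr mulmx1 !mulmxA.
    have -> : Z *m Dk *m Hk = 0 by rewrite [Z *m Dk]ZD mul0mx.
    by rewrite subr0.
  have ZI : Z *m (I_ j)^T = z.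
    transitivity (z *m (I_ j *m (I_ j)^T)); first exact/esym/mulmxA.
    by rewrite I_K mulmx1.
  by rewrite /rep zG ZGF mulmxBl ZI addrAC subrr add0r !mulmxA.
have /choice[g Hg] := surj; exists g; split=> // x y exy.
apply/eqP; rewrite -subr_eq0; apply/eqP.
have : e (x - y) = 0 by rewrite linearB exy subrr.
move=> /hclass_eq0[u uE]; set t := x - y in uE *.
have tE : t *m S_ *m Fk = u *m I_ j.+1 *m Dk.
  rewrite -(concentrated (@lift_supp t)) -[t *m S_ *m Fk *m _]/(rep t) -uE.
  exact: (tot_boundary (P := Pk)).
rewrite -[t]mulmx1 -(select_mxK k S) mulmxA -[t *m S_]mulmx1 -FG mulmxA tE.
transitivity (u *m I_ j.+1 *m (Dk *m Gk) *m S_^T); first by rewrite !mulmxA.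
by rewrite DG mulmx0 mul0mx.
Qed.

End BettiCount.

Section Resolutions.
Variable R : comNzRingType.
Hypothesis nR : noeth R.

Lemma kernel_mx n (N : set 'rV[R]_n) : submodule N ->
  exists r (L : 'M[R]_(r, n)), forall x, N x <-> exists y, y *m L = x.
Proof.
move=> sN; have [I [u [Nu Hu]]] := noeth_row nR sN.
exists #|I|, (\matrix_i u (enum_val i)) => x; split=> [/Hu[a ->]|[y <-]].
  exists (\row_i a (enum_val i)); rewrite mulmx_sum_row.
  rewrite (reindex (@enum_val I predT)); last exact: (onW_bij _ (@enum_val_bij I)).
  by apply: eq_bigr => i _; rewrite mxE rowK.
rewrite mulmx_sum_row; apply: submodule_sum => // i _; apply: submoduleZ => //.
by rewrite rowK.
Qed.

(** A matrix together with its size, so that passing to generators of the kernel can be iterated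
    although the sizes change. *)
Definition mx_state := {p : nat * nat & 'M[R]_(p.1, p.2)}.

Fact mx_kernel_ex (K : mx_state) : exists r (L : 'M[R]_(r, (tag K).1)),
  forall x : 'rV[R]_(tag K).1, x *m tagged K = 0 <-> exists y, y *m L = x.
Proof.
apply: kernel_mx; split; first by rewrite mul0mx.
by move=> a x y x0 y0; rewrite mulmxDl -scalemxAl x0 y0 scaler0 addr0.
Qed.

Definition mx_next (K : mx_state) : mx_state :=
  let r := projT1 (cid (mx_kernel_ex K)) in
  existT (fun p : nat * nat => 'M[R]_(p.1, p.2)) (r, (tag K).1)
    (projT1 (cid (projT2 (cid (mx_kernel_ex K))))).

Lemma mx_nextP (K : mx_state) (x : 'rV[R]_(tag K).1) :
  x *m tagged K = 0 <-> exists y, y *m (tagged (mx_next K) : 'M_(_, (tag K).1)) = x.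
Proof. exact: (projT2 (cid (projT2 (cid (mx_kernel_ex K)))) x). Qed.

Lemma free_resolution_exists (M : lmodType R) : fin_gen [set: M] ->
  exists P, free_resolution M P.
Proof.
move=> [I [u [_ Hu]]].
pose eps (x : 'rV[R]_#|I|) : M := \sum_i x 0 i *: u (enum_val i).
have epsl : linear eps.
  move=> a x y; rewrite /eps scaler_sumr -big_split; apply: eq_bigr => i _ /=.
  by rewrite !mxE scalerDl scalerA.
pose Eps : {linear 'rV[R]_#|I| -> M} := HB.pack eps (GRing.isLinear.Build _ _ _ _ eps epsl).
have [r [L HL]] : exists r (L : 'M[R]_(r, #|I|)), forall x, Eps x = 0 <-> exists y, y *m L = x.
  apply: (kernel_mx (N := fun x => Eps x = 0)); split; first exact: linear0.
  by move=> a x y x0 y0; rewrite linearP x0 y0 scaler0 addr0.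
pose K0 : mx_state := existT (fun p : nat * nat => 'M[R]_(p.1, p.2)) (r, #|I|) L.
pose K i : mx_state := iter i mx_next K0.
pose rk i := (tag (K i)).2.
pose dif i : 'M[R]_(rk i.+1, rk i) := tagged (K i).
have dif2 i : dif i.+1 *m dif i = 0.
  apply: mulmx_ext => x; rewrite mulmx0 mulmxA; apply/(mx_nextP (K := K i)).
  by exists x.
exists (FreeComplex dif2); split.
  exists Eps; split; last by move=> x; exact: HL.
  move=> y; have [//|a ->] := Hu y.
  exists (\row_i a (enum_val i)); rewrite /= /eps.
  rewrite [RHS](reindex (@enum_val I predT)); last exact: (onW_bij _ (@enum_val_bij I)).
  by apply: eq_bigr => i _; rewrite mxE.
move=> i /nontrivial_homology[z [zB]]; apply.
exact: (proj1 (mx_nextP (K := K i) z) zB).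
Qed.

End Resolutions.

Lemma has_chain_strict_chain (R : comNzRingType) (M : lmodType R) l (N : set M) Z :
  submodule N -> has_chain Z l N ->
  exists c, strict_chain (fun N : {pred M} => GRing.submod_closed N) l c /\
    forall x, (x \in c 0%N) <-> N x.
Proof.
have pred_sub (N' : set M) : submodule N' ->
    GRing.submod_closed ((fun x => `[< N' x >]) : {pred M}).
  move=> sN'; split; first by rewrite unfold_in; apply/asboolP; exact: submodule0.
  move=> a x y; rewrite !unfold_in => /asboolP Nx /asboolP Ny; apply/asboolP.
  exact: (proj2 sN').
have predE (N' : set M) x : (x \in ((fun x => `[< N' x >]) : {pred M})) <-> N' x.
  by rewrite unfold_in; split=> /asboolP.
elim: l N => [|l IH] N sN.
  move=> _; exists (fun _ x => `[< N x >]); split; last exact: predE.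
  by split=> // i _; exact: pred_sub.
move=> [N' [sN' NN' _ nN' ch]]; have [c [[c1 c2] c0]] := IH _ sN' ch.
exists (fun i => if i is i'.+1 then c i' else fun x => `[< N x >]); split; last exact: predE.
split=> [[_|i il]|[_|i il]]; [exact: pred_sub|exact: c1| |exact: c2].
split=> [x /predE Nx|H]; first by apply/c0; exact: NN'.
by apply: nN' => x N'x; apply/predE; apply: H; exact/c0.
Qed.

Lemma finite_length_fin_gen (R : comNzRingType) (M : lmodType R) :
  finite_length M -> fin_gen [set: M].
Proof.
move=> [n Hn].
have s0 : submodule [set (0 : M)] by split=> // a x y -> ->; rewrite scaler0 addr0.
apply: (@fin_gen_length _ _ [set 0] setT n) => //.
  by apply: fin_gen_sub0.
move=> l ch; have [c [Hc _]] := has_chain_strict_chain s0 ch.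
exact: Hn Hc.
Qed.

Lemma tot_deg_rank (r : nat -> nat) N (b : 'I_(tot_rank r N)) : (0 < r (tot_deg b))%N.
Proof.
rewrite /tot_deg; case: b => b bl /=.
have := mem_nth (0%N, 0%N) bl; case: (nth _ _ _) => j a; rewrite mem_tot_index => /andP[_].
exact: leq_ltn_trans.
Qed.

Lemma rat_bound d s : (2 ^ d <= 2 * s)%N -> (2 : rat) ^ (d%:Z - 1) <= s%:R.
Proof.
move=> H; rewrite expfzDr// exprN1 ler_pdivrMr// -natrM mulnC.
by rewrite -exprnP -natrX ler_nat.
Qed.

(** A row of [F] cannot be zero when [F *m G = 1%:M], so the minimal model has no degrees beyond
    those of the original. *)
Lemma graded_row_deg (R : comNzRingType) p q (v : 'I_p -> nat) (w : 'I_q -> nat)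
    (F : 'M[R]_(p, q)) (G : 'M[R]_(q, p)) b :
  graded v w 0 F -> F *m G = 1%:M -> exists i, v b = w i.
Proof.
move=> gF FG; apply: contrapT => Hb.
have : (F *m G) b b = 0.
  rewrite mxE big1// => i _; have [->|/gF e] := eqVneq (F b i) 0; first by rewrite mul0r.
  by case: Hb; exists i; rewrite e addn0.
by rewrite FG mxE eqxx => /eqP; rewrite oner_eq0.
Qed.

(** * The bounds for tiny complexes and for resolutions *)

Section Local.
Variables (R : comNzRingType) (m : {pred R}) (d : nat) (c : nat -> {pred R}).
Hypotheses (locR : noetherian_local m) (pc : strict_chain (@prime_ideal R) d c).
Hypothesis m2 : (2%:R : R) \in m.

(** Here [L = d]: the gap in degree [d.+1] holds because the complex itself is zero there, and the
    minimal model is no larger than the complex. *)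
Lemma tiny_complex_rank (P : free_complex R) : tiny_complex d P -> (2 ^ d <= 2 * \sum_(j < d.+1) rk P j)%N.
Proof.
move=> [rk0 finH [i ntH]].
have Hex (j : nat) a : exists M, a \in m -> forall u : homology P j, a ^+ M *: u = 0.
  have [am|] := boolP (a \in m); last by exists 0%N.
  by have [M HM] := finite_length_power locR (finH j) am; exists M.
have kill a : a \in m -> exists M, forall j (x : 'rV[R]_(rk P j)), (j <= d)%N ->
    x *m diff_out P j = 0 -> exists y, a ^+ M *: x = y *m differential P j.
  move=> am; have /choice[Mj HMj] j := Hex j a.
  (* One exponent for all degrees up to [d]. *)
  exists (\max_(j < d.+1) Mj j)%N => j x jd xD.
  have xD' : (a ^+ Mj j *: x + 0) *m diff_out P j = 0.
    by rewrite addr0 -scalemxAl xD scaler0.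
  have : hclass (differential P j) xD' = 0.
    rewrite (hclass_linear (differential P j) xD (mul0mx _ _)) HMj// add0r.
    by apply/hclass_eq0; exists 0; rewrite mul0mx.
  move=> /hclass_eq0[y yE]; rewrite addr0 in yE.
  have le : (Mj j <= \max_(j < d.+1) Mj j)%N by apply: (leq_bigmax (Ordinal (jd : (j < d.+1)%N))).
  exists (a ^+ (\max_(j < d.+1) Mj j - Mj j) *: y).
  by rewrite -scalemxAl yE scalerA -exprD subnK.
have inv := local_invertible locR.
have [n' [E [v [F [G [H [n'n minE]]]]]]] :=
  minimal_retract (fun x => @inv x) (tot_diff2 P d.+1) (@tot_diff_graded _ P d.+1).
have [[_ _ _ gF _] [_ _ FG _]] := minE.
have vd b : v b != d.+1.
  have [i0 ->] := graded_row_deg b gF FG; apply/eqP => e.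
  by have := tot_deg_rank i0; rewrite e rk0.
have := truncated_bound locR pc m2 (ltnSn d) kill _ minE vd => /(_ _)/leq_trans; apply.
  have [z [zB Hz]] := proj1 (nontrivial_homology _ _) ntH.
  exists i, z; split=> //; rewrite leqNgt; apply/negP => /rk0 ri; apply: Hz.
  exists 0; rewrite mul0mx; apply/rowP => b; have := ltn_ord b; by rewrite {2}ri.
rewrite leq_mul2l /=; apply: leq_trans (max_card _) _; rewrite card_ord.
by apply: leq_trans n'n _; rewrite tot_rankE big_ord_recr /= rk0// addn0.
Qed.

(** Here the gap is degree [N.+1], where the Betti number vanishes. Homology is killed by a power of
    [a] because it is [M] in degree 0 and zero above; the rank of the truncated model is the sum of
    the Betti numbers. *)
Lemma resolution_betti (k : fieldType) (pi : {rmorphism R -> k}) (M : lmodType R) P N :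
  residue_field m pi -> nontrivial M -> finite_length M -> free_resolution M P ->
  (forall j, (N < j)%N -> vdim (homology (base_change pi P) j) = 0%N) ->
  (2 ^ d <= 2 * \sum_(j < N.+1) vdim (homology (base_change pi P) j))%N.
Proof.
move=> resF [u u0] finM [[eps [epsS epsK]] exP] b0.
have inv := local_invertible locR.
(* Totalizing up to [N.+2] lets [betti_count] reach degree [N.+1], where the gap is read off. *)
have [n' [E [v [F [G [H [_ minE]]]]]]] :=
  minimal_retract (fun x => @inv x) (tot_diff2 P N.+2) (@tot_diff_graded _ P N.+2).
have count j : (j < N.+2)%N -> vdim (homology (base_change pi P) j) = #|[set b | v b == j]%SET|.
  by move=> jN; exact: (betti_count resF minE jN).
have vN b : v b != N.+1.
  apply/negP => vb; have := count N.+1 (ltnSn _); rewrite b0// => /esym/cards0_eq/setP/(_ b).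
  by rewrite !inE vb.
have kill a : a \in m -> exists M, forall j (x : 'rV[R]_(rk P j)), (j <= N)%N ->
    x *m diff_out P j = 0 -> exists y, a ^+ M *: x = y *m differential P j.
  move=> am; have [K HK] := finite_length_power locR finM am.
  exists K => -[|j] x _ xD.
    have /epsK[y <-] : eps (a ^+ K *: x) = 0 by rewrite linearZ /= HK.
    by exists y.
  have [y <-] : exists y, y *m differential P j.+1 = x.
    apply: contrapT => nx; apply: (exP j); apply/nontrivial_homology.
    by exists x.
  by exists (a ^+ K *: y); rewrite scalemxAl.
have NN : (N < N.+2)%N by [].
have := truncated_bound locR pc m2 NN kill _ minE vN => /(_ _)/leq_trans; apply.
  have [x xu] := epsS u; exists 0%N, x; split=> //; first exact: mulmx0.
  by move=> /epsK; rewrite xu => /eqP; rewrite (negbTE u0).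
rewrite leq_mul2l /=; apply: eq_leq.
rewrite (eq_bigr (fun j : 'I_N.+1 => #|[set b | v b == j]%SET|)); last first.
  by move=> j _; apply: count; rewrite ltnS ltnW.
rewrite -sum1_card (partition_big (fun b => inord (v b) : 'I_N.+1) xpredT)//=.
apply: eq_bigr => j _; rewrite -sum1_card; apply: eq_bigl => b; rewrite !inE.
apply/andP/eqP => [[vb /eqP <-]|vb]; first by rewrite inordK.
by have := ltn_ord j; rewrite -vb ltnS => vN'; split=> //; apply/eqP/val_inj; rewrite /= inordK.
Qed.

End Local.

Theorem corollary1p10 (R : comNzRingType) (m : {pred R}) (k : fieldType)
    (pi : {rmorphism R -> k}) (d : nat) :
  noetherian_local m -> residue_field m pi -> krull_dim R d ->
  2%N \in [pchar k] ->
  (forall P : free_complex R, tiny_complex d P ->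
     (2 : rat) ^ (d%:Z - 1) <= (\sum_(j < d.+1) rk P j)%:R) /\
  (forall M : lmodType R, nontrivial M -> finite_length M ->
     (((2 : rat) ^ (d%:Z - 1))%:E <= total_betti pi M)%E).
Proof.
move=> locR resF [[c pc] _] k2.
have m2 : (2%:R : R) \in m by rewrite (proj2 resF) rmorph_nat; rewrite (pcharf0 k2).
split=> [P tP|M ntM finM]; first by apply: rat_bound; exact: (tiny_complex_rank locR pc m2 tP).
have nR : noeth R by apply: noetherian_noeth; case: locR.
have resM : free_resolution M (resolution M).
  rewrite /resolution; case: pselect => [ex|[]]; first exact: (projT2 (cid ex)).
  exact/free_resolution_exists/finite_length_fin_gen.
suff [N HN] : exists N, (2 ^ d <= 2 * \sum_(j < N) betti pi M j)%N.
  by apply: le_trans (partial_sum_le_esum (betti pi M) N); rewrite lee_fin; exact: rat_bound.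
(* Either the Betti numbers vanish from some degree on, which yields the gap, or infinitely many are
   positive and the partial sums exceed every bound. *)
have [[N b0]|unb] := pselect (exists N, forall j, (N < j)%N -> betti pi M j = 0%N).
  by exists N.+1; exact: (resolution_betti locR pc m2 resF ntM finM resM b0).
suff [N HN] : exists N, (2 ^ d <= \sum_(j < N) betti pi M j)%N.
  by exists N; apply: leq_trans HN _; rewrite leq_pmull.
elim: (2 ^ d)%N => [|s [N HN]]; first by exists 0%N.
have /existsNP[j /not_implyP[Nj /eqP bj]] : ~ forall j, (N < j)%N -> betti pi M j = 0%N.
  by move=> H; apply: unb; exists N.
exists j.+1; rewrite big_ord_recr /= -addn1; apply: leq_add; last by rewrite lt0n.
apply: leq_trans HN _; rewrite -(subnKC (ltnW Nj)) big_split_ord /=; exact: leq_addr.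
Qed.
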